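(* Consider a fixed Fourier Neural Operator with $T$ layers satisfying assumptions (A1)–(A5) listed in the context. Let $\mathcal{A}_c\subset\mathcal{A}$ be compact (in $H^s(\mathbb{T}^d;\mathbb{R}^{d_a})$) and let $1\le t\le T$. For $a\in\mathcal{A}_c$ let $v_t(a)=\mathsf{L}_{t-1}\circ\cdots\circ\mathsf{L}_0\circ\mathcal{P}(a)$ be the continuum state and, for an integer $N>1$ with $K<N/2$, let $v_t^N(a)=\mathsf{L}^N_{t-1}\circ\cdots\circ\mathsf{L}^N_0\circ\mathcal{P}(a)$ be the discretized state on the grid $X^{(N)}$. Then there is a constant $C$, depending on $B,M,d,s,t$ and $\mathcal{A}_c$ (for the fixed FNO) and not on $N$, such that for all such $N$ $$\sup_{a\in\mathcal{A}_c}\frac{1}{N^{d/2}}\Big(\sum_{n\in[N]^d}|v_t(a)(x_n)-v_t^N(a)(x_n)|^2\Big)^{1/2}\le C N^{-s}.$$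
   Context: Notation. $\mathbb{T}^d$ is $[0,1]^d$ with periodic boundary conditions; $|\cdot|$ is the Euclidean norm; $\|\cdot\|_2$ is the induced matrix 2-norm; $\|\cdot\|_F$ is the Frobenius norm. For an integer $s\ge 0$, $H^s(\mathbb{T}^d;\mathbb{R}^m)$ is the Sobolev space of $f$ with $\sum_{k\in\mathbb{Z}^d}(1+|k|^{2s})|\widehat f(k)|^2<\infty$, where $\widehat f(k)=\int_{\mathbb{T}^d}f(x)e^{-2\pi i\langle k,x\rangle}dx$. For $s>d/2$ elements are identified with their continuous representatives. $[N]^d=\{n\in\mathbb{Z}_{\ge0}^d: n_i<N\ \forall i\}$, $x_n=n/N$, $X^{(N)}=\{x_n:n\in[N]^d\}$. For a positive integer $J$, $[[J]]=\{-L,\dots,L\}$ if $J=2L+1$ and $[[J]]=\{-L,\dots,L-1\}$ if $J=2L$; $[[J]]^d$ is its $d$-fold product. For $v$ given on the grid, $\mathsf{DFT}(v)(k)=\frac1{N^d}\sum_{n\in[N]^d}v(x_n)e^{-2\pi i\langle k,x_n\rangle}$. A shallow neural network is a map $\phi(u)=\sigma(A_1u+b)$ with matrix $A_1$, vector $b$ and activation $\sigma$; $\|\phi\|_{\mathrm{NN}}^2:=\|A_1\|_F^2+|b|^2$. Fourier Neural Operator (FNO). $\Psi=\mathcal{Q}\circ\mathsf{L}_{T-1}\circ\cdots\circ\mathsf{L}_0\circ\mathcal{P}$, mapping a space $\mathcal{A}$ of $\mathbb{R}^{d_a}$-valued functions on $\mathbb{T}^d$ to $\mathbb{R}^{d_u}$-valued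 functions. Here $\mathcal{P}:\mathbb{R}^{d_a}\to\mathbb{R}^{d_0}$ and $\mathcal{Q}:\mathbb{R}^{d_T}\to\mathbb{R}^{d_u}$ are shallow neural networks with globally Lipschitz $C^\infty$ activations $\sigma_p,\sigma_q$, acting pointwise in $x$. The layers are $\mathsf{L}_tv=\sigma_t(W_tv+\mathcal{K}_tv+b_t)$, $t=0,\dots,T-1$, with $W_t\in\mathbb{R}^{d_{t+1}\times d_t}$, $b_t\in\mathbb{R}^{d_{t+1}}$, and $\sigma_t:\mathbb{R}^{d_{t+1}}\to\mathbb{R}^{d_{t+1}}$ a globally Lipschitz, non-polynomial $C^\infty$ activation applied pointwise in $x$. The kernel operator is $$(\mathcal{K}_tv)(x)=\sum_{k\in[[K]]^d}P_t^{(k)}\,\widehat v(k)\,e^{2\pi i\langle k,x\rangle},$$ with $P_t^{(k)}\in\mathbb{C}^{d_{t+1}\times d_t}$ such that $\mathcal{K}_t$ maps real-valued functions to real-valued functions, and $K$ a fixed positive integer (mode truncation). Write $\|P_t\|_F^2=\sum_{k\in[[K]]^d}\|P_t^{(k)}\|_F^2$. States. $v_0(a)=\mathcal{P}(a)$ and $v_{t+1}(a)=\mathsf{L}_tv_t(a)$. Discretized FNO. With the same parameters, $v_0^N(a)=\mathcal{P}(a)$ on $X^{(N)}$ and $v_{t+1}^N=\mathsf{L}_t^Nv_t^N=\sigma_t(W_tv_t^N+\mathcal{K}_t^Nv_t^N+b_t)$ on $X^{(N)}$, where $$(\mathcal{K}_t^Nv)(x_n)=\sum_{k\in[[K]]^d}P_t^{(k)}\,\mathsf{DFT}(v)(k)\,e^{2\pi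 i\langle k,x_n\rangle}.$$ Assumptions. (A1) There is $B\ge1$ such that $\sigma_t$ ($0\le t\le T-1$), $\sigma_p$, $\sigma_q$ have continuous derivatives of orders $1,\dots,s$ bounded by $B$ (in the norm of multilinear maps between Euclidean spaces). (A2) $\mathcal{A}\subset H^s(\mathbb{T}^d;\mathbb{R}^{d_a})$. (A3) $1\le K<N/2$. (A4) $s>d/2$, $s$ an integer. (A5) There is $M\ge1$ such that $\|P_t\|_F\le M$, $\|W_t\|_2\le M$, $|b_t|\le M$ for all $0\le t\le T-1$; and $\mathcal{P},\mathcal{Q}$ are smooth and bounded in the sense that $\|\mathcal{P}\|_{\mathrm{NN}}\le M$, $\|\mathcal{Q}\|_{\mathrm{NN}}\le M$. *)

(* Defs.v *)
From HB Require Import structures.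
From mathcomp Require Import all_boot all_order all_algebra.
From mathcomp Require Import complex.
From mathcomp Require Import all_classical all_reals all_analysis.
From mathcomp Require mpoly.

Set Implicit Arguments.
Unset Strict Implicit.
Unset Printing Implicit Defensive.

Import Order.TTheory GRing.Theory Num.Theory.
Import numFieldNormedType.Exports.

Local Open Scope classical_set_scope.
Local Open Scope ring_scope.

Section Norms.
Variable R : realType.

(* On column vectors this is the Euclidean norm; the library norm on matrices
   is the sup norm, which is used only for topology and differentiability. *)
Definition frob m n (A : 'M[R]_(m, n)) : R :=
  Num.sqrt (\sum_i \sum_j A i j ^+ 2).

Definition enorm n (v : 'cV[R]_n) : R := frob v.

Definition mxnorm2 m n (A : 'M[R]_(m, n)) : R :=
  sup [set enorm (A *m x) | x in [set x : 'cV[R]_n | enorm x <= 1]].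

Definition sqnormC (z : R[i]) : R := complex.Re z ^+ 2 + complex.Im z ^+ 2.

Definition sqfrobC m n (A : 'M[R[i]]_(m, n)) : R :=
  \sum_i \sum_j sqnormC (A i j).

End Norms.

Section Fourier.
Variable R : realType.

Definition inner d (k : 'rV[int]_d) (x : 'rV[R]_d) : R :=
  \sum_i (k ord0 i)%:~R * x ord0 i.

Definition cis (theta : R) : R[i] := (cos theta +i* sin theta)%C.

(* Functions on the torus are 1-periodic functions on R^d. *)
Definition torus_fun d (Y : Type) (f : 'rV[R]_d -> Y) : Prop :=
  forall (x : 'rV[R]_d) (k : 'rV[int]_d), f (x + map_mx intr k) = f x.

(* Integral over [0,1]^d as an iterated Lebesgue integral. It is applied only
   to continuous integrands, for which it agrees with the integral for
   d-dimensional Lebesgue measure. *)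
Fixpoint cube_int d : ('rV[R]_d -> R) -> R :=
  match d with
  | 0 => fun f => f 0
  | d'.+1 => fun f =>
      \int[lebesgue_measure]_(y in `[0%R, 1%R])
        cube_int (fun x : 'rV[R]_d' => f (row_mx (y%:M : 'rV[R]_1) x))
  end.

Definition cube_intC d (g : 'rV[R]_d -> R[i]) : R[i] :=
  (cube_int (fun x => complex.Re (g x)) +i*
   cube_int (fun x => complex.Im (g x)))%C.

Definition fhat d m (f : 'rV[R]_d -> 'cV[R]_m) (k : 'rV[int]_d) :
    'cV[R[i]]_m :=
  \col_i cube_intC (fun x => (f x i ord0)%:C%C * cis (- (2 * pi * inner k x))).

(* A multi-index n in [N]^d is an element of 'rV['I_N]_d. *)
Definition gridpt N d (n : 'rV['I_N]_d) : 'rV[R]_d :=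
  \row_i ((n ord0 i)%:R / N%:R).

Definition DFT N d m (v : 'rV['I_N]_d -> 'cV[R]_m) (k : 'rV[int]_d) :
    'cV[R[i]]_m :=
  \col_i ((N%:R ^+ d)^-1 * \sum_(n : 'rV['I_N]_d)
     (v n i ord0)%:C%C * cis (- (2 * pi * inner k (gridpt n)))).

(* The shift by K./2 enumerates [[K]]^d by 'rV['I_K]_d: each coordinate ranges
   over -L..L if K = 2L+1 and over -L..L-1 if K = 2L. *)
Definition freq K d (j : 'rV['I_K]_d) : 'rV[int]_d :=
  \row_i ((j ord0 i)%:Z - (K./2)%:Z).

End Fourier.

Section Sobolev.
Variable R : realType.

Definition knorm2 d (k : 'rV[int]_d) : R := \sum_i ((k ord0 i)%:~R) ^+ 2.

Definition Hs_sqnorm d m (s : nat) (f : 'rV[R]_d -> 'cV[R]_m) : \bar R :=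
  \esum_(k in [set: 'rV[int]_d])
    ((1 + knorm2 k ^+ s) * sqfrobC (fhat f k))%:E.

(* H^s(T^d; R^m), elements being given by their continuous representatives;
   to be used for s > d/2 only. *)
Record Hs (d m s : nat) := MkHs {
  Hs_fun :> 'rV[R]_d -> 'cV[R]_m;
  Hs_periodic : torus_fun Hs_fun;
  Hs_continuous : continuous Hs_fun;
  Hs_finite : (Hs_sqnorm s Hs_fun < +oo)%E }.

Section Topology.
Variables d m s : nat.

Definition Hs_ball (f : Hs d m s) (e : R) : set (Hs d m s) :=
  [set g | (Hs_sqnorm s (fun x => g x - f x)%R < (e ^+ 2)%:E)%E].

Definition Hs_open : set (set (Hs d m s)) :=
  [set U | forall f, U f -> exists2 e : R, 0 < e & Hs_ball f e `<=` U].

Lemma Hs_openT : Hs_open setT.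
Proof. by move=> f _; exists 1. Qed.

Lemma Hs_ball_le f (e1 e2 : R) :
  0 <= e1 -> e1 <= e2 -> Hs_ball f e1 `<=` Hs_ball f e2.
Proof.
move=> e10 e12 g; rewrite /Hs_ball /= => /lt_le_trans; apply.
by rewrite lee_fin lerXn2r// nnegrE// (le_trans e10).
Qed.

Lemma Hs_openI : setI_closed Hs_open.
Proof.
move=> U V oU oV f [/oU[e1 e10 h1] /oV[e2 e20 h2]].
have m0 : 0 < Num.min e1 e2 by rewrite lt_min e10.
exists (Num.min e1 e2) => // g fg; split.
  by apply: h1; apply: Hs_ball_le fg; [exact: ltW|rewrite ge_min lexx].
by apply: h2; apply: Hs_ball_le fg; [exact: ltW|rewrite ge_min lexx orbT].
Qed.

Lemma Hs_open_bigU (I : Type) (U : I -> set (Hs d m s)) :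
  (forall i, Hs_open (U i)) -> Hs_open (\bigcup_i U i).
Proof.
move=> oU f [i _ /oU[e e0 h]]; exists e => // g /h Ug.
by exists i.
Qed.

HB.instance Definition _ := gen_eqMixin (Hs d m s).
HB.instance Definition _ := gen_choiceMixin (Hs d m s).
HB.instance Definition _ :=
  isOpenTopological.Build (Hs d m s) Hs_openT Hs_openI Hs_open_bigU.

End Topology.
End Sobolev.

Section Activations.
Variable R : realType.
Variables m n : nat.

Definition glob_lipschitz (sigma : 'cV[R]_m -> 'cV[R]_n) : Prop :=
  exists L : R, forall u v, enorm (sigma u - sigma v) <= L * enorm (u - v).

(* For a smooth map, iter_deriv [:: h_1; ..; h_j] sigma u is the value of the
   j-linear map D^j sigma(u) at (h_1, .., h_j). *)
Fixpoint iter_deriv (hs : seq 'cV[R]_m) (sigma : 'cV[R]_m -> 'cV[R]_n) :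
    'cV[R]_m -> 'cV[R]_n :=
  if hs is h :: hs' then 'D_h (iter_deriv hs' sigma) else sigma.

Definition smooth (sigma : 'cV[R]_m -> 'cV[R]_n) : Prop :=
  forall hs u, differentiable (iter_deriv hs sigma) u.

Definition deriv_bounded (s : nat) (B : R) (sigma : 'cV[R]_m -> 'cV[R]_n) :
    Prop :=
  forall (hs : seq 'cV[R]_m) u, (1 <= size hs <= s)%N ->
    enorm (iter_deriv hs sigma u) <= B * \prod_(h <- hs) enorm h.

Definition polynomial_map (sigma : 'cV[R]_m -> 'cV[R]_n) : Prop :=
  forall i, exists p : mpoly.mpoly m R,
    forall u, sigma u i ord0 = mpoly.meval (fun j => u j ord0) p.

End Activations.

Record shallow (R : realType) (m n : nat) := MkShallow {
  sh_mat : 'M[R]_(n, m);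
  sh_bias : 'cV[R]_n;
  sh_act : 'cV[R]_n -> 'cV[R]_n;
  sh_lipschitz : glob_lipschitz sh_act;
  sh_smooth : smooth sh_act }.

Definition shallow_eval (R : realType) m n (phi : shallow R m n)
    (u : 'cV[R]_m) : 'cV[R]_n :=
  sh_act phi (sh_mat phi *m u + sh_bias phi).

Definition NNnorm (R : realType) m n (phi : shallow R m n) : R :=
  Num.sqrt (frob (sh_mat phi) ^+ 2 + enorm (sh_bias phi) ^+ 2).

Section Kernel.
Variables (R : realType) (d K m n : nat).

(* Only the values P k with k in [[K]]^d matter. *)
Variable P : 'rV[int]_d -> 'M[R[i]]_(n, m).

Definition kernel_op (v : 'rV[R]_d -> 'cV[R]_m) (x : 'rV[R]_d) : 'cV[R[i]]_n :=
  \sum_(j : 'rV['I_K]_d)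
    cis (2 * pi * inner (freq j) x) *: (P (freq j) *m fhat v (freq j)).

Definition dkernel_op N (v : 'rV['I_N]_d -> 'cV[R]_m) (l : 'rV['I_N]_d) :
    'cV[R[i]]_n :=
  \sum_(j : 'rV['I_K]_d)
    cis (2 * pi * inner (freq j) (gridpt R l)) *:
      (P (freq j) *m DFT v (freq j)).

Definition kernel_real : Prop :=
  forall v : 'rV[R]_d -> 'cV[R]_m, torus_fun v -> continuous v ->
    forall x i, complex.Im (kernel_op v x i ord0) = 0.

Definition kernel_frob : R :=
  Num.sqrt (\sum_(j : 'rV['I_K]_d) sqfrobC (P (freq j))).

End Kernel.

(* The layers are indexed by all of nat, but only those with t < fno_depth are
   part of the operator: nothing is required of the others. *)
Record FNO (R : realType) (d da du : nat) := MkFNO {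
  fno_depth : nat;
  fno_modes : nat;
  fno_dim : nat -> nat;
  fno_lift : shallow R da (fno_dim 0);
  fno_proj : shallow R (fno_dim fno_depth) du;
  fno_W : forall t, 'M[R]_(fno_dim t.+1, fno_dim t);
  fno_P : forall t, 'rV[int]_d -> 'M[R[i]]_(fno_dim t.+1, fno_dim t);
  fno_b : forall t, 'cV[R]_(fno_dim t.+1);
  fno_act : forall t, 'cV[R]_(fno_dim t.+1) -> 'cV[R]_(fno_dim t.+1);
  fno_modes_gt0 : (0 < fno_modes)%N;
  fno_kernel_real :
    forall t, (t < fno_depth)%N -> kernel_real fno_modes (fno_P t);
  fno_act_lipschitz :
    forall t, (t < fno_depth)%N -> glob_lipschitz (@fno_act t);
  fno_act_smooth : forall t, (t < fno_depth)%N -> smooth (@fno_act t);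
  fno_act_nonpoly :
    forall t, (t < fno_depth)%N -> ~ polynomial_map (@fno_act t) }.

Section States.
Variables (R : realType) (d da du : nat) (Psi : FNO R d da du).

(* Taking real parts loses nothing: the kernel term is real by
   fno_kernel_real. That condition also forces P k = 0 when -k is not in
   [[K]]^d and P (-k) = (P k)^* otherwise, so that the discrete kernel term
   is real as well. *)
Definition fno_layer t (v : 'rV[R]_d -> 'cV[R]_(fno_dim Psi t)) (x : 'rV[R]_d) :
    'cV[R]_(fno_dim Psi t.+1) :=
  fno_act (fno_W Psi t *m v x
           + map_mx (@complex.Re R) (kernel_op (fno_modes Psi) (fno_P Psi t) v x)
           + fno_b Psi t).

Definition fno_dlayer N t (v : 'rV['I_N]_d -> 'cV[R]_(fno_dim Psi t))
    (n : 'rV['I_N]_d) : 'cV[R]_(fno_dim Psi t.+1) :=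
  fno_act (fno_W Psi t *m v n
           + map_mx (@complex.Re R) (dkernel_op (fno_modes Psi) (fno_P Psi t) v n)
           + fno_b Psi t).

Fixpoint state (a : 'rV[R]_d -> 'cV[R]_da) (t : nat) :
    'rV[R]_d -> 'cV[R]_(fno_dim Psi t) :=
  match t with
  | 0 => fun x => shallow_eval (fno_lift Psi) (a x)
  | t'.+1 => fno_layer (state a t')
  end.

Fixpoint dstate N (a : 'rV[R]_d -> 'cV[R]_da) (t : nat) :
    'rV['I_N]_d -> 'cV[R]_(fno_dim Psi t) :=
  match t with
  | 0 => fun n => shallow_eval (fno_lift Psi) (a (gridpt R n))
  | t'.+1 => fno_dlayer (dstate a t')
  end.

Definition fno_eval (a : 'rV[R]_d -> 'cV[R]_da) (x : 'rV[R]_d) : 'cV[R]_du :=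
  shallow_eval (fno_proj Psi) (state a (fno_depth Psi) x).

Definition grid_error N (a : 'rV[R]_d -> 'cV[R]_da) (t : nat) : R :=
  (N%:R `^ (d%:R / 2))^-1 *
  Num.sqrt (\sum_(n : 'rV['I_N]_d)
    enorm (state a t (gridpt R n) - dstate a t n) ^+ 2).

Definition act_deriv_bounded (s : nat) (B : R) : Prop :=
  [/\ forall t, (t < fno_depth Psi)%N -> deriv_bounded s B (@fno_act _ _ _ _ Psi t),
      deriv_bounded s B (sh_act (fno_lift Psi)) &
      deriv_bounded s B (sh_act (fno_proj Psi))].

Definition params_bounded (M : R) : Prop :=
  [/\ forall t, (t < fno_depth Psi)%N ->
        [/\ kernel_frob (fno_modes Psi) (fno_P Psi t) <= M,
            mxnorm2 (fno_W Psi t) <= M & enorm (fno_b Psi t) <= M],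
      NNnorm (fno_lift Psi) <= M & NNnorm (fno_proj Psi) <= M].

End States.

(* Main.v *)
(* The error made by replacing the Fourier coefficients of a state v by its DFT
   on the grid comes from aliasing, and is O(N^-s) as soon as the s-th finite
   differences of v along the coordinate directions of the N-th grid have root
   mean square O(N^-s) for every N; no Sobolev space is needed for the states.
   This discrete regularity holds for the input, because a function of H^s is
   the pointwise limit of its Fejer sums, whose differences are controlled by
   the Fourier weights (here s > d/2 enters). It is preserved by the affine part
   of a layer, since the kernel term is a trigonometric polynomial with a fixed
   set of frequencies, and by the activation, by the chain rule for finite
   differences and the discrete Gagliardo-Nirenberg inequality
   sum |Delta^j u|^(2s/j) <= C sum |Delta^s u|^2 for bounded u. All constants are
   uniform on a compact set of inputs because the H^s norm is bounded there. The
   error then satisfies rms(e_(t+1)) <= C (rms(e_t) + N^-s) with e_0 = 0. *)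

Require Import Defs.
From HB Require Import structures.
From mathcomp Require Import all_boot all_order all_algebra.
From mathcomp Require Import complex finmap.
From mathcomp Require Import all_classical all_reals all_analysis.
From mathcomp Require Import ring lra zify.
Import Order.TTheory GRing.Theory Num.Theory.
Import numFieldNormedType.Exports.
Local Open Scope classical_set_scope.
Local Open Scope ring_scope.
Set Implicit Arguments.
Unset Strict Implicit.
Unset Printing Implicit Defensive.

(** * Finite differences and the Gagliardo-Nirenberg inequality *)

(** On a finite set with an injective shift, summation by parts has no boundary terms, and the
    interpolation constants see neither the set nor its size: this is where independence of N comes
    from. The price is that a pointwise bound has to travel with the differences, because
    interpolation starts from it. The regularity class therefore carries a sup bound, and also
    continuity, which makes Fourier coefficients limits of grid means. Two obstacles shape the
    analysis. The integral over the cube is an iterated one, so additivity and convolution with a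
    kernel are handled on grid means, where they are finite identities, and then passed to the
    limit; no exchange of integrals occurs. And nothing is assumed about convergence of Fourier
    series. Fejer sums are preferred to partial sums because their kernel is nonnegative, which
    gives pointwise convergence for every continuous periodic function, and because, as averages of
    sums over frequency windows, they inherit quadratic bounds from the windows. *)

Section Difference.
Context {T : Type} {V : zmodType}.
Variable tau : T -> T.
Implicit Types u v : T -> V.

Definition dif u : T -> V := fun g => u (tau g) - u g.
Definition difn (j : nat) u : T -> V := iter j dif u.

Lemma difnS j u g : difn j.+1 u g = difn j u (tau g) - difn j u g.
Proof. by []. Qed.

Lemma difnSr j u : difn j.+1 u = difn j (dif u).
Proof. by rewrite /difn iterSr. Qed.

Lemma eq_difn j u v : u =1 v -> difn j u =1 difn j v.
Proof. by move=> uv; elim: j => [//|j IH] g; rewrite !difnS !IH. Qed.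

Lemma difnD j u v g : difn j (fun x => u x + v x) g = difn j u g + difn j v g.
Proof. by elim: j g => [//|j IH] g; rewrite !difnS !IH opprD addrACA. Qed.

Lemma difn0 j g : difn j (fun=> 0 : V) g = 0.
Proof. by elim: j g => [//|j IH] g; rewrite !difnS !IH subrr. Qed.

Lemma difn_cst j (c : V) g : difn j.+1 (fun=> c) g = 0.
Proof.
rewrite difnSr -(difn0 j g); apply: eq_difn => x.
by rewrite /dif subrr.
Qed.

Lemma difn_sum (I : Type) (r : seq I) (P : pred I) (F : I -> T -> V) j g :
  difn j (fun x => \sum_(i <- r | P i) F i x) g =
  \sum_(i <- r | P i) difn j (F i) g.
Proof.
elim: j g => [//|j IH] g; rewrite difnS !IH -sumrB.
by apply: eq_bigr => i _; rewrite difnS.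
Qed.

End Difference.

(** Along an orbit [tau] becomes [succn], so a bound at one grid point only concerns a sequence of s
    + 1 values. *)
Lemma difn_orbit (T : Type) (V : zmodType) (tau : T -> T) j (u : T -> V) r g :
  difn tau j u (iter r tau g) = difn succn j (fun i => u (iter i tau g)) r.
Proof. by elim: j r => [//|j IH] r; rewrite !difnS -iterS !IH. Qed.

Lemma difnZl (T : Type) (K : pzRingType) (tau : T -> T) j
    (c : K) (u : T -> K) g :
  difn tau j (fun x => c * u x) g = c * difn tau j u g.
Proof. by elim: j g => [//|j IH] g; rewrite !difnS !IH mulrBr. Qed.

Section GagliardoNirenberg.
Context {R : realType}.
Implicit Types a b c : R.

(** The small factor sits on [a] and [c], the two terms to be absorbed. With m the larger of them
    and ka^be = eps, either b <= ka m and the product is at most eps m, or m < b / ka and it is at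
    most a multiple of b. *)
Lemma young3 (al be ga eps : R) : 0 <= al -> 0 < be -> 0 <= ga ->
    al + be + ga = 1 -> 0 < eps ->
  exists2 K, 0 <= K & forall a b c, 0 <= a -> 0 <= b -> 0 <= c ->
    a `^ al * b `^ be * c `^ ga <= eps * (a + c) + K * b.
Proof.
move=> al0 be0 ga0 abc1 eps0.
pose ka := eps `^ be^-1.
have ka0 : 0 < ka by rewrite powR_gt0.
exists (ka^-1 `^ (al + ga)); first exact: powR_ge0.
move=> a b c a0 b0 c0.
pose m := Num.max a c.
have am : a <= m by rewrite le_max lexx.
have cm : c <= m by rewrite le_max lexx orbT.
have m0 : 0 <= m by rewrite (le_trans a0).
have [bm|mb] := leP b (ka * m).
- have [m_gt0|] := ltP 0 m; last first.
    move=> m_le0; have b_0 : b = 0.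
      by apply/le_anti; rewrite b0 (le_trans bm)// mulr_ge0_le0 // ltW.
    rewrite b_0 powR0 ?gt_eqF// mulr0 mul0r mulr0 addr0.
    by rewrite mulr_ge0 ?addr_ge0// ltW.
  apply: (@le_trans _ _ (m `^ al * (ka * m) `^ be * m `^ ga)).
    apply: ler_pM; rewrite ?mulr_ge0 ?powR_ge0//; last first.
      by apply: ge0_ler_powR; rewrite ?nnegrE.
    apply: ler_pM; rewrite ?powR_ge0//.
      by apply: ge0_ler_powR; rewrite ?nnegrE.
    by apply: ge0_ler_powR; rewrite ?nnegrE ?mulr_ge0// ltW.
  rewrite powRM ?(ltW ka0)// mulrCA -!mulrA -powRD ?abc1; last first.
    by rewrite (gt_eqF m_gt0) implybT.
  rewrite -powRD; last by rewrite (gt_eqF m_gt0) implybT.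
  rewrite addrA abc1 powRr1// /ka -powRrM mulVf ?gt_eqF// powRr1 ?(ltW eps0)//.
  rewrite -[leLHS]addr0 lerD// ?mulr_ge0 ?powR_ge0//.
  rewrite ler_pM2l// /m ge_max lerDl lerDr; exact/andP.
- have b_gt0 : 0 < b by rewrite (le_lt_trans _ mb)// mulr_ge0// ltW.
  have mkb : m <= ka^-1 * b by rewrite -ler_pdivrMl ?invr_gt0// invrK ltW.
  apply: (@le_trans _ _ ((ka^-1 * b) `^ al * b `^ be * (ka^-1 * b) `^ ga)).
    apply: ler_pM; rewrite ?mulr_ge0 ?powR_ge0//; last first.
      by apply: ge0_ler_powR; rewrite ?nnegrE ?mulr_ge0 ?invr_ge0 ?(ltW ka0)//;
         rewrite (le_trans cm).
    apply: ler_pM; rewrite ?powR_ge0//.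
    by apply: ge0_ler_powR; rewrite ?nnegrE ?mulr_ge0 ?invr_ge0 ?(ltW ka0)//;
       rewrite (le_trans am).
  rewrite !powRM ?invr_ge0 ?(ltW ka0)//.
  have -> : ka^-1 `^ al * b `^ al * b `^ be * (ka^-1 `^ ga * b `^ ga) =
            (ka^-1 `^ al * ka^-1 `^ ga) * (b `^ al * b `^ be * b `^ ga).
    by ring.
  rewrite -!powRD ?abc1 ?powRr1//; last by rewrite invr_eq0 (gt_eqF ka0) implybT.
  - by rewrite lerDr mulr_ge0 ?addr_ge0 ?(ltW eps0).
  - by rewrite (gt_eqF b_gt0) implybT.
  - by rewrite (gt_eqF b_gt0) implybT.
Qed.

Definition signed_powR (q y : R) := Num.sg y * `|y| `^ q.

Lemma signed_powRN q y : signed_powR q (- y) = - signed_powR q y.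
Proof. by rewrite /signed_powR sgrN normrN mulNr. Qed.

(** By homogeneity it is enough to compare 1 with t = b / a in [-1, 1]. The integer [n] above [q]
    replaces a derivative: for t >= 0, 1 - t^q <= 1 - t^n, and the latter is 1 - t times a geometric
    sum of n terms at most 1. *)
Lemma signed_powR_lip (q : R) n a b : 1 <= q -> q <= n%:R ->
  `|signed_powR q a - signed_powR q b| <=
  n%:R * Num.max `|a| `|b| `^ (q - 1) * `|a - b|.
Proof.
move=> q1 qn; have q0 : 0 < q by exact: lt_le_trans q1.
wlog ba : a b / `|b| <= `|a|.
  move=> H; case/orP: (le_total `|b| `|a|) => ab; first exact: H.
  by rewrite distrC (distrC a) maxC; exact: H.
rewrite max_l//.
wlog a0 : a b ba / 0 <= a.
  move=> H; have [a0|a0] := leP 0 a; first exact: H.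
  have := H (- a) (- b); rewrite !normrN !signed_powRN -!opprD !normrN.
  by apply => //; rewrite oppr_ge0 ltW.
have [a_0|a_neq0] := eqVneq a 0.
  have b_0 : b = 0 by apply/eqP; rewrite -normr_le0 (le_trans ba)// a_0 normr0.
  by rewrite a_0 b_0 !subrr normr0 mulr0.
have a_gt0 : 0 < a by rewrite lt_def a_neq0.
pose t := b / a.
have bE : b = a * t by rewrite /t mulrCA mulfV ?mulr1.
have t1 : `|t| <= 1.
  by rewrite /t normrM normfV (gtr0_norm a_gt0) ler_pdivrMr// mul1r -(gtr0_norm a_gt0).
have n1 : 1 <= n%:R :> R by exact: le_trans qn.
suff H : `|1 - signed_powR q t| <= n%:R * `|1 - t|.
  rewrite (gtr0_norm a_gt0) {1}bE.
  have -> : signed_powR q a = a `^ q.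
    by rewrite /signed_powR gtr0_sg// mul1r gtr0_norm.
  have -> : signed_powR q (a * t) = a `^ q * signed_powR q t.
    rewrite /signed_powR sgrM gtr0_sg// mul1r normrM (gtr0_norm a_gt0).
    by rewrite powRM// mulrCA.
  have -> : a - b = a * (1 - t) by rewrite {1}bE mulrBr mulr1.
  rewrite normrM (gtr0_norm a_gt0) -[X in X - _]mulr1 -mulrBr normrM.
  rewrite ger0_norm ?powR_ge0// -[X in X `^ q](mulr1 a).
  have -> : n%:R * a `^ (q - 1) * (a * `|1 - t|) = a `^ q * (n%:R * `|1 - t|).
    by rewrite -(mulr_powRB1 a0 q0); ring.
  by rewrite mulr1 ler_wpM2l ?powR_ge0.
have /andP[tN1 t_1] : -1 <= t <= 1 by rewrite -ler_norml.
have [t0|t0] := leP 0 t.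
- have [t_0|t_neq0] := eqVneq t 0.
    by rewrite t_0 /signed_powR sgr0 mul0r !subr0 normr1 mulr1.
  have t_gt0 : 0 < t by rewrite lt_def t_neq0.
  rewrite /signed_powR gtr0_sg// mul1r (gtr0_norm t_gt0).
  have tq : t ^+ n <= t `^ q.
    by rewrite -powR_mulrn//; apply: ger_powR; rewrite ?t_gt0.
  have tq1 : t `^ q <= 1.
    by rewrite -(powRr0 t); apply: ger_powR; rewrite ?t_gt0// ltW.
  rewrite !ger0_norm ?subr_ge0//.
  apply: (@le_trans _ _ (1 - t ^+ n)); first by rewrite lerB.
  rewrite -{1}(expr1n _ n) subrXX mulrC ler_wpM2r ?subr_ge0//.
  rewrite -[n in leRHS]card_ord -sum1_card natr_sum ler_sum// => i _.
  by rewrite expr1n mul1r exprn_ile1.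
- rewrite /signed_powR (ltr0_sg t0) mulN1r opprK (ltr0_norm t0).
  have tq : (- t) `^ q <= - t.
    by apply: ge1r_powR => //; rewrite oppr_gt0 t0/= lerNl.
  rewrite !ger0_norm ?addr_ge0 ?powR_ge0 ?oppr_ge0 ?(ltW t0)//.
  apply: (@le_trans _ _ (1 - t)); first by rewrite lerD2l.
  by rewrite ler_peMl// addr_ge0// oppr_ge0 ltW.
Qed.

Definition gn_sum (T : finType) (tau : T -> T) (s j : nat) (u : T -> R) :=
  \sum_g `|difn tau j u g| `^ ((2 * s)%:R / j%:R).

Lemma gn_sum_ge0 (T : finType) (tau : T -> T) s j u : 0 <= gn_sum tau s j u.
Proof. by apply: sumr_ge0 => g _; exact: powR_ge0. Qed.

Lemma signed_powRM (q y : R) : 0 <= q -> signed_powR q y * y = `|y| `^ (q + 1).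
Proof.
move=> q0; rewrite /signed_powR.
have q1 : 0 < q + 1 by rewrite ltr_wpDl.
have := mulr_powRB1 (normr_ge0 y) q1; rewrite addrK => <-.
by rewrite mulrAC -normrEsg.
Qed.

Lemma sum_shift (T : finType) (W : nmodType) (tau : T -> T) (F : T -> W) :
  injective tau -> \sum_g F (tau g) = \sum_g F g.
Proof. by move=> taui; rewrite [RHS](reindex_inj taui). Qed.

Lemma sum_shift_iter (T : finType) (W : nmodType) (tau : T -> T) r (F : T -> W) :
  injective tau -> \sum_g F (iter r tau g) = \sum_g F g.
Proof.
by move=> taui; elim: r F => [//|r IH] F; rewrite -[RHS](sum_shift F taui); exact: (IH (F \o tau)).
Qed.

(** Write |y|^p as the signed power of exponent p - 1 times y, with y = Delta^j u a difference of
    Delta^(j-1) u. Invariance of the sum under [tau] moves that difference onto the signed power,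
    which is Lipschitz with exponent p - 2. *)
Lemma gn_by_parts (T : finType) (tau : T -> T) (s j : nat) (u : T -> R) :
    injective tau -> (0 < j < s)%N ->
  gn_sum tau s j u <=
  \sum_g (2 * s)%:R *
    Num.max `|difn tau j u (tau g)| `|difn tau j u g| `^ ((2 * s)%:R / j%:R - 2)
         * `|difn tau j.+1 u g| * `|difn tau j.-1 u (tau g)|.
Proof.
move=> taui /andP[j0 js]; set p : R := (2 * s)%:R / j%:R.
have jp : 0 < j%:R :> R by rewrite ltr0n.
have p2 : 2 <= p.
  by rewrite /p ler_pdivlMr// -natrM ler_nat leq_mul2l (ltnW js).
have pn : p <= (2 * s)%:R.
  by rewrite /p ler_pdivrMr// ler_peMr// ler1n.
rewrite /gn_sum -/p.
have -> : \sum_g `|difn tau j u g| `^ p =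
  \sum_g - ((signed_powR (p - 1) (difn tau j u (tau g)) -
           signed_powR (p - 1) (difn tau j u g)) * difn tau j.-1 u (tau g)).
  transitivity (\sum_g (signed_powR (p - 1) (difn tau j u g) *
      difn tau j.-1 u (tau g) - signed_powR (p - 1) (difn tau j u g) *
      difn tau j.-1 u g)).
    apply: eq_bigr => g _.
    rewrite -mulrBr -difnS prednK// signed_powRM ?subrK//.
    by rewrite subr_ge0 (le_trans _ p2)// ler1n.
  rewrite sumrB.
  rewrite -[in X in _ - X](sum_shift _ taui) -sumrB.
  by apply: eq_bigr => g _; ring.
apply: ler_sum => g _; rewrite (le_trans (ler_norm _))// normrN normrM.
rewrite ler_wpM2r// difnS.
have -> : p - 2 = (p - 1) - 1 by ring.
apply: signed_powR_lip; first by rewrite lerBrDr.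
by rewrite (le_trans _ pn)// gerBl.
Qed.

(* Summation by parts leaves |Delta^j u|^(p-2) |Delta^(j+1) u| |Delta^(j-1) u|,
   whose exponents are exactly those for which Young's inequality closes. *)
Lemma gn_step (s j : nat) (A : R) : (0 < j < s)%N ->
  exists2 C : R, 0 <= C & forall (T : finType) (tau : T -> T) (u : T -> R),
    injective tau -> (forall g, `|u g| <= A) ->
    gn_sum tau s j u <= C * gn_sum tau s j.+1 u.
Proof.
elim: j => [//|j IH] /andP[_ js].
have s0 : 0 < s%:R :> R by rewrite ltr0n (leq_trans _ js).
have s2 : 0 < (2 * s)%:R :> R by rewrite natrM mulr_gt0.
have s20 : (2 * s)%:R != 0 :> R by rewrite gt_eqF.
have jj0 : j.+1%:R != 0 :> R by rewrite pnatr_eq0.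
have jj20 : j.+2%:R != 0 :> R by rewrite pnatr_eq0.
pose p : R := (2 * s)%:R / j.+1%:R.
pose al : R := (p - 2) / p.
pose be : R := j.+2%:R / (2 * s)%:R.
pose ga : R := j%:R / (2 * s)%:R.
have p2 : 2 <= p.
  by rewrite /p ler_pdivlMr// -natrM ler_nat leq_mul2l (ltnW js).
have p0 : p != 0 by rewrite gt_eqF// (lt_le_trans _ p2).
have al0 : 0 <= al by rewrite divr_ge0 ?subr_ge0// (le_trans _ p2).
have be0 : 0 < be by rewrite divr_gt0.
have ga0 : 0 <= ga by rewrite divr_ge0.
have abc1 : al + be + ga = 1.
  rewrite /al /be /ga /p mulrBl mulfV// invf_div.
  have -> : j.+2%:R = j%:R + 2 :> R by rewrite -natrD addn2.
  have -> : j.+1%:R = j%:R + 1 :> R by rewrite -addn1 natrD.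
  by field; rewrite ?s20 ?gt_eqF.
have maxpow (x y : R) : 0 <= x -> 0 <= y ->
    Num.max x y `^ p <= x `^ p + y `^ p.
  by move=> x0 y0; case: (leP x y) => _; rewrite ?lerDl ?lerDr powR_ge0.
have splitX (x : R) : 0 <= x -> x `^ (p - 2) = (x `^ p) `^ al.
  by move=> x0; rewrite -powRrM /al mulrC divfK.
have splitY (x : R) : 0 <= x -> x = (x `^ ((2 * s)%:R / j.+2%:R)) `^ be.
  move=> x0; rewrite -powRrM /be mulrA divfK// mulfV// powRr1//.
(* The factor of order j costs a sum of order j + 1 by the induction hypothesis, so it can be
   absorbed as well. At j = 0 its exponent [ga] vanishes and the sup bound takes its place. *)
have [C' C'0 hC'] : exists2 C' : R, 0 <= C' &
    forall (T : finType) (tau : T -> T) (u : T -> R),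
    injective tau -> (forall g, `|u g| <= A) -> (0 < j)%N ->
    gn_sum tau s j u <= C' * gn_sum tau s j.+1 u.
  case: j IH js {jj0 jj20 p al be ga p2 p0 al0 be0 ga0 abc1 maxpow splitX splitY} =>
      [|j] IH js; first by exists 0.
  have [|C C0 hC] := IH; first by rewrite ltnS (ltn_trans _ js).
  by exists C => // T tau u ? ? _; exact: hC.
(* [A1] bounds [u] when j = 0; being at least 1, it is a harmless factor when j > 0. *)
pose A1 := Num.max A 1.
have A10 : 0 < A1 by rewrite lt_max ltr01 orbT.
(* eps * 2s * A1 * (2 + C') = 1/2 *)
pose eps := ((2 * s)%:R * A1 * (2 + C') * 2)^-1.
have C'2 : 0 < 2 + C' by rewrite ltr_wpDr.
have eps0 : 0 < eps by rewrite invr_gt0 !mulr_gt0.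
have [K K0 hK] := young3 al0 be0 ga0 abc1 eps0.
exists (2 * ((2 * s)%:R * A1 * K)); first by rewrite !mulr_ge0// ltW.
move=> T tau u taui uA.
set I1 := gn_sum tau s j.+1 u; set I2 := gn_sum tau s j.+2 u.
set I0 := gn_sum tau s j u.
suff H : I1 <= (2 * s)%:R * A1 * (eps * (2 * I1 + C' * I1) + K * I2).
  have E : (2 * s)%:R * A1 * (eps * (2 * I1 + C' * I1) + K * I2) =
         I1 / 2 + (2 * s)%:R * A1 * K * I2.
    rewrite /eps; field; rewrite ?s20 ?gt_eqF//.
  rewrite E in H; rewrite -/I1 -/I2; lra.
apply: le_trans (@gn_by_parts T tau s j.+1 u taui _) _ => //=.
rewrite -/p.
(* At j = 0 the quotient 2s / j is 0 by the convention for division: the power would be 1 at every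
   point and its sum the cardinality of [T]. The term is set to 0 instead. *)
pose c0 g : R := if j == 0%N then 0 else `|difn tau j u (tau g)| `^ ((2 * s)%:R / j%:R).
have c00 g : 0 <= c0 g by rewrite /c0; case: ifP => // _; exact: powR_ge0.
apply: (@le_trans _ _ (\sum_g (2 * s)%:R * A1 * (eps *
   ((`|difn tau j.+1 u (tau g)| `^ p + `|difn tau j.+1 u g| `^ p) + c0 g) + K *
    `|difn tau j.+2 u g| `^ ((2 * s)%:R / j.+2%:R)))); last first.
  rewrite -mulr_sumr ler_wpM2l ?mulr_ge0// ?(ltW A10)//.
  rewrite big_split/= -!mulr_sumr lerD// ler_wpM2l ?(ltW eps0)//.
  rewrite !big_split/= (sum_shift (fun g => `|difn tau j.+1 u g| `^ p))//.
  rewrite -/I1 mulr2n mulrDl mul1r lerD//.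
  rewrite /c0; case: eqP => [_|/eqP]; first by rewrite big1 ?mulr_ge0 ?gn_sum_ge0.
  rewrite -lt0n => /hC' H.
  by rewrite (sum_shift (fun g => `|difn tau j u g| `^ ((2 * s)%:R / j%:R)))//
    H.
apply: ler_sum => g _.
rewrite -!mulrA ler_wpM2l//.
set X : R := Num.max _ _; set Y : R := `|difn tau j.+2 u g|.
set Z : R := `|difn tau j u (tau g)|.
have X0 : 0 <= X by rewrite le_max normr_ge0.
have ZA : Z <= A1 * c0 g `^ ga.
  rewrite /c0 /ga /Z; case: (posnP j) => [->|j0].
    rewrite mul0r powRr0 mulr1 /A1 le_max uA//.
  rewrite -powRrM.
  have -> : (2 * s)%:R / j%:R * (j%:R / (2 * s)%:R) = 1 :> R.
    by rewrite mulrA divfK ?mulfV// pnatr_eq0 -lt0n.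
  by rewrite powRr1// ler_peMl// le_max lexx orbT.
apply: (@le_trans _ _ (X `^ (p - 2) * (Y * (A1 * c0 g `^ ga)))).
  by rewrite ler_wpM2l ?powR_ge0// ler_wpM2l ?normr_ge0.
have -> : X `^ (p - 2) * (Y * (A1 * c0 g `^ ga)) =
   A1 * (X `^ (p - 2) * Y * c0 g `^ ga) by ring.
rewrite ler_wpM2l ?(ltW A10)// (splitX X X0) {1}(splitY Y (normr_ge0 _)).
apply: le_trans (hK _ _ _ _ _ _) _; rewrite ?powR_ge0//.
by rewrite lerD2r ler_pM2l// lerD2r maxpow ?normr_ge0.
Qed.

(** Descending iteration of [gn_step] down from j = s, where the exponent is 2. The constant is
    chosen before [T], hence serves all grids at once. *)
Lemma gagliardo_nirenberg (s j : nat) (A : R) : (0 < j <= s)%N ->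
  exists2 C : R, 0 <= C & forall (T : finType) (tau : T -> T) (u : T -> R),
    injective tau -> (forall g, `|u g| <= A) ->
    gn_sum tau s j u <= C * \sum_g difn tau s u g ^+ 2.
Proof.
move=> /andP[j0 js]; rewrite -(subKn js).
have : (s - j < s)%N by rewrite ltn_subrL j0 (leq_trans j0 js).
elim: (s - j)%N => [s0|k IH ks]; rewrite ?subn0.
  exists 1 => // T tau u _ _; rewrite mul1r /gn_sum.
  apply: ler_sum => g _; rewrite natrM mulfK ?pnatr_eq0 -?lt0n//.
  by rewrite -[2]/(2%:R) powR_mulrn// real_normK ?num_real.
have [C C0 hC] := IH (ltnW ks).
have [|C' C'0 hC'] := @gn_step s (s - k.+1) A.
  by rewrite subn_gt0 ks ltn_subrL (leq_ltn_trans _ ks).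
exists (C' * C); first exact: mulr_ge0.
move=> T tau u taui uA; rewrite -mulrA.
apply: le_trans (hC' T tau u taui uA) _; rewrite ler_wpM2l//.
by rewrite (subnSK (ltnW ks)); exact: hC.
Qed.

End GagliardoNirenberg.

(** * Euclidean norm and Cauchy-Schwarz for finite sums *)

Section Enorm.
Context {R : realType}.

Lemma enorm_ge0 n (v : 'cV[R]_n) : 0 <= enorm v.
Proof. exact: sqrtr_ge0. Qed.

Lemma enorm_sqr n (v : 'cV[R]_n) : enorm v ^+ 2 = \sum_i v i ord0 ^+ 2.
Proof.
rewrite /enorm /frob sqr_sqrtr; last first.
  by apply: sumr_ge0 => i _; apply: sumr_ge0 => j _; exact: sqr_ge0.
by apply: eq_bigr => i _; rewrite big_ord1.
Qed.

Lemma coord_le_enorm n (v : 'cV[R]_n) i : `|v i ord0| <= enorm v.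
Proof.
rewrite -(ler_pXn2r (ltn0Sn 1)) ?nnegrE ?enorm_ge0// enorm_sqr real_normK ?num_real//.
by rewrite (bigD1 i)//= lerDl sumr_ge0// => j _; exact: sqr_ge0.
Qed.

Lemma enorm_le_sum n (v : 'cV[R]_n) : enorm v <= \sum_i `|v i ord0|.
Proof.
rewrite -(ler_pXn2r (ltn0Sn 1)) ?nnegrE ?enorm_ge0 ?sumr_ge0// enorm_sqr.
rewrite expr2 mulr_suml ler_sum// => i _; rewrite -real_normK ?num_real// expr2.
by rewrite ler_wpM2l// (bigD1 i)//= lerDl sumr_ge0.
Qed.

Lemma enorm_delta n (i : 'I_n) : enorm (delta_mx i ord0 : 'cV[R]_n) = 1.
Proof.
apply/eqP; rewrite -(eqrXn2 (ltn0Sn 1)) ?enorm_ge0// enorm_sqr expr1n.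
rewrite (bigD1 i)//= mxE !eqxx expr1n big1 ?addr0// => j ji.
by rewrite mxE (negbTE ji) expr0n.
Qed.

Lemma sqr_sum_le (I : Type) (r : seq I) (F : I -> R) :
  (\sum_(i <- r) F i) ^+ 2 <= (size r)%:R * \sum_(i <- r) F i ^+ 2.
Proof.
elim: r => [|i r IH]; first by rewrite !big_nil expr0n mulr0.
rewrite !big_cons/=; set S := \sum_(_ <- _) _ in IH *.
set Q := \sum_(_ <- _) _ in IH *.
have H : 2 * F i * S <= (size r)%:R * F i ^+ 2 + Q.
  rewrite /S /Q; elim: {IH S Q} r => [|j r IH]; rewrite ?big_nil ?big_cons/=.
    by rewrite mulr0 mul0r addr0.
  have := sqr_ge0 (F i - F j); rewrite -[X in X%:R]addn1 natrD; lra.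
rewrite -[X in X%:R]addn1 natrD; lra.
Qed.

Lemma sqr_sum_fin_le (I : finType) (F : I -> R) :
  (\sum_i F i) ^+ 2 <= #|I|%:R * \sum_i F i ^+ 2.
Proof.
apply: le_trans (sqr_sum_le _ _) _; rewrite ler_wpM2r ?sumr_ge0//.
  by move=> i _; exact: sqr_ge0.
by rewrite ler_nat -[leqLHS]/(size _) cardT enumT.
Qed.

End Enorm.

(** * The chain rule for finite differences *)

Section Growth.
Context {R : realType}.
Implicit Types (Y C D : R) (a b : nat -> R).

(* grows Y C n a: on 0..n the j-th differences of the sequence a are O(Y^j), the
   behaviour of a map whose j-th derivatives scale like Y^j. *)
Definition grows Y C (n : nat) a :=
  forall j r, (j + r <= n)%N -> `|difn succn j a r| <= C * Y ^+ j.

Lemma difn_sup a j r C :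
  (forall i, (r <= i <= r + j)%N -> `|a i| <= C) ->
  `|difn succn j a r| <= 2 ^+ j * C.
Proof.
elim: j r => [|j IH] r H.
  by rewrite expr0 mul1r; apply: H; rewrite addn0 leqnn.
rewrite difnS exprS mulrDl mul1r mulrDl (le_trans (ler_normB _ _))//.
rewrite lerD// IH// => i /andP[i1 i2]; apply: H; lia.
Qed.

(** Discrete Leibniz rule: the difference of a product is [dif a] times the shifted [b] plus [a]
    times [dif b]. Each difference uses up one index, so the range and the constants vary in the
    induction; the j splittings give 2^j, at most 2^n. *)
Lemma growsM Y C D n a b : 0 <= Y -> 0 <= C -> 0 <= D ->
  grows Y C n a -> grows Y D n b ->
  grows Y (2 ^+ n * C * D) n (fun r => a r * b r).
Proof.
move=> Y0 C0 D0 ga gb.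
suff H : forall j a b C D n, 0 <= C -> 0 <= D -> grows Y C n a -> grows Y D n b ->
    forall r, (j + r <= n)%N -> `|difn succn j (fun r => a r * b r) r| <=
      2 ^+ j * C * D * Y ^+ j.
  move=> j r jr; apply: le_trans (H _ _ _ _ _ _ C0 D0 ga gb _ jr) _.
  rewrite ler_wpM2r ?exprn_ge0// ler_wpM2r// ler_wpM2r//.
  by rewrite ler_weXn2l ?ler1n// (leq_trans _ jr)// leq_addr.
move=> {ga gb a b C D n C0 D0}.
elim=> [|j IH] a b C D n C0 D0 ga gb r jr.
  rewrite expr0 mul1r mulr1 normrM ler_pM//.
    by have := ga 0%N r jr; rewrite expr0 mulr1.
  by have := gb 0%N r jr; rewrite expr0 mulr1.
case: n ga gb jr => [//|n] ga gb jr.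
rewrite difnSr (@eq_difn _ _ _ _ _
  (fun r => dif succn a r * b r.+1 + a r * dif succn b r)); last first.
  by move=> x; rewrite /dif; ring.
rewrite difnD (le_trans (ler_normD _ _))//.
have da : grows Y (C * Y) n (dif succn a).
  move=> i q iq; rewrite -difnSr -mulrA -exprS; apply: ga; lia.
have db : grows Y (D * Y) n (dif succn b).
  move=> i q iq; rewrite -difnSr -mulrA -exprS; apply: gb; lia.
have sb : grows Y D n (fun r => b r.+1).
  move=> i q iq; have -> : difn succn i (fun r => b r.+1) q = difn succn i b q.+1.
    by elim: i q {iq} => [//|i IHi] q; rewrite !difnS !IHi.
  apply: gb; lia.
have sa : grows Y C n a by move=> i q iq; apply: ga; lia.
have jr' : (j + r <= n)%N by lia.
apply: le_trans (lerD (IH _ _ _ _ _ (mulr_ge0 C0 Y0) D0 da sb _ jr')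
                      (IH _ _ _ _ _ C0 (mulr_ge0 D0 Y0) sa db _ jr')) _.
by rewrite [X in X <= _](_ : _ = 2 ^+ j.+1 * C * D * Y ^+ j.+1)// !exprS; ring.
Qed.

Lemma grows_prod Y C n (I : Type) (l : seq I) (a : I -> nat -> R) :
  0 <= Y -> 0 <= C -> (forall i, grows Y C n (a i)) ->
  grows Y ((2 ^+ n * C) ^+ size l) n (fun r => \prod_(i <- l) a i r).
Proof.
move=> Y0 C0 ga; elim: l => [|i l IH] j r jr.
  rewrite (@eq_difn _ _ _ _ _ (fun=> 1)); last by move=> x; rewrite big_nil.
  case: j jr => [|j] jr; first by rewrite !expr0 mulr1 normr1.
  by rewrite difn_cst normr0 expr0 mul1r exprn_ge0.
rewrite (@eq_difn _ _ _ _ _ (fun r => a i r * \prod_(i <- l) a i r)); last first.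
  by move=> x; rewrite big_cons.
have := growsM Y0 C0 (_ : 0 <= (2 ^+ n * C) ^+ size l) (ga i) IH.
rewrite exprS; apply=> //; by rewrite exprn_ge0// mulr_ge0// exprn_ge0.
Qed.

End Growth.

(** * Taylor expansion along a line, in coordinates *)

Section Taylor.
Context {R : realType}.

(** The remainder of [g 0] has the remainder of [g 1] as derivative, so the mean value theorem
    lowers the order. On [0, 1] the factor 1/s! of the sharp bound can be given up. *)
Lemma taylor_bound (s : nat) (g : nat -> R -> R) (C : R) :
  (forall k x, is_derive x (1 : R) (g k) (g k.+1 x)) ->
  (forall x, 0 <= x <= 1 -> `|g s x| <= C) ->
  forall x, 0 <= x <= 1 ->
    `|g 0%N x - \sum_(k < s) g k 0 / k`!%:R * x ^+ k| <= C.
Proof.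
move=> dg gC; pose T s (g : nat -> R -> R) := \poly_(k < s) (g k 0 / k`!%:R).
suff H : forall x, 0 <= x <= 1 -> `|g 0%N x - (T s g).[x]| <= C.
  by move=> x /H; rewrite horner_poly.
elim: s g dg gC => [|s IH] g dg gC x x01.
  by rewrite /T horner_poly big_ord0 subr0 gC.
have C0 : 0 <= C by apply: le_trans (gC 0 _); rewrite ?lexx ?ler01.
have dT : (T s.+1 g)^`() = T s (fun k => g k.+1).
  apply/polyP => k; rewrite coef_deriv !coef_poly ltnS; case: ifP => // _.
    rewrite factS natrM -mulr_natr; field.
    by rewrite ?pnatr_eq0 -?lt0n ?fact_gt0 //= -natr1 natr1 pnatr_eq0.
  by rewrite mul0rn.
pose h x := g 0%N x - (T s.+1 g).[x].
have dh y : is_derive y (1 : R) h (g 1%N y - (T s (fun k => g k.+1)).[y]).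
  rewrite -dT; exact: is_deriveB.
have ch : {within `[0, x], continuous h}.
  by apply: derivable_within_continuous => y _; exact: (@ex_derive _ _ _ _ _ _ _ (dh y)).
have [c c01] := @MVT_segment R h _ 0 x (proj1 (andP x01)) (fun y _ => dh y) ch.
rewrite subr0 {2}/h horner_coef0 coef_poly/= fact0 divr1 subrr subr0.
rewrite -[X in `|X|]/(h x) => ->.
move: c01; rewrite in_itv/= => /andP[c0 cx].
have /andP[x0 x1] := x01.
rewrite normrM (ger0_norm x0) -[leRHS]mulr1 ler_pM//.
apply: (IH (fun k => g k.+1)) => //.
by rewrite c0 (le_trans cx).
Qed.

Section Line.
Variables (m n : nat) (F : 'cV[R]_m -> 'cV[R]_n) (w v : 'cV[R]_m) (c : 'I_n).

Lemma is_derive_line x : differentiable F (w + x *: v) ->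
  is_derive x (1 : R) (fun x => F (w + x *: v) c ord0)
    ('D_v F (w + x *: v) c ord0).
Proof.
move=> dF.
have E : (fun h : R => h^-1 *: (((fun x : R => F (w + x *: v)) \o shift x) (h *: 1)
      - F (w + x *: v))) =
    (fun h : R => h^-1 *: ((F \o shift (w + x *: v)) (h *: v) - F (w + x *: v))).
  by apply/funext => h /=; rewrite [h%:A]mulr1 scalerDl addrCA.
have dl : derivable (fun x : R => F (w + x *: v)) x 1.
  by rewrite /derivable E; exact: diff_derivable.
apply: DeriveDef; first by move/derivable_mxP : dl; exact.
have -> : 'D_v F (w + x *: v) = 'D_1 (fun x : R => F (w + x *: v)) x.
  by rewrite /derive E.
by rewrite derive_mx// mxE.
Qed.

End Line.

Lemma derive_coord m n (F : 'cV[R]_m -> 'cV[R]_n) v u : differentiable F u ->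
  'D_v F u = \sum_i v i ord0 *: 'D_(delta_mx i ord0) F u.
Proof.
move=> dF; rewrite deriveE//.
rewrite {1}(_ : v = \sum_i v i ord0 *: delta_mx i ord0); last first.
  apply/matrixP => i j; rewrite (ord1 j) summxE (bigD1 i)//= !mxE !eqxx mulr1.
  by rewrite big1 ?addr0// => k ki; rewrite !mxE eq_sym (negbTE ki) mulr0.
by rewrite linear_sum; apply: eq_bigr => i _; rewrite linearZ/= deriveE.
Qed.

(** Ordered multi-indices, permutations not merged, to match the nested derivatives of
    [iter_deriv]. *)
Fixpoint midx (m k : nat) : seq (seq 'I_m) :=
  if k is k'.+1 then [seq i :: l | i <- enum 'I_m, l <- midx m k'] else [:: [::]].

Lemma size_midx m k l : l \in midx m k -> size l = k.
Proof.
elim: k l => [|k IH] l /=; first by rewrite inE => /eqP->.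
by move=> /allpairsP[[i l'] [_ /= /IH <- ->]].
Qed.

Definition mdir m (l : seq 'I_m) : seq 'cV[R]_m := [seq delta_mx i ord0 | i <- l].

Lemma derive_sum_seq m n (I : Type) (r : seq I) (F : I -> 'cV[R]_m -> 'cV[R]_n)
    (c : I -> R) v u : (forall i, differentiable (F i) u) ->
  'D_v (fun u => \sum_(i <- r) c i *: F i u) u = \sum_(i <- r) c i *: 'D_v (F i) u.
Proof.
move=> dF; suff [] : is_derive u v (fun u => \sum_(i <- r) c i *: F i u)
  (\sum_(i <- r) c i *: 'D_v (F i) u) by [].
elim: r => [|i r IH].
  rewrite big_nil (_ : (fun _ => _) = cst 0); first exact: is_derive_cst.
  by apply/funext => x; rewrite big_nil.
rewrite big_cons (_ : (fun _ => _) =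
  (c i *: F i) + (fun u => \sum_(i <- r) c i *: F i u)); last first.
  by apply/funext => x; rewrite big_cons.
apply: is_deriveD; apply: is_deriveZ; apply: derivableP; exact: diff_derivable.
Qed.

(** This separates base point from direction: the coefficients are derivatives at [u], and the
    direction enters only through monomials, whose differences the product rule controls. *)
Lemma iter_deriv_coord m n (sigma : 'cV[R]_m -> 'cV[R]_n) v k u : smooth sigma ->
  iter_deriv (nseq k v) sigma u =
  \sum_(l <- midx m k) (\prod_(i <- l) v i ord0) *: iter_deriv (mdir l) sigma u.
Proof.
move=> sm; elim: k u => [|k IH] u.
  by rewrite /= big_seq1 big_nil scale1r.
rewrite /= big_allpairs_dep/=.
rewrite (_ : iter_deriv (nseq k v) sigma = fun u =>
  \sum_(l <- midx m k) (\prod_(i <- l) v i ord0) *: iter_deriv (mdir l) sigma u);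
  last exact/funext.
rewrite derive_sum_seq; last by move=> l; exact: sm.
have E l : (\prod_(j <- l) v j ord0) *: 'D_v (iter_deriv (mdir l) sigma) u =
    \sum_i (\prod_(j <- l) v j ord0) *:
      (v i ord0 *: 'D_(delta_mx i ord0) (iter_deriv (mdir l) sigma) u).
  by rewrite (derive_coord v (sm (mdir l) u)) scaler_sumr.
transitivity (\sum_(l <- midx m k) \sum_i (\prod_(j <- l) v j ord0) *:
      (v i ord0 *: 'D_(delta_mx i ord0) (iter_deriv (mdir l) sigma) u)).
  by apply: eq_bigr => l _; exact: E.
rewrite exchange_big/= [RHS]big_enum/=; apply: eq_bigr => i _; apply: eq_bigr => l _.
by rewrite big_cons scalerA mulrC.
Qed.

End Taylor.

(** * Finite differences of a composition *)

Section Composition.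
Context {R : realType}.

Lemma lip_bounded m n (sigma : 'cV[R]_m -> 'cV[R]_n) (A : R) :
  glob_lipschitz sigma -> exists2 C : R, 0 <= C &
    forall w : 'cV[R]_m, (forall i, `|w i ord0| <= A) ->
      forall c, `|sigma w c ord0| <= C.
Proof.
move=> [L lipL]; exists (`|L| * (m%:R * `|A|) + enorm (sigma 0)).
  by rewrite addr_ge0 ?enorm_ge0 ?mulr_ge0.
move=> w wA c.
have -> : sigma w c ord0 = (sigma w - sigma 0) c ord0 + sigma 0 c ord0.
  by rewrite !mxE subrK.
rewrite (le_trans (ler_normD _ _))// lerD ?coord_le_enorm//.
rewrite (le_trans (coord_le_enorm _ _))// (le_trans (lipL _ _))//.
rewrite subr0 (le_trans (ler_norm _))// normrM ler_wpM2l//.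
rewrite ger0_norm ?enorm_ge0// (le_trans (enorm_le_sum _))//.
rewrite mulr_natl -[m in leRHS]card_ord -sumr_const ler_sum// => i _.
by rewrite (le_trans (wA i))// ler_norm.
Qed.

(* For Y >= 1 the bound follows from the boundedness of sigma on the range of w;
   for Y <= 1 expand sigma o w at w 0, so that every monomial of the Taylor
   polynomial is a product of sequences whose j-th differences are O(Y^j). *)
Lemma chain_bound m n s (sigma : 'cV[R]_m -> 'cV[R]_n) (A B : R) :
    (0 < s)%N -> 0 <= B -> smooth sigma -> glob_lipschitz sigma ->
    deriv_bounded s B sigma ->
  exists2 C : R, 0 <= C & forall (w : nat -> 'cV[R]_m) c (Y : R), 0 <= Y ->
    (forall r i, (r <= s)%N -> `|w r i ord0| <= A) ->
    (forall j r i, (0 < j)%N -> (j + r <= s)%N ->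
      `|difn succn j (fun r => w r i ord0) r| <= Y ^+ j) ->
    `|difn succn s (fun r => sigma (w r) c ord0) 0%N| <= C * Y ^+ s.
Proof.
move=> s0 B0 sm lip db; have [A' A'0 hA'] := lip_bounded A lip.
pose C1 := \sum_(k < s) \sum_(l <- midx m k) B * (2 ^+ s * s%:R) ^+ k.
pose C2 := 2 ^+ s * (B * (m%:R * s%:R) ^+ s).
have C10 : 0 <= C1.
  by do 2!apply: sumr_ge0 => *; rewrite mulr_ge0 ?exprn_ge0 ?mulr_ge0 ?exprn_ge0.
have C20 : 0 <= C2 by rewrite !mulr_ge0 ?exprn_ge0 ?mulr_ge0.
exists (C1 + C2 + 2 ^+ s * A'); first by rewrite !addr_ge0// mulr_ge0// exprn_ge0.
move=> w c Y Y0 wA wY.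
have [Y1|Y1] := leP 1 Y.
  apply: (@le_trans _ _ (2 ^+ s * A')).
    apply: difn_sup => i; rewrite add0n => /= is_; apply: hA' => q; exact: wA.
  rewrite -[leLHS]mulr1 ler_pM// ?mulr_ge0 ?exprn_ge0 ?exprn_ege1//.
  by rewrite lerDr addr_ge0.
have {}Y1 := ltW Y1.
pose a i r := w r i ord0 - w 0%N i ord0.
have s1 : 1 <= s%:R :> R by rewrite ler1n.
have aY i r : (r <= s)%N -> `|a i r| <= s%:R * Y.
  move=> rs; apply: (@le_trans _ _ (r%:R * Y)); last by rewrite ler_wpM2r ?ler_nat.
  elim: r rs => [|r IH] rs; first by rewrite /a subrr normr0 mul0r.
  rewrite /a -(subrK (w r i ord0) (w r.+1 i ord0)) -addrA -[r.+1]addn1 natrD mulrDl.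
  rewrite addrC mul1r (le_trans (ler_normD _ _))// lerD//.
    by rewrite IH// ltnW.
  by rewrite addn1; have := wY 1%N r i isT rs; rewrite expr1.
(* At order 0 the bound s Y is weakened to s, which uses Y <= 1; from order 1 on the constant [w 0]
   drops out of the differences. *)
have ag i : grows Y s%:R s (a i).
  move=> [|j] r jr; first by rewrite expr0 mulr1 (le_trans (aY _ _ _))// ler_piMr.
  rewrite (@eq_difn _ _ _ _ _ (fun r => w r i ord0 + - w 0%N i ord0))//.
  rewrite difnD difn_cst addr0 (le_trans (wY _ _ _ _ _))//.
  by rewrite ler_peMl// exprn_ge0.
pose v r := w r - w 0%N.
pose K k l := iter_deriv (mdir l) sigma (w 0%N) c ord0 / k`!%:R.
pose rem r := sigma (w r) c ord0 -
  \sum_(k < s) \sum_(l <- midx m k) K k l * \prod_(i <- l) a i r.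
(* The Taylor remainder is already O(Y^s) at each of the s + 1 points, so the trivial bound on its
   s-th difference is enough. *)
have remP r : (r <= s)%N -> `|rem r| <= B * (m%:R * s%:R) ^+ s * Y ^+ s.
  move=> rs.
  have ev : enorm (v r) <= m%:R * s%:R * Y.
    rewrite (le_trans (enorm_le_sum _))// -mulrA.
    rewrite mulr_natl -[m in leRHS]card_ord -sumr_const ler_sum// => i _.
    by rewrite !mxE; exact: aY.
  rewrite -mulrA -exprMn.
  apply: (@le_trans _ _ (B * enorm (v r) ^+ s)); last first.
    by rewrite ler_wpM2l// lerXn2r ?nnegrE ?enorm_ge0 ?mulr_ge0.
  pose g k x := iter_deriv (nseq k (v r)) sigma (w 0%N + x *: v r) c ord0.
  have dg k x : is_derive x (1 : R) (g k) (g k.+1 x).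
    by apply: is_derive_line; exact: sm.
  have gB x : 0 <= x <= 1 -> `|g s x| <= B * enorm (v r) ^+ s.
    move=> _; rewrite (le_trans (coord_le_enorm _ _))//.
    rewrite (le_trans (db _ _ _)) ?size_nseq ?s0 ?leqnn//.
    by rewrite big_nseq iter_mulr_1.
  have := taylor_bound dg gB (_ : 0 <= 1 <= 1); rewrite ler01 lexx => /(_ isT).
  rewrite /g scale1r /= subrKC; congr (`| _ - _ | <= _).
  apply: eq_bigr => k _; rewrite expr1n mulr1 scale0r addr0 iter_deriv_coord//.
  rewrite summxE mulr_suml; apply: eq_bigr => l _.
  rewrite !mxE /K [RHS]mulrC mulrA; congr (_ * _ * _).
  by apply: eq_bigr => i _; rewrite !mxE.
rewrite (@eq_difn _ _ _ _ _ (fun r => (\sum_(k < s) \sum_(l <- midx m k)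
   K k l * \prod_(i <- l) a i r) + rem r)); last by move=> r; rewrite /rem addrC subrK.
rewrite difnD 2!mulrDl (le_trans (ler_normD _ _))//.
rewrite -[leLHS]addr0 lerD ?mulr_ge0 ?exprn_ge0// lerD//; last first.
  rewrite /C2 -mulrA difn_sup// => r /andP[_]; rewrite add0n => /remP.
rewrite difn_sum (le_trans (ler_norm_sum _ _ _))// /C1 mulr_suml ler_sum// => k _.
rewrite difn_sum (le_trans (ler_norm_sum _ _ _))// mulr_suml.
rewrite big_seq [leRHS]big_seq ler_sum// => l lk; have sl := size_midx lk.
rewrite difnZl normrM.
(* The constant monomial involves sigma itself, on which [deriv_bounded] says nothing; it is killed
   by the s >= 1 differences. *)
case: l {lk} sl => [|i0 l] sl.
  rewrite (@eq_difn _ _ _ _ _ (fun=> 1)); last by move=> x; rewrite big_nil.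
  have -> : difn succn s (fun=> 1 : R) 0%N = 0.
    by rewrite -(prednK s0) difn_cst.
  rewrite normr0 mulr0.
  by rewrite !mulr_ge0 ?exprn_ge0 ?mulr_ge0 ?exprn_ge0.
rewrite -mulrA ler_pM//.
  rewrite /K normrM (le_trans (_ : _ <= `|iter_deriv (mdir (i0 :: l)) sigma (w 0%N) c ord0|))//.
    rewrite ler_piMr// ger0_norm ?invr_ge0// invf_le1 ?ltr0n ?fact_gt0//.
    by rewrite ler1n fact_gt0.
  rewrite (le_trans (coord_le_enorm _ _))//.
  have szl : (0 < size (mdir (i0 :: l) : seq 'cV[R]_m) <= s)%N.
    by rewrite size_map /= -[(size l).+1]/(size (i0 :: l)) sl ltnW.
  rewrite (le_trans (db _ _ szl))// big_map big1 ?mulr1// => i _.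
  exact: enorm_delta.
have := grows_prod (i0 :: l) Y0 (ler0n R s) ag.
by move=> /(_ s 0%N); rewrite addn0 sl; apply.
Qed.

(** At a point g the scale Y of [chain_bound] is chosen so that Y^s is the sum of |Delta^j u|^(s/j)
    over coordinates, orders and the first s + 1 points of the orbit of g. Squaring and summing over
    g leaves |Delta^j u|^(2s/j), the quantity that the Gagliardo-Nirenberg inequality controls. *)
Lemma composition_bound m n s (sigma : 'cV[R]_m -> 'cV[R]_n) (A B : R) :
    (0 < s)%N -> 0 <= B -> smooth sigma -> glob_lipschitz sigma ->
    deriv_bounded s B sigma ->
  exists2 C : R, 0 <= C & forall (T : finType) (tau : T -> T) (u : T -> 'cV[R]_m),
    injective tau -> (forall g i, `|u g i ord0| <= A) -> forall c,
    \sum_g difn tau s (fun g => sigma (u g) c ord0) g ^+ 2 <=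
    C * \sum_i \sum_g difn tau s (fun g => u g i ord0) g ^+ 2.
Proof.
move=> s0 B0 sm lip db.
have [C0 C00 hC0] := chain_bound A s0 B0 sm lip db.
have /choice[G hG] : forall j : 'I_s, exists C : R, 0 <= C /\
    forall (T : finType) (tau : T -> T) (u : T -> R),
    injective tau -> (forall g, `|u g| <= A) ->
    gn_sum tau s j.+1 u <= C * \sum_g difn tau s u g ^+ 2.
  move=> j; have [|C C_0 hC] := @gagliardo_nirenberg R s j.+1 A; first exact: ltn_ord.
  by exists C.
(* Coordinate, order minus one, position along the orbit. *)
pose J := ('I_m * 'I_s * 'I_s.+1)%type.
pose Gt := \sum_j G j.
have Gt0 : 0 <= Gt by apply: sumr_ge0 => j _; exact: (hG j).1.
exists (C0 ^+ 2 * #|{: J}|%:R * (#|{: J}|%:R * Gt)).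
  by rewrite !mulr_ge0 ?exprn_ge0.
move=> T tau u taui uA c.
pose x (p : J) g : R := difn tau p.1.2.+1 (fun g => u g p.1.1 ord0) (iter p.2 tau g).
pose e (p : J) : R := s%:R / p.1.2.+1%:R.
have sR0 : 0 < s%:R :> R by rewrite ltr0n.
have X0 p g : 0 <= `|x p g| `^ e p by exact: powR_ge0.
set S := \sum_i _.
have S0 : 0 <= S.
  by apply: sumr_ge0 => i _; apply: sumr_ge0 => g _; exact: sqr_ge0.
apply: (@le_trans _ _ (\sum_g C0 ^+ 2 * (#|{: J}|%:R *
    \sum_p (`|x p g| `^ e p) ^+ 2))).
  apply: ler_sum => g _.
  pose Z := \sum_p `|x p g| `^ e p.
  have Z0 : 0 <= Z by exact: sumr_ge0.
  pose Y := Z `^ s%:R^-1.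
  have YZ : Y ^+ s = Z.
    by rewrite -powR_mulrn ?powR_ge0// -powRrM mulVf ?gt_eqF// powRr1.
  apply: (@le_trans _ _ ((C0 * Y ^+ s) ^+ 2)); last first.
    by rewrite exprMn ler_wpM2l ?exprn_ge0// YZ; exact: sqr_sum_fin_le.
  rewrite -(real_normK (num_real (difn _ _ _ _))) lerXn2r ?nnegrE//.
    by rewrite mulr_ge0 ?exprn_ge0 ?powR_ge0.
  have := @difn_orbit _ _ tau s (fun g => sigma (u g) c ord0) 0 g.
  rewrite [iter 0 tau g]/= => ->.
  apply: (hC0 (fun r => u (iter r tau g))) => //; first exact: powR_ge0.
  move=> [//|j] r i _ jr; have js : (j < s)%N by lia.
  have rs : (r < s.+1)%N by lia.
  rewrite -(difn_orbit tau j.+1 (fun g => u g i ord0) r g).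
  pose p : J := (i, Ordinal js, Ordinal rs).
  rewrite -[X in `|X|]/(x p g).
  have -> : `|x p g| = (`|x p g| `^ e p) `^ (j.+1%:R / s%:R).
    by rewrite -powRrM /e /= mulrA divfK ?pnatr_eq0// mulfV ?gt_eqF// powRr1.
  have -> : Y ^+ j.+1 = Z `^ (j.+1%:R / s%:R).
    by rewrite -powR_mulrn ?powR_ge0// /Y -powRrM mulrC.
  apply: ge0_ler_powR; rewrite ?nnegrE ?divr_ge0//.
  by rewrite /Z (bigD1 p)//= lerDl sumr_ge0.
rewrite -mulr_sumr -mulrA -!mulrA ler_wpM2l ?exprn_ge0// -mulr_sumr ler_wpM2l//.
rewrite ler_wpM2l// exchange_big/= mulr_natl -sumr_const ler_sum// => p _.
have := (hG p.1.2).2 T tau (fun g => u g p.1.1 ord0) taui (fun g => uA g _).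
rewrite /gn_sum => H.
rewrite (eq_bigr (fun g => `|x p g| `^ ((2 * s)%:R / p.1.2.+1%:R))); last first.
  move=> g _; rewrite -powR_mulrn ?powR_ge0// -powRrM natrM /e.
  by congr (_ `^ _); ring.
rewrite /x (sum_shift_iter p.2 (fun g => `|difn tau p.1.2.+1 (fun g => u g p.1.1 ord0) g| `^ _))//.
apply: le_trans H _; apply: ler_pM => //.
- exact: (hG _).1.
- by apply: sumr_ge0 => g _; exact: sqr_ge0.
- by rewrite /Gt (bigD1 p.1.2)//= lerDl sumr_ge0// => j _; exact: (hG j).1.
- rewrite /S (bigD1 p.1.1)//= lerDl sumr_ge0// => i _.
  by apply: sumr_ge0 => g _; exact: sqr_ge0.
Qed.

End Composition.

(** * Convergence of Riemann sums on the cube *)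

Section RiemannSums1.
Context {R : realType}.
Local Notation mu := (@lebesgue_measure R).

Lemma continuous_integrable01 (G : R -> R) :
  (forall y, 0 <= y <= 1 -> {for y, continuous G}) ->
  mu.-integrable `[0, 1] (EFin \o G).
Proof.
move=> cG; apply: continuous_compact_integrable; first exact: segment_compact.
by apply: continuous_in_subspaceT => y /[1!inE]/=; rewrite in_itv/= => /cG.
Qed.

Lemma fine_mu_itv (a b : R) : a <= b -> fine (mu `[a, b]) = b - a.
Proof.
move=> ab; rewrite lebesgue_measure_itv/= lte_fin; case: ltP => // ba.
by rewrite (le_anti (introT andP (conj ab ba))) subrr.
Qed.

Lemma Rintegral_near_cst (a b c w : R) (G : R -> R) : a <= b ->
  mu.-integrable `[a, b] (EFin \o G) ->
  (forall y, a <= y <= b -> `|G y - c| <= w) ->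
  `|\int[mu]_(y in `[a, b]) G y - c * (b - a)| <= w * (b - a).
Proof.
move=> ab iG Gc.
have icst r : mu.-integrable `[a, b] (EFin \o cst r).
  apply: continuous_compact_integrable; first exact: segment_compact.
  by apply: continuous_subspaceT => y; exact: cvg_cst.
have Gc' y : `[a, b]%classic y -> c - w <= G y <= c + w.
  by rewrite /= in_itv/= => /Gc; rewrite ler_distl.
have H1 : \int[mu]_(y in `[a, b]) (c - w) <= \int[mu]_(y in `[a, b]) G y.
  by apply: le_Rintegral; [exact: measurable_itv|exact: icst|exact: iG|
    move=> y /Gc' /andP[]].
have H2 : \int[mu]_(y in `[a, b]) G y <= \int[mu]_(y in `[a, b]) (c + w).
  by apply: le_Rintegral; [exact: measurable_itv|exact: iG|exact: icst|
    move=> y /Gc' /andP[]].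
move: H1 H2; rewrite !Rintegral_cst// !fine_mu_itv// => H1 H2.
by rewrite ler_distl -mulrBl -mulrDl H1 H2.
Qed.

Lemma Rintegral_dist (e : R) (G1 G2 : R -> R) :
  mu.-integrable `[0, 1] (EFin \o G1) -> mu.-integrable `[0, 1] (EFin \o G2) ->
  (forall y, 0 <= y <= 1 -> `|G1 y - G2 y| <= e) ->
  `|\int[mu]_(y in `[0, 1]) G1 y - \int[mu]_(y in `[0, 1]) G2 y| <= e.
Proof.
move=> i1 i2 G12; rewrite -RintegralB//.
have := @Rintegral_near_cst 0 1 0 e (fun y => G1 y - G2 y) ler01 _ _.
rewrite mul0r !subr0 mulr1; apply.
  rewrite (_ : EFin \o _ = (EFin \o G1) \- (EFin \o G2))%E//.
  exact: integrableB.
by move=> y /G12; rewrite subr0.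
Qed.

Lemma riemann_sum1 (N : nat) (w : R) (G : R -> R) : (0 < N)%N ->
  mu.-integrable `[0, 1] (EFin \o G) ->
  (forall x y, 0 <= x <= 1 -> 0 <= y <= 1 -> `|x - y| <= N%:R^-1 ->
     `|G x - G y| <= w) ->
  `|\int[mu]_(y in `[0, 1]) G y - N%:R^-1 * \sum_(n < N) G (n%:R / N%:R)| <= w.
Proof.
move=> N0 iG Gw.
have NR : 0 < N%:R :> R by rewrite ltr0n.
have iGab a b : 0 <= a -> b <= 1 -> mu.-integrable `[a, b] (EFin \o G).
  move=> a0 b1; apply: integrableS iG => //.
  move=> y /=; rewrite !in_itv/= => /andP[ay yb].
  by rewrite (le_trans a0)//= (le_trans yb).
suff H : forall m, (m <= N)%N -> `|\int[mu]_(y in `[0, (m%:R / N%:R)%R]) G y -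
    N%:R^-1 * \sum_(n < m) G (n%:R / N%:R)| <= w * (m%:R / N%:R).
  by have := H N (leqnn N); rewrite divff ?gt_eqF// mulr1.
elim=> [_|m IH mN].
  by rewrite mul0r mulr0 big_ord0 mulr0 subr0 set_itv1 Rintegral_set1 normr0.
have m1 : m%:R / N%:R <= m.+1%:R / N%:R :> R by rewrite ler_pM2r ?invr_gt0// ler_nat.
have m0 : 0 <= m%:R / N%:R :> R by rewrite divr_ge0.
have mN1 : m.+1%:R / N%:R <= 1 :> R by rewrite ler_pdivrMr// mul1r ler_nat.
have len : m.+1%:R / N%:R - m%:R / N%:R = N%:R^-1 :> R.
  by rewrite -mulrBl -natrB// subSnn mul1r.
have E : \int[mu]_(y in `[0, (m.+1%:R / N%:R)%R]) G y =
    \int[mu]_(y in `[0, (m%:R / N%:R)%R]) G y +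
    \int[mu]_(y in `[(m%:R / N%:R)%R, (m.+1%:R / N%:R)%R]) G y.
  rewrite -(@Rintegral_itv_obnd_cbnd _ (m%:R / N%:R) (BRight (m.+1%:R / N%:R)) G);
    last first.
    apply: integrableS (iGab _ _ m0 mN1) => //.
    by move=> y /=; rewrite !in_itv/= => /andP[/ltW -> ->].
  by rewrite -(@Rintegral_itvB _ G (BLeft 0) (BRight (m.+1%:R / N%:R)) (m%:R / N%:R));
    rewrite ?bnd_simp ?subrKC//; [exact: iGab].
rewrite E big_ord_recr/= mulrDr opprD addrACA (le_trans (ler_normD _ _))//.
have -> : w * (m.+1%:R / N%:R) = w * (m%:R / N%:R) + w * N%:R^-1.
  by rewrite -len; ring.
rewrite lerD ?IH ?(ltnW mN)//.
have := @Rintegral_near_cst (m%:R / N%:R) (m.+1%:R / N%:R) (G (m%:R / N%:R)) w G m1.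
rewrite len (mulrC (G _)); apply; first exact: iGab.
move=> y /andP[y1 y2]; apply: Gw.
- by rewrite (le_trans m0)//= (le_trans y2).
- by rewrite m0 (le_trans m1).
- by rewrite ger0_norm ?subr_ge0// (le_trans (lerB y2 (lexx _)))// len.
Qed.

End RiemannSums1.

Section RiemannSums.
Context {R : realType}.
Local Notation mu := (@lebesgue_measure R).

Definition in_cube d (x : 'rV[R]_d) := forall i, 0 <= x ord0 i <= 1.

Lemma cube_compact d : compact [set x : 'rV[R]_d | in_cube x].
Proof.
have := @rV_compact R d (fun=> `[0, 1]%classic) 
  (fun=> @segment_compact R 0 1).
congr compact.
Qed.

Lemma cube_unif_continuous d (f : 'rV[R]_d -> R) (e : R) : continuous f -> 0 < e ->
  exists2 del : R, 0 < del & forall x y : 'rV[R]_d, in_cube x ->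
    (forall i, `|x ord0 i - y ord0 i| < del) -> `|f x - f y| < e.
Proof.
move=> cf e0; pose P (del : R) (x : 'rV[R]_d) := forall y : 'rV[R]_d,
  (forall i, `|x ord0 i - y ord0 i| < del) -> `|f x - f y| < e.
have /compact_near_coveringP/(_ R (0^'+)%classic P) := @cube_compact d.
case=> [x _|del /= del0 H].
  have e20 : 0 < e / 2 by rewrite divr_gt0.
  have /cvgrPdist_lt /(_ _ e20) := cf x.
  move=> /nbhs_ballP[r /= r0 rP].
  have r20 : 0 < r / 2 by rewrite divr_gt0.
  exists (ball x (r / 2), [set del | 0 < del < r / 2]) => /=.
    split; first exact: nbhsx_ballx.
    near=> t; apply/andP; split; first by near: t; exact: nbhs_right_gt.
    by near: t; exact: nbhs_right_lt.
  move=> [x' t] /= [[_ xx'] /andP[t0 tr]] y x'y.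
  have xy : ball x r y.
    split=> // i j; rewrite (splitr r); apply: (ball_triangle (xx' i j)).
    rewrite (ord1 i) /ball /= (lt_trans (x'y j))//.
  have xx'r : ball x r x' by split=> // i j; apply: le_ball (xx' i j); lra.
  rewrite (splitr e) -(subrKA (f x)) (le_lt_trans (ler_normD _ _))// ltrD//.
    by rewrite distrC; exact: rP.
  exact: rP.
exists (del / 2); first by rewrite divr_gt0.
move=> x y Qx xy; apply: (H (del / 2)) => //=; last by rewrite divr_gt0.
by rewrite sub0r normrN ger0_norm ?divr_ge0 ?ltW//; move: del0 => /= ?; lra.
Unshelve. all: by end_near. Qed.

Lemma row_mx_cons_coord d (y : R) (x : 'rV[R]_d) (i : 'I_d.+1) :
  (row_mx (y%:M : 'rV_1) x : 'rV_(1 + d)) ord0 i =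
  if unlift ord0 i is Some j then x ord0 j else y.
Proof.
case: unliftP => [j ->|->].
  rewrite (_ : lift ord0 j = rshift 1 j); last exact: val_inj.
  by rewrite row_mxEr.
rewrite (_ : ord0 = lshift d (ord0 : 'I_1)); last exact: val_inj.
by rewrite row_mxEl mxE eqxx mulr1n.
Qed.

Definition rcons0 d (y : R) (x : 'rV[R]_d) : 'rV[R]_d.+1 := row_mx (y%:M : 'rV_1) x.

Lemma slice_continuous d (f : 'rV[R]_d.+1 -> R) (y : R) : continuous f ->
  continuous (fun x : 'rV[R]_d => f (rcons0 y x)).
Proof.
move=> cf x; have FF : Filter (nbhs x) by exact: nbhs_filter.
apply/cvgrPdist_lt => e e0.
have /cvgrPdist_lt /(_ _ e0) /nbhs_ballP[r /= r0 rP] := cf (rcons0 y x).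
exists (fun i j => ball (x i j) r) => [i j|x' xx']; first exact: nbhsx_ballx.
apply: rP; split=> // i j.
rewrite (ord1 i) /rcons0 !row_mx_cons_coord.
by case: unliftP => [k _|_]; [exact: xx'|exact: ballxx].
Qed.

Lemma in_cube_rcons0 d (y : R) (x : 'rV[R]_d) : 0 <= y <= 1 -> in_cube x ->
  in_cube (rcons0 y x).
Proof.
by move=> y01 Qx i; rewrite /rcons0 row_mx_cons_coord; case: unliftP => [j _|_].
Qed.

Lemma rcons0_dist d (y y' e : R) (x x' : 'rV[R]_d) :
  `|y - y'| < e -> (forall i, `|x ord0 i - x' ord0 i| < e) ->
  forall i, `|rcons0 y x ord0 i - rcons0 y' x' ord0 i| < e.
Proof.
by move=> yy xx i; rewrite /rcons0 !row_mx_cons_coord; case: unliftP => [j _|_].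
Qed.

Lemma rcons0_dist_le d (y y' e : R) (x x' : 'rV[R]_d) :
  `|y - y'| <= e -> (forall i, `|x ord0 i - x' ord0 i| <= e) ->
  forall i, `|rcons0 y x ord0 i - rcons0 y' x' ord0 i| <= e.
Proof.
by move=> yy xx i; rewrite /rcons0 !row_mx_cons_coord; case: unliftP => [j _|_].
Qed.

Lemma cube_int_rcons0 d (f : 'rV[R]_d.+1 -> R) :
  cube_int f = \int[mu]_(y in `[0, 1]) cube_int (fun x => f (rcons0 y x)).
Proof. by []. Qed.

(** The first hypothesis is [cube_int_dist] one dimension lower. Comparing iterated integrals needs
    integrable slices, and integrability of the slices needs that comparison, so both go through one
    induction on d. *)
Lemma cube_int_slice d (f : 'rV[R]_d.+1 -> R) :
  (forall (f1 f2 : 'rV[R]_d -> R) e, continuous f1 -> continuous f2 ->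
     (forall x, in_cube x -> `|f1 x - f2 x| <= e) ->
     `|cube_int f1 - cube_int f2| <= e) ->
  continuous f ->
  mu.-integrable `[0, 1] (EFin \o (fun y => cube_int (fun x => f (rcons0 y x)))).
Proof.
move=> IH cf; apply: continuous_integrable01 => y y01.
apply/cvgrPdist_le => e e0.
have [del del0 H] := cube_unif_continuous cf e0.
near=> y'; apply: IH; try exact: slice_continuous.
move=> x Qx; apply/ltW/H; first exact: in_cube_rcons0.
apply: rcons0_dist => [|i]; last by rewrite subrr normr0.
by near: y'; exists del.
Unshelve. all: by end_near. Qed.

Lemma cube_int_dist d (f1 f2 : 'rV[R]_d -> R) e : continuous f1 -> continuous f2 ->
  (forall x, in_cube x -> `|f1 x - f2 x| <= e) ->
  `|cube_int f1 - cube_int f2| <= e.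
Proof.
elim: d f1 f2 e => [|d IH] f1 f2 e c1 c2 f12.
  by apply: f12 => -[].
rewrite !cube_int_rcons0; apply: Rintegral_dist; try exact: cube_int_slice.
move=> y y01; apply: IH; try exact: slice_continuous.
by move=> x Qx; apply: f12; exact: in_cube_rcons0.
Qed.

Lemma sum_rV_cons (V : nmodType) (T : finType) d (F : 'rV[T]_d.+1 -> V) :
  \sum_n F n = \sum_(a : T) \sum_(n : 'rV[T]_d) F (row_mx (\row_(_ < 1) a) n).
Proof.
rewrite pair_big/= (reindex (fun p : T * 'rV[T]_d =>
   row_mx (\row_(_ < 1) p.1) p.2 : 'rV[T]_(1 + d)))//=.
exists (fun n : 'rV[T]_(1 + d) => (n ord0 ord0, rsubmx n)) => [[a n]|n] _ /=.
  rewrite row_mxKr; congr (_, _).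
  rewrite (_ : ord0 = lshift d (ord0 : 'I_1)); last exact: val_inj.
  by rewrite row_mxEl mxE.
apply/rowP => i; rewrite -[in RHS](hsubmxK n); congr (row_mx _ _ _ _).
apply/rowP => j; rewrite !mxE (ord1 j); congr (n _ _); exact: val_inj.
Qed.

Lemma gridpt_cons N d (a : 'I_N) (n : 'rV['I_N]_d) :
  gridpt R (row_mx (\row_(_ < 1) a) n : 'rV_(1 + d)) =
  rcons0 (a%:R / N%:R) (gridpt R n).
Proof.
apply/rowP => i; rewrite /rcons0 row_mx_cons_coord mxE.
case: unliftP => [j ->|->].
  rewrite (_ : lift ord0 j = rshift 1 j); last exact: val_inj.
  by rewrite row_mxEr mxE.
rewrite (_ : ord0 = lshift d (ord0 : 'I_1)); last exact: val_inj.
by rewrite row_mxEl mxE.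
Qed.

Lemma riemann_sum d N (w : R) (f : 'rV[R]_d -> R) : (0 < N)%N -> 0 <= w ->
  continuous f ->
  (forall x y, in_cube x -> in_cube y ->
     (forall i, `|x ord0 i - y ord0 i| <= N%:R^-1) -> `|f x - f y| <= w) ->
  `|cube_int f - (N%:R ^+ d)^-1 * \sum_(n : 'rV['I_N]_d) f (gridpt R n)| <= w *+ d.
Proof.
move=> N0; have NR : 0 < N%:R :> R by rewrite ltr0n.
elim: d f => [|d IH] f w0 cf fw.
  rewrite expr0 invr1 mul1r (eq_bigr (fun=> f 0)); last first.
    by move=> n _; congr f; apply/rowP => -[].
  by rewrite sumr_const card_mx muln0 expn0 mulr1n subrr normr0.
rewrite cube_int_rcons0 sum_rV_cons.
under eq_bigr do under eq_bigr do rewrite gridpt_cons.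
pose G (y : R) := cube_int (fun x : 'rV[R]_d => f (rcons0 y x)).
have iG : mu.-integrable `[0, 1] (EFin \o G).
  by apply: cube_int_slice => // f1 f2 e; exact: cube_int_dist.
rewrite -(subrKA (N%:R^-1 * \sum_(n < N) G (n%:R / N%:R))) mulrS.
rewrite (le_trans (ler_normD _ _))// lerD//.
  apply: riemann_sum1 => // x y x01 y01 xy.
  apply: cube_int_dist; try exact: slice_continuous.
  move=> z Qz; apply: fw; try exact: in_cube_rcons0.
  by apply: rcons0_dist_le => // i; rewrite subrr normr0 invr_ge0 ltW.
rewrite exprS invfM -mulrA -mulrBr mulr_sumr -sumrB normrM ger0_norm ?invr_ge0 ?(ltW NR)//.
have -> : w *+ d = N%:R^-1 * \sum_(n < N) w *+ d.
  by rewrite sumr_const card_ord -[X in _ * X]mulr_natl mulKf ?gt_eqF.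
rewrite ler_pM2l ?invr_gt0//.
rewrite (le_trans (ler_norm_sum _ _ _))// ler_sum// => n _.
have n01 : 0 <= (n%:R / N%:R : R) <= 1.
  by rewrite divr_ge0//= ler_pdivrMr// mul1r ler_nat ltnW.
apply: IH => //; first exact: slice_continuous.
move=> x y Qx Qy xy; apply: fw; try exact: in_cube_rcons0.
by apply: rcons0_dist_le => //; rewrite subrr normr0 invr_ge0 ltW.
Qed.

Definition grid_mean N d (f : 'rV[R]_d -> R) : R :=
  (N%:R ^+ d)^-1 * \sum_(n : 'rV['I_N]_d) f (gridpt R n).

Lemma grid_mean_cvg d (f : 'rV[R]_d -> R) : continuous f ->
  (fun N => grid_mean N f) @ \oo --> cube_int f.
Proof.
move=> cf; apply/cvgrPdist_le => e e0.
pose w := e / d.+1%:R.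
have w0 : 0 < w by rewrite divr_gt0.
have [del del0 H] := cube_unif_continuous cf w0.
near=> N.
have N0 : (0 < N)%N by near: N; exact: nbhs_infty_gt.
apply: (@le_trans _ _ (w *+ d)).
  apply: riemann_sum => //; first exact: ltW.
  move=> x y Qx Qy xy; apply/ltW/H => // i; apply: le_lt_trans (xy i) _.
  rewrite -(invrK del) ltf_pV2 ?posrE ?invr_gt0 ?ltr0n//.
  near: N; exact: nbhs_infty_gtr.
rewrite -mulr_natr /w mulrAC ler_pdivrMr// ler_wpM2l ?(ltW e0)//.
by rewrite ler_nat.
Unshelve. all: by end_near. Qed.

End RiemannSums.

(** * Aliasing *)

Section Cis.
Context {R : realType}.
Implicit Types (z w : R[i]) (x y : R).
Local Notation Re := (@complex.Re R).
Local Notation Im := (@complex.Im R).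
Local Notation normc := (@Normc.normc R).

Lemma normc_sqr z : normc z ^+ 2 = Re z ^+ 2 + Im z ^+ 2.
Proof. by case: z => a b /=; rewrite sqr_sqrtr// addr_ge0 ?sqr_ge0. Qed.

Lemma normc_ge0 z : 0 <= normc z.
Proof. by case: z => a b; exact: sqrtr_ge0. Qed.

Lemma Re_le_normc z : `|Re z| <= normc z.
Proof.
rewrite -(ler_pXn2r (ltn0Sn 1)) ?nnegrE ?normc_ge0// normc_sqr real_normK ?num_real//.
by rewrite lerDl sqr_ge0.
Qed.

Lemma Im_le_normc z : `|Im z| <= normc z.
Proof.
rewrite -(ler_pXn2r (ltn0Sn 1)) ?nnegrE ?normc_ge0// normc_sqr real_normK ?num_real//.
by rewrite lerDr sqr_ge0.
Qed.

Lemma normc_le_ReIm z : normc z <= `|Re z| + `|Im z|.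
Proof.
rewrite -(ler_pXn2r (ltn0Sn 1)) ?nnegrE ?normc_ge0 ?addr_ge0// normc_sqr sqrrD.
rewrite !real_normK ?num_real// addrAC lerDl mulrn_wge0// mulr_ge0//.
Qed.

Lemma normc_sum (I : Type) (r : seq I) (P : pred I) (F : I -> R[i]) :
  normc (\sum_(i <- r | P i) F i) <= \sum_(i <- r | P i) normc (F i).
Proof.
elim/big_rec2 : _ => [|i y x _ yx]; first by rewrite Normc.normc0.
by rewrite (le_trans (le_normcD _ _))// lerD2l.
Qed.

Lemma normc_real x : normc x%:C%C = `|x|.
Proof. by rewrite /= expr0n addr0 sqrtr_sqr. Qed.

Lemma normcN z : normc (- z) = normc z.
Proof. by case: z => x y /=; rewrite !sqrrN. Qed.

Lemma normcX z n : normc (z ^+ n) = normc z ^+ n.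
Proof.
elim: n => [|n IH]; first by rewrite !expr0 Normc.normc1.
by rewrite !exprS Normc.normcM IH.
Qed.

Lemma ReD z w : Re (z + w) = Re z + Re w.
Proof. by case: z w => a b [c e]. Qed.

Lemma ImD z w : Im (z + w) = Im z + Im w.
Proof. by case: z w => a b [c e]. Qed.

Lemma ReB z w : Re (z - w) = Re z - Re w.
Proof. by case: z w => a b [c e]. Qed.

Lemma ImB z w : Im (z - w) = Im z - Im w.
Proof. by case: z w => a b [c e]. Qed.

Lemma Re_sum (I : Type) (r : seq I) (P : pred I) (F : I -> R[i]) :
  Re (\sum_(i <- r | P i) F i) = \sum_(i <- r | P i) Re (F i).
Proof. exact: (big_morph Re ReD). Qed.

Lemma Im_sum (I : Type) (r : seq I) (P : pred I) (F : I -> R[i]) :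
  Im (\sum_(i <- r | P i) F i) = \sum_(i <- r | P i) Im (F i).
Proof. exact: (big_morph Im ImD). Qed.

Lemma Re_realM x z : Re (x%:C%C * z) = x * Re z.
Proof. by case: z => a b /=; rewrite mul0r subr0. Qed.

Lemma Im_realM x z : Im (x%:C%C * z) = x * Im z.
Proof. by case: z => a b /=; rewrite mul0r addr0. Qed.

Lemma cisD x y : cis (x + y) = cis x * cis y.
Proof.
by rewrite /cis cosD sinD; apply/eqP; rewrite eq_complex /= eqxx /= addrC mulrC
  [X in _ + X]mulrC.
Qed.

Lemma cis0 : cis 0 = 1 :> R[i].
Proof. by rewrite /cis cos0 sin0. Qed.

Lemma normc_cis x : normc (cis x) = 1.
Proof. by rewrite /= cos2Dsin2 sqrtr1. Qed.

Lemma cis_mulrn x n : cis (x *+ n) = cis x ^+ n.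
Proof.
by elim: n => [|n IH]; rewrite ?cis0// mulrS cisD IH exprS.
Qed.

Lemma cis_int (m : int) : cis (2 * pi * m%:~R) = 1 :> R[i].
Proof.
have c1 : cis (2 * pi) = 1 :> R[i].
  by rewrite /cis mulr_natl cos2pi sin2pi.
have cn n : cis (2 * pi * n%:R) = 1 :> R[i].
  by rewrite mulr_natr cis_mulrn c1 expr1n.
case: m => n; first exact: cn.
have := cisD (2 * pi * (Negz n)%:~R) (2 * pi * n.+1%:R).
rewrite NegzE mulrNz -[n.+1%:~R]/(n.+1%:R) mulrN addNr cis0 cn mulr1 => <-//.
Qed.

Lemma cis_sub1_sqr x : normc (cis x - 1) ^+ 2 = 2 - 2 * cos x.
Proof.
rewrite normc_sqr ReB ImB /= subr0 sqrrB1 -addrA addrC -!addrA.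
have := cos2Dsin2 x; lra.
Qed.

End Cis.

Section Inner.
Context {R : realType}.
Variable d : nat.
Implicit Types (k l : 'rV[int]_d) (x y : 'rV[R]_d).

Lemma innerDl k l x : inner (k + l) x = inner k x + inner l x.
Proof. by rewrite -big_split; apply: eq_bigr => i _; rewrite !mxE intrD mulrDl. Qed.

Lemma innerNl k x : inner (- k) x = - inner k x.
Proof. by rewrite -sumrN; apply: eq_bigr => i _; rewrite !mxE mulrNz mulNr. Qed.

Lemma innerDr k x y : inner k (x + y) = inner k x + inner k y.
Proof. by rewrite -big_split; apply: eq_bigr => i _; rewrite !mxE mulrDr. Qed.

Lemma inner_int k l : inner k (map_mx intr l) = (\sum_i k ord0 i * l ord0 i)%:~R :> R.
Proof.
rewrite /inner; under eq_bigr do rewrite mxE -intrM.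
by rewrite -rmorph_sum.
Qed.

Lemma inner_delta k i (c : R) : inner k (c *: delta_mx ord0 i) = (k ord0 i)%:~R * c.
Proof.
rewrite /inner (bigD1 i)//= !mxE !eqxx mulr1 big1 ?addr0// => j ji.
by rewrite !mxE (negbTE ji) !mulr0.
Qed.

End Inner.

Section GridShift.
Context {R : realType}.
Variables (N d : nat).
Implicit Types (n : 'rV['I_N]_d) (k : 'rV[int]_d).

Definition gshift (i : 'I_d) n : 'rV['I_N]_d :=
  \row_j (if j == i then ordS (n ord0 j) else n ord0 j).

Lemma gshift_inj i : injective (gshift i).
Proof.
move=> n n' /rowP nn'; apply/rowP => j; have := nn' j; rewrite !mxE.
by case: eqP => // _ /ordS_inj.
Qed.

(** [ordS] wraps around: at the last index the point jumps back by a full period, which [l]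
    records. *)
Lemma gridpt_shift i n : exists l : 'rV[int]_d,
  gridpt R (gshift i n) = gridpt R n + N%:R^-1 *: delta_mx ord0 i + map_mx intr l.
Proof.
pose z : int := if (n ord0 i).+1 == N then -1 else 0.
exists (\row_j (if j == i then z else 0)); apply/rowP => j; rewrite !mxE eqxx /=.
case: eqP => [->|_]; last by rewrite mulr0 !addr0.
have NR : N%:R != 0 :> R by rewrite pnatr_eq0 -lt0n (leq_ltn_trans _ (ltn_ord (n ord0 i))).
rewrite mulr1 /z /=; case: eqP => [nN|/eqP nN].
  rewrite nN modnn mul0r -[X in _ + X + _]mul1r -mulrDl natr1 nN divff//.
  by rewrite mulrN1z subrr.
rewrite modn_small; last by rewrite ltn_neqAle nN ltn_ord.
by rewrite -[(n ord0 i).+1]addn1 natrD mulrDl mul1r addr0.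
Qed.

Lemma cis_shift i n k : cis (2 * pi * inner k (gridpt R (gshift i n))) =
  cis (2 * pi * ((k ord0 i)%:~R / N%:R)) * cis (2 * pi * inner k (gridpt R n)).
Proof.
have [l ->] := gridpt_shift i n.
rewrite !innerDr inner_int inner_delta -cisD.
set m : R := (\sum_i0 _)%:~R.
have -> : 2 * pi * (inner k (gridpt R n) + (k ord0 i)%:~R / N%:R + m) =
   2 * pi * ((k ord0 i)%:~R / N%:R) + 2 * pi * inner k (gridpt R n) + 2 * pi * m.
  by ring.
by rewrite [LHS]cisD [X in _ * X]cis_int mulr1.
Qed.

Lemma cisN_shift i n k : cis (- (2 * pi * inner k (gridpt R n))) =
  cis (2 * pi * ((k ord0 i)%:~R / N%:R)) *
  cis (- (2 * pi * inner k (gridpt R (gshift i n)))).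
Proof.
have [l ->] := gridpt_shift i n.
rewrite !innerDr inner_int inner_delta.
set a := 2 * pi * inner _ _; set b := 2 * pi * (_ / _).
have -> : - (2 * pi * (inner k (gridpt R n) + (k ord0 i)%:~R / N%:R +
    (\sum_i0 k ord0 i0 * l ord0 i0)%:~R)) =
    - a - b + 2 * pi * (- \sum_i0 k ord0 i0 * l ord0 i0)%:~R.
  by rewrite mulrNz /a /b; ring.
by rewrite !cisD cis_int mulr1 mulrCA -cisD subrr cis0 mulr1.
Qed.

End GridShift.

Section ScalarDFT.
Context {R : realType}.
Local Notation normc := (@Normc.normc R).

(* DFT and, with sfhat below, fhat of a single component. *)
Definition sdft N d (g : 'rV['I_N]_d -> R) (k : 'rV[int]_d) : R[i] :=
  ((N%:R ^+ d)^-1)%:C%C * \sum_n (g n)%:C%C * cis (- (2 * pi * inner k (gridpt R n))).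

Lemma DFTE N d m (v : 'rV['I_N]_d -> 'cV[R]_m) k i :
  DFT v k i ord0 = sdft (fun n => v n i ord0) k.
Proof. by rewrite mxE /sdft fmorphV rmorphXn/= rmorph_nat. Qed.

Lemma card_grid N d : #|{: 'rV['I_N]_d}| = (N ^ d)%N.
Proof. by rewrite card_mx card_ord mul1n. Qed.

Lemma normc_sdft_sqr_le N d (g : 'rV['I_N]_d -> R) k :
  normc (sdft g k) ^+ 2 <= (N%:R ^+ d)^-1 * \sum_n g n ^+ 2.
Proof.
have [N0|N0] := posnP (N ^ d)%N.
  rewrite -natrX N0 invr0 mul0r /sdft -natrX N0 invr0.
  by rewrite (_ : 0%:C%C = 0)// mul0r Normc.normc0 expr0n.
have Nd0 : 0 < N%:R ^+ d :> R by rewrite -natrX ltr0n.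
rewrite /sdft Normc.normcM normc_real ger0_norm ?invr_ge0 ?(ltW Nd0)// exprMn.
apply: (@le_trans _ _ ((N%:R ^+ d)^-1 ^+ 2 * (\sum_n `|g n|) ^+ 2)).
  rewrite ler_wpM2l ?sqr_ge0// lerXn2r ?nnegrE ?normc_ge0 ?sumr_ge0//.
  rewrite (le_trans (normc_sum _ _ _))// ler_sum// => n _.
  by rewrite Normc.normcM normc_cis mulr1 normc_real.
rewrite expr2 -mulrA ler_pM2l ?invr_gt0// ler_pdivrMl//.
rewrite (le_trans (sqr_sum_fin_le _))// card_grid natrX.
rewrite ler_pM2l// ler_sum// => n _; by rewrite real_normK ?num_real.
Qed.

Lemma sdft_difn N d (i : 'I_d) s (g : 'rV['I_N]_d -> R) k :
  sdft (difn (gshift i) s g) k =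
  (cis (2 * pi * ((k ord0 i)%:~R / N%:R)) - 1) ^+ s * sdft g k.
Proof.
elim: s => [|s IH]; first by rewrite expr0 mul1r.
rewrite exprS -mulrA -IH; set h := difn _ s g; set w := cis _.
rewrite /sdft mulrCA; congr (_ * _).
rewrite mulrBl mul1r mulr_sumr.
under eq_bigr do rewrite difnS rmorphB/= mulrBl.
rewrite sumrB; congr (_ - _).
rewrite -[RHS](sum_shift _ (@gshift_inj N d i)); apply: eq_bigr => n _.
by rewrite (cisN_shift i) mulrCA.
Qed.

(** The difference multiplies the k-th coefficient by a number of modulus at least 1, so the
    coefficient is at most that of the s-th difference, which Cauchy-Schwarz bounds by a mean
    square. *)
Lemma sdft_decay N d (i : 'I_d) s (g : 'rV['I_N]_d -> R) (k : 'rV[int]_d) :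
  2 <= normc (cis (2 * pi * ((k ord0 i)%:~R / N%:R)) - 1) ^+ 2 ->
  normc (sdft g k) ^+ 2 <= (N%:R ^+ d)^-1 * \sum_n difn (gshift i) s g n ^+ 2.
Proof.
move=> h2; apply: le_trans (normc_sdft_sqr_le _ k).
rewrite (sdft_difn i s g k); move: (sdft g k) => z.
rewrite Normc.normcM exprMn normcX -exprM mulnC exprM.
by rewrite ler_peMl ?sqr_ge0// exprn_ege1// (le_trans _ h2)// ler1n.
Qed.

End ScalarDFT.

Section Aliasing.
Context {R : realType}.
Variable d : nat.
Local Notation normc := (@Normc.normc R).
Implicit Types (F : 'rV[R]_d -> R) (k : 'rV[int]_d).

Definition pts N F : 'rV['I_N]_d -> R := fun n => F (gridpt R n).

(** The 2^d frequencies modulo 2N that reduce to k modulo N. *)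
Definition alias_freq N (k : 'rV[int]_d) (b : {ffun 'I_d -> bool}) : 'rV[int]_d :=
  k + \row_i (N * b i)%:Z.

Definition double_idx N (n : 'rV['I_N]_d) : 'rV['I_(2 * N)]_d :=
  \row_i insubd (widen_ord (leq_pmull N (isT : 0 < 2)%N) (n ord0 i)) (2 * n ord0 i)%N.

Lemma double_idxE N (n : 'rV['I_N]_d) i : double_idx n ord0 i = (2 * n ord0 i)%N :> nat.
Proof. by rewrite mxE val_insubd ltn_pmul2l// ltn_ord. Qed.

Lemma gridpt_double N (n : 'rV['I_N]_d) : gridpt R (double_idx n) = gridpt R n.
Proof.
apply/rowP => i; rewrite mxE [RHS]mxE double_idxE !natrM invfM.
by rewrite mulrACA divff ?mul1r// pnatr_eq0.
Qed.

(** Orthogonality of the characters of (Z/2)^d: the sum factors into terms 1 + (-1)^(n_i) and so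
    detects the points of the coarse grid inside the fine one. *)
Lemma sum_aliases N (n : 'rV['I_(2 * N)]_d) : (0 < N)%N ->
  \sum_(b : {ffun 'I_d -> bool})
     cis (- (2 * pi * inner (\row_i (N * b i)%:Z) (gridpt R n))) =
  if [forall i, ~~ odd (n ord0 i)] then (2 ^+ d)%:C%C else 0 :> R[i].
Proof.
move=> N0; have NR : N%:R != 0 :> R by rewrite pnatr_eq0 -lt0n.
transitivity (\sum_(b : {ffun 'I_d -> bool}) \prod_i
    cis (- (pi * (b i * n ord0 i)%N%:R)) : R[i]).
  apply: eq_bigr => b _.
  rewrite -(big_morph (@cis R) (@cisD R) (@cis0 R)); congr cis.
  rewrite /inner mulr_sumr -sumrN; apply: eq_bigr => i _; congr (- _).
  by rewrite !mxE -[(_)%:~R]/((N * b i)%N%:R) !natrM; field.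
rewrite -(bigA_distr_bigA (fun i (b : bool) => cis (- (pi * (b * n ord0 i)%N%:R)))).
have E i : \sum_(b : bool) cis (- (pi * (b * n ord0 i)%N%:R)) =
    if odd (n ord0 i) then 0 else 2 :> R[i].
  rewrite big_bool/= mul1n mul0n mulr0 oppr0 cis0.
  have -> : cis (- (pi * (n ord0 i)%:R)) = (-1) ^+ n ord0 i :> R[i].
    rewrite mulr_natr -mulNrn cis_mulrn; congr (_ ^+ _).
    by apply/eqP; rewrite eq_complex /= cosN sinN cospi sinpi oppr0 !eqxx.
  rewrite -signr_odd; case: odd; first by rewrite expr1 addNr.
  by rewrite expr0.
rewrite (eq_bigr _ (fun i _ => E i)).
case: (boolP [forall i, ~~ odd (n ord0 i)]) => [/forallP h|].
  rewrite (eq_bigr (fun=> 2)); last by move=> i _; rewrite (negbTE (h i)).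
  by rewrite prodr_const card_ord rmorphXn/= rmorph_nat.
by move=> /forallPn[i /negPn oi]; rewrite (bigD1 i)//= oi mul0r.
Qed.

Lemma sdft_alias N F k : (0 < N)%N ->
  sdft (@pts N F) k = \sum_(b : {ffun 'I_d -> bool})
    sdft (@pts (2 * N) F) (alias_freq N k b).
Proof.
move=> N0; rewrite /sdft -mulr_sumr exchange_big/=.
have E (n : 'rV['I_(2 * N)]_d) : \sum_(b : {ffun 'I_d -> bool}) (pts F n)%:C%C *
    cis (- (2 * pi * inner (alias_freq N k b) (gridpt R n))) =
    if [forall i, ~~ odd (n ord0 i)] then (2 ^+ d)%:C%C * ((pts F n)%:C%C *
    cis (- (2 * pi * inner k (gridpt R n)))) else 0.
  rewrite -mulr_sumr.
  under eq_bigr do rewrite innerDl mulrDr opprD cisD.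
  by rewrite -mulr_sumr sum_aliases//; case: ifP; rewrite ?mulr0// mulrA mulrC.
rewrite (eq_bigr _ (fun n _ => E n)) -big_mkcond/= -mulr_sumr mulrA -rmorphM/=.
have -> : (((2 * N)%N%:R ^+ d)^-1 * 2 ^+ d : R) = (N%:R ^+ d)^-1.
  by rewrite natrM exprMn invfM mulrAC mulVf ?mul1r// expf_neq0// pnatr_eq0.
congr (_ * _).
pose half_idx (n : 'rV['I_(2 * N)]_d) : 'rV['I_N]_d :=
  \row_i insubd (Ordinal N0) (n ord0 i)./2.
rewrite [RHS](reindex_onto (@double_idx N) half_idx)/=; last first.
  move=> n /forallP en; apply/rowP => i; apply: ord_inj; rewrite double_idxE mxE.
  have ni := ltn_ord (n ord0 i).
  rewrite val_insubd; have -> : ((n ord0 i)./2 < N)%N by lia.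
  by have := odd_double_half (n ord0 i); rewrite (negbTE (en i)) add0n -mul2n.
apply: eq_big => [n|n _]; last by rewrite /pts gridpt_double.
apply/esym/andP; split; first by apply/forallP => i; rewrite double_idxE oddM.
apply/eqP/rowP => i; apply: ord_inj; rewrite mxE val_insubd double_idxE mul2n doubleK.
by rewrite ltn_ord.
Qed.

Lemma inner_continuous k : continuous (@inner R d k).
Proof.
rewrite /inner; apply: continuous_big => [|i _ x]; first exact: add_continuous.
apply: (@continuous_comp _ _ _ (fun x : 'rV[R]_d => x ord0 i) ( *%R _)).
  exact: coord_continuous.
exact: mulrl_continuous.
Qed.

Definition sfhat F k : R[i] :=
  cube_intC (fun x => (F x)%:C%C * cis (- (2 * pi * inner k x))).

Definition smooth_grid s (Q : R) F := forall N (i : 'I_d), (0 < N)%N ->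
  (N%:R ^+ d)^-1 * \sum_n difn (gshift i) s (@pts N F) n ^+ 2 <= Q / N%:R ^+ (2 * s).

Lemma alias_step s Q F N k : (0 < N)%N -> 0 <= Q ->
  (forall i, (4 * `|k ord0 i| <= N)%N) -> smooth_grid s Q F ->
  normc (sdft (@pts N F) k - sdft (@pts (2 * N) F) k) <=
  2 ^+ d * Num.sqrt Q / (2 * N)%N%:R ^+ s.
Proof.
move=> N0 Q0 kN sF; have NR : 0 < N%:R :> R by rewrite ltr0n.
have N2 : 0 < (2 * N)%N%:R :> R by rewrite ltr0n muln_gt0.
rewrite sdft_alias// (bigD1 [ffun=> false])//=.
have -> : alias_freq N k [ffun=> false] = k.
  by apply/rowP => i; rewrite !mxE ffunE muln0 addr0.
rewrite addrAC subrr add0r (le_trans (normc_sum _ _ _))//.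
have card2 : 2 ^+ d = #|{: {ffun 'I_d -> bool}}|%:R :> R.
  by rewrite card_ffun card_bool card_ord natrX.
rewrite -mulrA card2 mulr_natl -sumr_const big_mkcond ler_sum//= => b _.
case: ifP => [b0|_]; last by rewrite divr_ge0 ?sqrtr_ge0 ?exprn_ge0 ?(ltW N2).
have [i bi] : exists i, b i.
  apply/existsP; apply: contraNT b0 => /existsPn nb; apply/eqP/ffunP => i.
  by rewrite ffunE; exact/negbTE.
rewrite -(ler_pXn2r (ltn0Sn 1)) ?nnegrE ?normc_ge0//.
rewrite exprMn sqr_sqrtr// exprVn -exprM [(s * 2)%N]mulnC.
apply: le_trans (sF (2 * N)%N i _); last by rewrite muln_gt0.
apply: sdft_decay; rewrite cis_sub1_sqr lerBrDr -lerBrDl subrr.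
rewrite pmulr_rle0// !mxE bi muln1.
pose a : R := (k ord0 i)%:~R / N%:R.
(* On the grid 2N the frequency k_i + N is nearly opposite on the circle: its angle is pi + pi k_i /
   N, and |k_i| <= N/4 keeps the cosine nonpositive. *)
have -> : 2 * pi * ((k ord0 i + N%:Z)%:~R / (2 * N)%N%:R) = pi * a + pi :> R.
  rewrite intrD natrM /a -[N%:Z%:~R]/(N%:R); field; exact: lt0r_neq0.
rewrite cosDpi oppr_le0; apply: cos_ge0_pihalf; rewrite -ler_norml.
rewrite normrM (ger0_norm (pi_ge0 R)) ler_pM2l ?pi_gt0//.
rewrite /a normrM normfV (gtr0_norm NR) ler_pdivrMr// -intr_norm.
have := kN i; rewrite -(ler_nat R) natrM -[_%:~R]/(`|k ord0 i|%N%:R); lra.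
Qed.

(** Since s >= 1, passing from 2^j N to 2^(j+1) N costs at most the fraction 2^-(j+1) of the bound;
    1 - 2^-j is the sum of the fractions spent so far. *)
Lemma alias_telescope s Q F N k j : (0 < s)%N -> (0 < N)%N -> 0 <= Q ->
  (forall i, (4 * `|k ord0 i| <= N)%N) -> smooth_grid s Q F ->
  normc (sdft (@pts N F) k - sdft (@pts (2 ^ j * N) F) k) <=
  2 ^+ d * Num.sqrt Q / N%:R ^+ s * (1 - 2 ^- j).
Proof.
move=> s0 N0 Q0 kN sF; have NR : 0 < N%:R :> R by rewrite ltr0n.
elim: j => [|j IH].
  by rewrite expn0 mul1n subrr Normc.normc0 expr0 invr1 subrr mulr0.
have j2 : (0 < 2 ^ j)%N by rewrite expn_gt0.
have j2R : 0 < 2 ^+ j :> R by rewrite exprn_gt0.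
rewrite expnS -mulnA -(subrKA (sdft (@pts (2 ^ j * N) F) k)).
rewrite (le_trans (le_normcD _ _))//.
have := @alias_step s Q F (2 ^ j * N) k _ Q0 _ sF.
rewrite muln_gt0 j2 N0 => /(_ isT) H.
have {}H := H (fun i => leq_trans (kN i) (leq_pmull _ j2)).
apply: le_trans (lerD IH H) _.
set D := _ * Num.sqrt Q.
have D0 : 0 <= D by rewrite mulr_ge0 ?sqrtr_ge0 ?exprn_ge0.
suff H1 : D / (2 * (2 ^ j * N))%N%:R ^+ s <= D / N%:R ^+ s * 2 ^- j.+1.
  rewrite (le_trans (lerD (lexx _) H1))// -mulrDr.
  have -> : 1 - 2 ^- j + 2 ^- j.+1 = 1 - 2 ^- j.+1 :> R.
    by rewrite exprS; field; rewrite gt_eqF.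
  exact: lexx.
clearbody D; rewrite -!mulrA ler_wpM2l// mulnA -expnS natrM exprMn invfM mulrC.
rewrite ler_pM2l ?invr_gt0 ?exprn_gt0// lef_pV2 ?posrE ?exprn_gt0 ?ltr0n ?expn_gt0//.
rewrite natrX -exprM ler_weXn2l ?ler1n// leq_pmulr//.
Qed.

Lemma phase_continuous (g : R -> R) F k : continuous g -> continuous F ->
  continuous (fun x => F x * g (- (2 * pi * inner k x))).
Proof.
move=> cg cF x; apply: continuousM; first exact: cF.
apply: (@continuous_comp _ _ _ (fun x => - (2 * pi * inner k x)) g); last exact: cg.
apply: continuousN.
apply: (@continuous_comp _ _ _ (@inner R d k) ( *%R _)); first exact: inner_continuous.
exact: mulrl_continuous.
Qed.

Lemma Re_sdft N F k : complex.Re (sdft (@pts N F) k) =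
  grid_mean N (fun x => F x * cos (- (2 * pi * inner k x))).
Proof.
by rewrite Re_realM Re_sum; congr (_ * _); apply: eq_bigr => n _; rewrite Re_realM.
Qed.

Lemma Im_sdft N F k : complex.Im (sdft (@pts N F) k) =
  grid_mean N (fun x => F x * sin (- (2 * pi * inner k x))).
Proof.
by rewrite Im_realM Im_sum; congr (_ * _); apply: eq_bigr => n _; rewrite Im_realM.
Qed.

Lemma Re_sfhat F k : complex.Re (sfhat F k) =
  cube_int (fun x => F x * cos (- (2 * pi * inner k x))).
Proof. by congr cube_int; apply/funext => x; rewrite Re_realM. Qed.

Lemma Im_sfhat F k : complex.Im (sfhat F k) =
  cube_int (fun x => F x * sin (- (2 * pi * inner k x))).
Proof. by congr cube_int; apply/funext => x; rewrite Im_realM. Qed.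

Lemma sdft_cvg_Re F k : continuous F ->
  (fun N => complex.Re (sdft (@pts N F) k)) @ \oo --> complex.Re (sfhat F k).
Proof.
move=> cF; rewrite Re_sfhat; under eq_cvg do rewrite Re_sdft.
by apply/grid_mean_cvg/phase_continuous => //; exact: continuous_cos.
Qed.

Lemma sdft_cvg_Im F k : continuous F ->
  (fun N => complex.Im (sdft (@pts N F) k)) @ \oo --> complex.Im (sfhat F k).
Proof.
move=> cF; rewrite Im_sfhat; under eq_cvg do rewrite Im_sdft.
by apply/grid_mean_cvg/phase_continuous => //; exact: continuous_sin.
Qed.

Lemma cvg_dyadic_dist (u : nat -> R) (l a e : R) N : (0 < N)%N ->
  u @ \oo --> l -> (forall j, `|a - u (2 ^ j * N)%N| <= e) -> `|a - l| <= e.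
Proof.
move=> N0 ul H; apply/ler_addgt0Pr => r r0.
have /cvgrPdist_le /(_ _ r0) [M _ HM] := ul.
have MN : (M <= 2 ^ M * N)%N.
  by rewrite (leq_trans (ltnW (ltn_expl M (isT : 1 < 2)%N)))// leq_pmulr.
rewrite -(subrKA (u (2 ^ M * N)%N)) (le_trans (ler_normD _ _))// lerD//.
by rewrite distrC; exact: HM.
Qed.

(* The DFTs on the grids N, 2N, 4N, ... differ by finitely many aliased
   coefficients, each of size O((2^j N)^-s), so no summability over the
   frequencies is needed. *)
Lemma sdft_sfhat s Q F N k : (0 < s)%N -> (0 < N)%N -> 0 <= Q -> continuous F ->
  (forall i, (4 * `|k ord0 i| <= N)%N) -> smooth_grid s Q F ->
  normc (sdft (@pts N F) k - sfhat F k) <= 2 * (2 ^+ d * Num.sqrt Q) / N%:R ^+ s.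
Proof.
move=> s0 N0 Q0 cF kN sF.
set D := 2 ^+ d * Num.sqrt Q.
have D0 : 0 <= D / N%:R ^+ s.
  by rewrite divr_ge0 ?exprn_ge0// mulr_ge0 ?sqrtr_ge0 ?exprn_ge0.
have H j : normc (sdft (@pts N F) k - sdft (@pts (2 ^ j * N) F) k) <= D / N%:R ^+ s.
  rewrite (le_trans (alias_telescope j s0 N0 Q0 kN sF))// ler_piMr//.
(* Real and imaginary parts go to the limit separately, each with the full bound; hence the factor
   2. *)
rewrite (le_trans (normc_le_ReIm _))// -mulrA mulr_natl mulr2n ReB ImB lerD//.
  have := @cvg_dyadic_dist _ _ (complex.Re (sdft (@pts N F) k)) (D / N%:R ^+ s) N
    N0 (@sdft_cvg_Re F k cF).
  apply=> j; by rewrite -ReB (le_trans (Re_le_normc _)).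
have := @cvg_dyadic_dist _ _ (complex.Im (sdft (@pts N F) k)) (D / N%:R ^+ s) N
  N0 (@sdft_cvg_Im F k cF).
apply=> j; by rewrite -ImB (le_trans (Im_le_normc _)).
Qed.

End Aliasing.

(** * Fourier weights *)

Section FiniteSums.
Context {R : realType}.

Lemma sum_prod_rV n d (h : 'I_d -> 'I_n -> R) :
  \sum_(j : 'rV['I_n]_d) \prod_i h i (j ord0 i) = \prod_i \sum_a h i a.
Proof.
rewrite bigA_distr_bigA (reindex (fun f : {ffun 'I_d -> 'I_n} => \row_i f i))/=.
  by apply: eq_bigr => f _; apply: eq_bigr => i _; rewrite mxE.
exists (fun j : 'rV_d => [ffun i => j ord0 i]) => [f|j] _.
  by apply/ffunP => i; rewrite ffunE mxE.
by apply/rowP => i; rewrite mxE ffunE.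
Qed.

Lemma sum_inj_le (I J : finType) (P : pred I) (phi : I -> J) (f : J -> R) :
  (forall j, 0 <= f j) -> {in P &, injective phi} ->
  \sum_(i | P i) f (phi i) <= \sum_j f j.
Proof.
move=> f0 inj.
have -> : \sum_(i | P i) f (phi i) = \sum_(j in phi @: [set i | P i]%SET) f j.
  rewrite big_imset/=; last by move=> x y; rewrite !inE; exact: inj.
  by apply: eq_bigl => i; rewrite inE.
by rewrite [leRHS](bigID (mem (phi @: [set i | P i]%SET)))/= lerDl sumr_ge0.
Qed.

(** Comparison with the integral of x^(-q), in telescoping form; the step inequality follows from
    exp x >= 1 + x and ln (1 + x) <= x. *)
Lemma power_sum_bound (q : R) : 1 < q ->
  exists2 G : R, 0 <= G & forall n, \sum_(l < n) (1 + l%:R) `^ (- q) <= G.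
Proof.
move=> q1; pose e := q - 1; have e0 : 0 < e by rewrite subr_gt0.
have qE : - q = - e - 1 by rewrite /e; ring.
have step l : (1 <= l)%N ->
    (1 + l%:R) `^ (- q) <= e^-1 * (l%:R `^ (- e) - (1 + l%:R) `^ (- e)).
  move=> l1; have l0 : 0 < l%:R :> R by rewrite ltr0n.
  have l10 : 0 < 1 + l%:R :> R by rewrite addr_gt0.
  rewrite -ler_pdivrMl ?invr_gt0// invrK.
  have -> : l%:R `^ (- e) = (1 + l%:R) `^ (- e) * expR (- e * ln (l%:R / (1 + l%:R))).
    rewrite lnM ?posrE ?invr_gt0// lnV ?posrE// mulrBr expRD.
    by rewrite /powR !gt_eqF// expRN mulrCA divff ?mulr1// gt_eqF ?expR_gt0.
  have -> : (1 + l%:R) `^ (- q) = (1 + l%:R) `^ (- e) * (1 + l%:R)^-1.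
    rewrite qE powRD; last by rewrite (gt_eqF l10) implybT.
    by rewrite powR_inv1// ltW.
  rewrite mulrCA -[X in _ <= _ - X]mulr1 -mulrBr ler_wpM2l ?powR_ge0//.
  rewrite lerBrDr (le_trans _ (expR_ge1Dx _))// addrC lerD2l.
  rewrite mulNr -mulrN ler_pM2l// lerNr.
  have -> : l%:R / (1 + l%:R) = 1 + - (1 + l%:R)^-1 :> R by field; rewrite gt_eqF.
  apply: le_ln1Dx; rewrite ltrN2 invf_lt1// ltrDl//.
exists (1 + e^-1); first by rewrite addr_ge0 ?invr_ge0 ?(ltW e0).
suff H n : \sum_(l < n.+1) (1 + l%:R) `^ (- q) <=
    1 + e^-1 * (1 - (1 + n%:R) `^ (- e)).
  case=> [|n]; first by rewrite big_ord0 addr_ge0 ?invr_ge0 ?(ltW e0).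
  apply: le_trans (H n) _; rewrite lerD2l ler_piMr ?invr_ge0 ?(ltW e0)//.
elim: n => [|n IH].
  by rewrite big_ord1 addr0 !powR1 subrr mulr0 addr0.
rewrite big_ord_recr/=; apply: le_trans (lerD IH (step n.+1 isT)) _.
by rewrite -[n.+1%:R]/((1 + n)%N%:R) natrD -addrA -mulrDr addrA subrK.
Qed.

(** Within a residue class modulo N, an index is determined by its side of [b] and the integer
    quotient by N of its distance to [b]. The sum is therefore at most twice a convergent series,
    whatever N, n, b and r. *)
Lemma class_sum_bound (q : R) : 1 < q ->
  exists2 G : R, 0 <= G & forall N n (b r : 'I_n), (0 < N)%N ->
    \sum_(a < n | (N %| absz (a%:Z - r%:Z))%N) (1 + (absz (a%:Z - b%:Z))%:R / N%:R) `^ (- q)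
      <= G.
Proof.
move=> q1; have [G G0 hG] := power_sum_bound q1.
exists (G *+ 2); first by rewrite mulrn_wge0.
move=> N n b r N0; have NR : 0 < N%:R :> R by rewrite ltr0n.
have lt_n (a : 'I_n) : (absz (a%:Z - b%:Z) %/ N < n)%N.
  apply: leq_ltn_trans (leq_div _ _) _; have := ltn_ord a; have := ltn_ord b; lia.
pose phi (a : 'I_n) : bool * 'I_n := ((b <= a)%N, Ordinal (lt_n a)).
pose f (p : bool * 'I_n) : R := (1 + p.2%:R) `^ (- q).
apply: (@le_trans _ _ (\sum_(a < n | (N %| absz (a%:Z - r%:Z))%N) f (phi a))).
  apply: ler_sum => a _; rewrite /f /=.
  rewrite !powRN lef_pV2 ?posrE ?powR_gt0 ?ltr_pwDl ?divr_ge0//.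
  apply: ge0_ler_powR; rewrite ?nnegrE ?addr_ge0 ?divr_ge0//.
    by rewrite (le_trans ler01)// ltW.
  by rewrite lerD2l ler_pdivlMr// -natrM ler_nat leq_trunc_div.
apply: le_trans (sum_inj_le _ _) _.
- by move=> p; exact: powR_ge0.
- move=> a a' /= Na Na' [sg dv]; apply: ord_inj.
  have Naa : (N %| absz (a%:Z - a'%:Z))%N.
    have : (N%:Z %| (a%:Z - r%:Z) - (a'%:Z - r%:Z))%Z by rewrite rpredB// dvdzE.
    by rewrite opprB addrA subrK dvdzE.
  pose x := absz (a%:Z - b%:Z); pose x' := absz (a'%:Z - b%:Z).
  have xxE : absz (x%:Z - x'%:Z) = absz (a%:Z - a'%:Z).
    by move: sg; rewrite /x /x'; clear; lia.
  have {}dv : (x %/ N = x' %/ N)%N by [].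
  have mm : (x %% N = x' %% N)%N.
    rewrite -xxE in Naa; clearbody x x'.
    have E y z : (z <= y)%N -> (y - z)%N = absz (y%:Z - z%:Z) by clear; lia.
    have C y z : absz (y%:Z - z%:Z) = absz (z%:Z - y%:Z) by clear; lia.
    apply/eqP; have [le|/ltnW le] := leqP x' x; first by rewrite eqn_mod_dvd// E.
    by rewrite eq_sym eqn_mod_dvd// E// C.
  have : x = x' by rewrite (divn_eq x N) (divn_eq x' N) dv mm.
  by move: sg; rewrite /x /x'; clear; lia.
rewrite /f -(pair_bigA _ (fun (_ : bool) (l : 'I_n) => (1 + l%:R) `^ (- q)))/=.
by rewrite big_bool/= -mulr2n lerMn2r hG.
Qed.

(* The Fejer sum of order n is a mean over j' of the sums over the frequencies
   dfreq j j'. *)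
Definition dfreq n d (j j' : 'rV['I_n]_d) : 'rV[int]_d :=
  \row_i ((j ord0 i)%:Z - (j' ord0 i)%:Z).

Definition same_class (N d : nat) (k l : 'rV[int]_d) : bool :=
  [forall i, (N %| absz (k ord0 i - l ord0 i)%R)%N].

(** A product over coordinates, so that sums over a residue class factor into one-dimensional ones.
    With q = 2s/d it dominates (1 + |k|/N)^(-2s), and the one-dimensional sums stay bounded because
    q > 1, that is, s > d/2. *)
Definition freq_weight (q : R) N d (k : 'rV[int]_d) : R :=
  \prod_i (1 + (absz (k ord0 i))%:R / N%:R) `^ (- q).

Lemma freq_weight_sum (q : R) d : 1 < q -> exists2 G : R, 0 <= G &
  forall N n (j' r : 'rV['I_n]_d), (0 < N)%N ->
  \sum_(j : 'rV['I_n]_d | same_class N (dfreq j j') (dfreq r j'))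
     freq_weight q N (dfreq j j') <= G.
Proof.
move=> q1; have [G G0 hG] := class_sum_bound q1.
exists (G ^+ d); first exact: exprn_ge0.
move=> N n j' r N0; rewrite big_mkcond/=.
pose h i (a : 'I_n) : R := if (N %| absz (a%:Z - (r ord0 i)%:Z))%N then
  (1 + (absz (a%:Z - (j' ord0 i)%:Z))%:R / N%:R) `^ (- q) else 0.
apply: (@le_trans _ _ (\sum_(j : 'rV['I_n]_d) \prod_i h i (j ord0 i))).
  apply: ler_sum => j _; case: ifP => [/forallP sc|_].
    rewrite le_eqVlt; apply/orP; left; apply/eqP/eq_bigr => i _.
    rewrite /h !mxE; have := sc i; rewrite !mxE.
    by rewrite opprB addrA subrK => ->.
  by apply: prodr_ge0 => i _; rewrite /h; case: ifP => // _; exact: powR_ge0.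
rewrite sum_prod_rV -[d in leRHS]card_ord -prodr_const ler_prod// => i _.
rewrite /h -big_mkcond/= hG// andbT.
by apply: sumr_ge0 => a _; exact: powR_ge0.
Qed.

End FiniteSums.

Section Weights.
Context {R : realType}.
Local Notation normc := (@Normc.normc R).

Lemma dist_cis_le (x : R) : normc (cis x - 1) <= 2 * `|x|.
Proof.
have mvt (f df : R -> R) y : 0 <= y -> (forall z : R, is_derive z (1 : R) f (df z)) ->
    (forall z, `|df z| <= 1) -> `|f y - f 0| <= y.
  move=> y0 dF df1.
  have cf : {within `[0, y], continuous f}.
    apply: derivable_within_continuous => z _.
    exact: (@ex_derive _ _ _ _ _ _ _ (dF z)).
  have [c _] := @MVT_segment R f df 0 y y0 (fun z _ => dF z) cf.
  by move=> ->; rewrite subr0 normrM (ger0_norm y0) ler_piMl.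
wlog x0 : x / 0 <= x.
  move=> H; have [x0|/ltW x0] := leP 0 x; first exact: H.
  have := H (- x); rewrite oppr_ge0 normrN => /(_ x0); apply: le_trans.
  rewrite -(ler_pXn2r (ltn0Sn 1)) ?nnegrE ?normc_ge0//.
  by rewrite !cis_sub1_sqr cosN.
rewrite (le_trans (normc_le_ReIm _))// ReB ImB /= subr0 (ger0_norm x0).
rewrite mulr_natl mulr2n lerD//.
  rewrite -[X in _ - X](@cos0 R).
  apply: (mvt _ (fun z => - sin z)) => // z.
  by rewrite normrN sin_max.
rewrite -[X in `|X|]subr0 -[X in _ - X](@sin0 R).
by apply: (mvt _ cos) => // z; exact: cos_max.
Qed.

Lemma dist_cis_le2 (x : R) : normc (cis x - 1) <= 2.
Proof.
by rewrite (le_trans (le_normcD _ _))// normcN Normc.normc1 normc_cis.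
Qed.

Variable d s : nat.
Hypothesis d0 : (0 < d)%N.
Implicit Types k : 'rV[int]_d.

Definition hs_weight k : R := 1 + knorm2 R k ^+ s.

Lemma knorm2_ge0 k : 0 <= knorm2 R k.
Proof. by apply: sumr_ge0 => i _; exact: sqr_ge0. Qed.

Lemma hs_weight_gt0 k : 0 < hs_weight k.
Proof. by rewrite ltr_pwDl// exprn_ge0// knorm2_ge0. Qed.

Lemma coord_le_knorm k i : (absz (k ord0 i))%:R <= Num.sqrt (knorm2 R k).
Proof.
rewrite -(ler_pXn2r (ltn0Sn 1)) ?nnegrE ?sqrtr_ge0// sqr_sqrtr ?knorm2_ge0//.
rewrite /knorm2 (bigD1 i)//= -[X in X ^+ 2]/((absz (k ord0 i))%:~R) abszE intr_norm.
by rewrite real_normK ?num_real// lerDl sumr_ge0// => j _; exact: sqr_ge0.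
Qed.

Lemma freq_weight_lower k N : (0 < N)%N ->
  (1 + Num.sqrt (knorm2 R k) / N%:R) ^- (2 * s) <=
  freq_weight ((2 * s)%:R / d%:R) N k.
Proof.
move=> N0; set rho := Num.sqrt _; have rho0 : 0 <= rho by exact: sqrtr_ge0.
have NR : 0 < N%:R :> R by rewrite ltr0n.
have dR : d%:R != 0 :> R by rewrite pnatr_eq0 -lt0n.
have b0 : 0 < 1 + rho / N%:R by rewrite ltr_pwDl// divr_ge0// ltW.
rewrite /freq_weight.
have -> : (1 + rho / N%:R) ^- (2 * s) =
    \prod_(i < d) (1 + rho / N%:R) `^ (- ((2 * s)%:R / d%:R)).
  rewrite prodr_const card_ord -powR_mulrn ?powR_ge0// -powRrM mulNr divfK//.
  by rewrite powR_invn// ltW.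
apply: ler_prod => i _; rewrite powR_ge0/= !powRN lef_pV2 ?posrE ?powR_gt0//.
apply: ge0_ler_powR; rewrite ?nnegrE ?divr_ge0 ?addr_ge0 ?divr_ge0 ?(ltW b0)//.
by rewrite lerD2l ler_pM2r ?invr_gt0// coord_le_knorm.
Qed.

(* With rho the Euclidean length of k, both sides are compared with
   (1 + rho / N)^(-2s). *)
Lemma diff_weight_le k N i : (0 < N)%N ->
  (normc (cis (2 * pi * ((k ord0 i)%:~R / N%:R)) - 1) ^+ s) ^+ 2 / hs_weight k <=
  (8 * pi) ^+ (2 * s) / N%:R ^+ (2 * s) * freq_weight ((2 * s)%:R / d%:R) N k.
Proof.
move=> N0; set a := normc _; set rho := Num.sqrt (knorm2 R k).
have rho0 : 0 <= rho by exact: sqrtr_ge0.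
have NR : 0 < N%:R :> R by rewrite ltr0n.
have b0 : 0 < 1 + rho / N%:R by rewrite ltr_pwDl// divr_ge0// ltW.
have pi2 := pi_ge2 R.
have a0 : 0 <= a by exact: normc_ge0.
have a1 : a <= 4 * pi * (rho / N%:R).
  apply: le_trans (dist_cis_le _) _.
  rewrite !normrM normfV (gtr0_norm NR) (ger0_norm (pi_ge0 R)) ger0_norm//.
  have -> : 2 * (2 * pi * (`|(k ord0 i)%:~R| / N%:R)) =
            4 * pi * (`|(k ord0 i)%:~R| / N%:R) :> R by ring.
  rewrite ler_wpM2l ?mulr_ge0 ?pi_ge0// ler_pM2r ?invr_gt0//.
  by rewrite -intr_norm -abszE coord_le_knorm.
have a2 : a <= 4 * pi by rewrite (le_trans (dist_cis_le2 _))//; lra.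
apply: (@le_trans _ _ ((8 * pi) ^+ (2 * s) / N%:R ^+ (2 * s) *
    (1 + rho / N%:R) ^- (2 * s))); last first.
  rewrite ler_wpM2l ?freq_weight_lower//.
  by rewrite divr_ge0 ?exprn_ge0 ?mulr_ge0 ?pi_ge0 ?(ltW NR).
rewrite -exprM [(s * 2)%N]mulnC.
have mx0 : 0 < Num.max 1 rho by rewrite lt_max ltr01.
have w1 : Num.max 1 rho ^+ (2 * s) <= hs_weight k.
  rewrite /hs_weight; case: (leP 1 rho) => _.
    by rewrite exprM sqr_sqrtr ?knorm2_ge0// lerDr.
  by rewrite expr1n lerDl exprn_ge0// knorm2_ge0.
apply: (@le_trans _ _ (a ^+ (2 * s) / Num.max 1 rho ^+ (2 * s))).
  by rewrite ler_wpM2l ?exprn_ge0// lef_pV2 ?posrE ?exprn_gt0 ?hs_weight_gt0.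
rewrite -!exprVn -!exprMn lerXn2r ?nnegrE ?mulr_ge0 ?invr_ge0 ?pi_ge0//.
- by rewrite ltW.
- by rewrite ltW.
rewrite ler_pdivrMr// [leRHS]mulrAC ler_pdivlMr// [leRHS]mulrAC ler_pdivlMr//.
have m1 : 1 <= Num.max 1 rho by rewrite le_max lexx.
have m2 : rho <= Num.max 1 rho by rewrite le_max lexx orbT.
have E1 : a * N%:R <= 4 * pi * rho.
  by move: a1; rewrite mulrA ler_pdivlMr.
have E2 : a * rho <= 4 * pi * Num.max 1 rho.
  apply: ler_pM => //.
have : a * (1 + rho / N%:R) * N%:R <= 8 * pi * Num.max 1 rho.
  have -> : a * (1 + rho / N%:R) * N%:R = a * N%:R + a * rho.
    by field; rewrite gt_eqF.
  have : 4 * pi * rho <= 4 * pi * Num.max 1 rho :> R.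
    by rewrite ler_wpM2l ?mulr_ge0 ?pi_ge0.
  lra.
lra.
Qed.

(** For N = 1 all frequencies are congruent, so [freq_weight_sum] turns this into summability of the
    inverse weights, the core of the Sobolev embedding. *)
Lemma inv_weight_le k :
  (hs_weight k)^-1 <= 4 ^+ (2 * s) * freq_weight ((2 * s)%:R / d%:R) 1 k.
Proof.
set rho := Num.sqrt (knorm2 R k); have rho0 : 0 <= rho by exact: sqrtr_ge0.
apply: (@le_trans _ _ (4 ^+ (2 * s) * (1 + rho / 1%:R) ^- (2 * s))); last first.
  by rewrite ler_wpM2l ?exprn_ge0// freq_weight_lower.
have b0 : 0 < 1 + rho by rewrite ltr_pwDl.
have mx0 : 0 < Num.max 1 rho by rewrite lt_max ltr01.
rewrite divr1; have w1 : Num.max 1 rho ^+ (2 * s) <= hs_weight k.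
  rewrite /hs_weight; case: (leP 1 rho) => _.
    by rewrite exprM sqr_sqrtr ?knorm2_ge0// lerDr.
  by rewrite expr1n lerDl exprn_ge0// knorm2_ge0.
apply: (@le_trans _ _ (Num.max 1 rho ^- (2 * s))).
  by rewrite lef_pV2 ?posrE ?exprn_gt0 ?hs_weight_gt0.
rewrite -!exprVn -exprMn lerXn2r ?nnegrE ?mulr_ge0 ?invr_ge0 ?(ltW mx0) ?(ltW b0)//.
rewrite -ler_pdivrMr ?invr_gt0// invrK mulrC ler_pdivrMr//.
have m1 : 1 <= Num.max 1 rho by rewrite le_max lexx.
have m2 : rho <= Num.max 1 rho by rewrite le_max lexx orbT.
lra.
Qed.

End Weights.

(** * Fejer sums and discrete regularity of Sobolev functions *)

Section Waves.
Context {R : realType}.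
Variable d : nat.
Local Notation normc := (@Normc.normc R).
Local Notation Re := (@complex.Re R).
Implicit Types (k l : 'rV[int]_d) (x y : 'rV[R]_d).

Definition wave k x : R[i] := cis (2 * pi * inner k x).

Lemma waveD k l x : wave (k + l) x = wave k x * wave l x.
Proof. by rewrite /wave innerDl mulrDr cisD. Qed.

Lemma wave_addr k x y : wave k (x + y) = wave k x * wave k y.
Proof. by rewrite /wave innerDr mulrDr cisD. Qed.

Lemma conjc_cis (t : R) : conjc (cis t) = cis (- t).
Proof. by rewrite /cis cosN sinN. Qed.

Lemma waveN k x : wave (- k) x = conjc (wave k x).
Proof. by rewrite /wave innerNl mulrN conjc_cis. Qed.

Lemma inner_oppr k x : inner k (- x) = - inner k x.
Proof. by rewrite -sumrN; apply: eq_bigr => i _; rewrite mxE mulrN. Qed.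

Lemma wave_oppr k x : wave k (- x) = conjc (wave k x).
Proof. by rewrite /wave inner_oppr mulrN conjc_cis. Qed.

Lemma wave0 x : wave 0 x = 1.
Proof.
by rewrite /wave (_ : inner 0 x = 0) ?mulr0 ?cis0// /inner big1// => i _;
  rewrite mxE mul0r.
Qed.

Lemma normc_wave k x : normc (wave k x) = 1.
Proof. exact: normc_cis. Qed.

Lemma normc_sqrE (z : R[i]) : normc z ^+ 2 = Re (z * conjc z).
Proof. by rewrite normc_sqr; case: z => a b /=; ring. Qed.

Lemma normc_conj (z : R[i]) : normc (conjc z) = normc z.
Proof. by case: z => a b /=; rewrite sqrrN. Qed.

Lemma cis_neq1 N (a : int) : (0 < N)%N -> ~~ (N %| absz a)%N ->
  cis (2 * pi * (a%:~R / N%:R)) != 1 :> R[i].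
Proof.
move=> N0 Na; have NR : 0 < N%:R :> R by rewrite ltr0n.
pose r := (a %% N%:Z)%Z.
have r0 : 0 <= r by rewrite modz_ge0// -lt0n.
have rN : r < N%:Z by rewrite ltz_pmod// ltz_nat.
have r_neq0 : r != 0.
  by apply: contra Na => /eqP r_eq0; rewrite -[N]/(absz N%:Z) -dvdzE; apply/dvdz_mod0P.
have r_gt0 : 0 < r by rewrite lt_def r_neq0.
have -> : 2 * pi * (a%:~R / N%:R) =
    2 * pi * (a %/ N%:Z)%Z%:~R + 2 * (pi * (r%:~R / N%:R)) :> R.
  rewrite {1}(divz_eq a N%:Z) intrD intrM -/r -[N%:Z%:~R]/(N%:R : R).
  by field; exact: lt0r_neq0.
rewrite cisD cis_int mul1r; set phi := pi * _.
have s0 : 0 < sin phi.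
  apply: sin_gt0_pi; rewrite mulr_gt0 ?pi_gt0 ?divr_gt0 ?ltr0z//=.
  by rewrite gtr_pMr ?pi_gt0// ltr_pdivrMr// mul1r -[N%:R]/(N%:Z%:~R) ltr_int.
apply/eqP => c1; have : normc (cis (2 * phi) - 1) ^+ 2 = 0.
  by rewrite c1 subrr Normc.normc0 expr0n.
rewrite cis_sub1_sqr (mulr_natl phi 2) cos_mulr2n cos2sin2 => h.
have : sin phi ^+ 2 = 0 by rewrite mulr2n in h; lra.
by move/eqP; rewrite expf_eq0/= gt_eqF.
Qed.

Lemma sum_wave_eq0 N k i : (0 < N)%N -> ~~ (N %| absz (k ord0 i))%N ->
  \sum_(n : 'rV['I_N]_d) wave k (gridpt R n) = 0.
Proof.
move=> N0 /(cis_neq1 N0); set w := cis _ => w1; set S := \sum_n _.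
have H : S = w * S.
  rewrite {1}/S -(sum_shift _ (@gshift_inj N d i)) /S mulr_sumr.
  by apply: eq_bigr => n _; rewrite /wave cis_shift.
apply/eqP; have : (w - 1) * S = 0 by rewrite mulrBl mul1r -H subrr.
by move/eqP; rewrite mulf_eq0 subr_eq0 (negbTE w1).
Qed.

Lemma same_class_sym N k l : same_class N k l = same_class N l k.
Proof. by apply: eq_forallb => i; rewrite -abszN opprB. Qed.

(** A Schur test. In the expanded square, orthogonality on the grid leaves only pairs of congruent
    frequencies; for those the product is regrouped as (t_j mu_j') (t_j' mu_j) and split by 2xy <=
    x^2 + y^2. The two halves are equal by symmetry. *)
Lemma mean_sqr_waves_le N (J : finType) (kap : J -> 'rV[int]_d) (c : J -> R[i])
    (t mu : J -> R) (La : R) : (0 < N)%N ->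
  (forall j, normc (c j) = t j * mu j) ->
  (forall j, \sum_(j' | same_class N (kap j') (kap j)) mu j' ^+ 2 <= La) ->
  (N%:R ^+ d)^-1 *
    \sum_(n : 'rV['I_N]_d) normc (\sum_j c j * wave (kap j) (gridpt R n)) ^+ 2 <=
  La * \sum_j t j ^+ 2.
Proof.
move=> N0 ctm muLa; have NR : 0 < N%:R ^+ d :> R by rewrite exprn_gt0 ?ltr0n.
rewrite ler_pdivrMl//.
have E n : normc (\sum_j c j * wave (kap j) (gridpt R n)) ^+ 2 =
    \sum_j \sum_j' Re (c j * conjc (c j') * wave (kap j - kap j') (gridpt R n)).
  rewrite normc_sqrE rmorph_sum/= mulr_suml Re_sum; apply: eq_bigr => j _.
  rewrite mulr_sumr Re_sum; apply: eq_bigr => j' _.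
  by rewrite waveD waveN rmorphM/= mulrACA.
under eq_bigr do rewrite E.
rewrite exchange_big/=; under eq_bigr do rewrite exchange_big/=.
apply: (@le_trans _ _ (\sum_j \sum_(j' | same_class N (kap j') (kap j))
    N%:R ^+ d * ((t j ^+ 2 * mu j' ^+ 2 + t j' ^+ 2 * mu j ^+ 2) / 2))).
  apply: ler_sum => j _; rewrite [leRHS]big_mkcond/=; apply: ler_sum => j' _.
  rewrite -Re_sum -mulr_sumr; case: ifPn => [sc|].
    rewrite (le_trans (ler_norm _))// (le_trans (Re_le_normc _))//.
    rewrite !Normc.normcM normc_conj mulrC.
    have -> : normc (c j) * normc (c j') = (t j * mu j') * (t j' * mu j).
      by rewrite !ctm; ring.
    apply: (@le_trans _ _ (N%:R ^+ d * `|(t j * mu j') * (t j' * mu j)|)).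
      apply: le_trans (ler_norm _) _; rewrite normrM ler_wpM2r// ger0_norm ?normc_ge0//.
      rewrite (le_trans (normc_sum _ _ _))//.
      under eq_bigr do rewrite normc_wave.
      by rewrite sumr_const card_grid -natrX.
    rewrite ler_wpM2l ?(ltW NR)// ler_pdivlMr// normrM -!exprMn.
    rewrite -(real_normK (num_real (t j * _))) -(real_normK (num_real (t j' * _))).
    have := sqr_ge0 (`|t j * mu j'| - `|t j' * mu j|); lra.
  move=> /forallPn[i nd]; rewrite (@sum_wave_eq0 _ _ i)// ?mulr0//.
  by rewrite !mxE -abszN opprB.
have H (P : J -> J -> bool) (A B : J -> J -> R) (x : R) :
    \sum_j \sum_(j' | P j j') x * ((A j j' + B j j') / 2) =
    x * ((\sum_j \sum_(j' | P j j') A j j' + \sum_j \sum_(j' | P j j') B j j') / 2).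
  rewrite -big_split/= mulr_suml mulr_sumr; apply: eq_bigr => j _.
  by rewrite -big_split/= mulr_suml mulr_sumr.
rewrite H ler_wpM2l ?(ltW NR)// ler_pdivrMr//.
set S1 := \sum_j \sum_(_ | _) _; set S2 := \sum_j \sum_(_ | _) _.
have S12 : S2 = S1.
  rewrite /S2 (exchange_big_dep predT)//= /S1; apply: eq_bigr => j _.
  by apply: eq_bigl => j'; rewrite same_class_sym.
rewrite S12 -mulr2n -(mulr_natr S1) ler_wpM2r// /S1 mulr_sumr ler_sum// => j _.
by rewrite -mulr_sumr mulrC ler_wpM2r ?sqr_ge0.
Qed.

Lemma mean_wave M k x : (0 < M)%N -> (forall i, (absz (k ord0 i) < M)%N) ->
  (M%:R ^+ d)^-1 * \sum_(n : 'rV['I_M]_d) Re (wave k (x - gridpt R n)) = (k == 0)%:R.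
Proof.
move=> M0 kM; have MR : M%:R ^+ d != 0 :> R by rewrite expf_neq0// pnatr_eq0 -lt0n.
have [->|k0] := eqVneq k 0.
  under eq_bigr do rewrite wave0.
  by rewrite sumr_const card_grid -[X in X *+ _]/(1) -natrX -[X in _ * X]/(_%:R)
    mulVf// natrX.
have [i ki] : exists i, k ord0 i != 0.
  apply/existsP; apply: contraNT k0 => /existsPn k0; apply/eqP/rowP => i.
  by rewrite mxE; have := k0 i; rewrite negbK => /eqP.
rewrite -Re_sum; under eq_bigr do rewrite wave_addr wave_oppr.
rewrite -mulr_sumr -rmorph_sum/= (@sum_wave_eq0 M k i)//.
  by rewrite rmorph0 mulr0/= mulr0.
by apply: contraTN (kM i) => /dvdn_leq; rewrite absz_gt0 ki -leqNgt; exact.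
Qed.

End Waves.

(** * Continuous periodic functions *)

Section TorusFunctions.
Context {R : realType}.
Variable d : nat.
Variable F : 'rV[R]_d -> R.
Hypothesis cF : continuous F.
Hypothesis tF : torus_fun F.

Lemma torus_bounded : exists2 A : R, 0 <= A & forall x, `|F x| <= A.
Proof.
have cN : {within [set x : 'rV[R]_d | in_cube x], continuous (fun x => `|F x|)}.
  apply: continuous_subspaceT => x; apply: (@continuous_comp _ _ _ F Num.norm).
    exact: cF.
  exact: norm_continuous.
have ne : ([set x : 'rV[R]_d | in_cube x] !=set0)%classic.
  by exists 0 => i; rewrite mxE lexx ler01.
have [c _ Hc] := EVT_max_rV ne (@cube_compact R d) cN.
exists `|F c| => // x.
pose l : 'rV[int]_d := \row_i (- Num.floor (x ord0 i)).
rewrite -(tF x l); apply: Hc; rewrite inE => i.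
rewrite !mxE mulrNz; have /andP[] := floor_itv (x ord0 i); rewrite intrD; lra.
Qed.

Lemma cos_periodZ (t : R) (m : int) : cos (t + 2 * pi * m%:~R) = cos t.
Proof.
have := cisD t (2 * pi * m%:~R); rewrite cis_int mulr1.
by move/(congr1 (@complex.Re R)).
Qed.

(** The Korovkin majorant: it reduces convergence of averages against a positive kernel to the test
    functions 1 and cos. A point away from x modulo periods has a coordinate where 1 - cos is at
    least [eta], and there the sup bound is affordable with C = 2A / eta. *)
Lemma torus_modulus x (e : R) : 0 < e -> exists2 C : R, 0 <= C & forall y,
  `|F y - F x| <= e + C * \sum_i (1 - cos (2 * pi * (x ord0 i - y ord0 i))).
Proof.
move=> e0; have [A A0 FA] := torus_bounded.
have /cvgrPdist_lt /(_ _ e0) /nbhs_ballP[r /= r0 rP] := @cF x.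
pose del := Num.min r 2^-1.
have del0 : 0 < del by rewrite lt_min r0 invr_gt0 ltr0n.
have delr : del <= r by rewrite ge_min lexx.
have del2 : del <= 2^-1 by rewrite ge_min lexx orbT.
have pi0 := pi_gt0 R.
have tdel : 2 * pi * del <= pi.
  by rewrite mulrAC -ler_pdivlMr// divff ?gt_eqF// -ler_pdivlMl// mulr1.
pose eta := 1 - cos (2 * pi * del).
have eta0 : 0 < eta.
  have td0 : 0 < 2 * pi * del by rewrite !mulr_gt0.
  by rewrite subr_gt0 -[ltRHS]cos0 ltr_cos// in_itv/= ?lexx ?(ltW pi0)// (ltW td0) tdel.
have cos1 t : 0 <= 1 - cos t :> R by rewrite subr_ge0 cos_le1.
exists (2 * A / eta); first by rewrite !mulr_ge0 ?invr_ge0// ltW.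
move=> y; set S := \sum_i _.
have S0 : 0 <= S by apply: sumr_ge0.
(* Translates y so that each coordinate is within 1/2 of that of x, where 1 - cos increases with the
   distance. *)
pose l : 'rV[int]_d := \row_i Num.floor (x ord0 i - y ord0 i + 2^-1).
pose y' := y + map_mx intr l.
have y'E i : x ord0 i - y' ord0 i =
    x ord0 i - y ord0 i - (Num.floor (x ord0 i - y ord0 i + 2^-1))%:~R.
  by rewrite !mxE opprD addrA.
have t2 i : `|x ord0 i - y' ord0 i| <= 2^-1.
  rewrite y'E ler_norml.
  have /andP[] := floor_itv (x ord0 i - y ord0 i + 2^-1); rewrite intrD; lra.
rewrite -(tF y l) -/y'.
case: (boolP [forall i, `|x ord0 i - y' ord0 i| < del]) => [/forallP near|].
  rewrite distrC (@le_trans _ _ e)//; last by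
    rewrite lerDl !mulr_ge0 ?invr_ge0 ?(ltW eta0).
  apply/ltW/rP; split=> // i j; rewrite (ord1 i).
  exact: lt_le_trans (near j) delr.
rewrite negb_forall => /existsP[i far]; rewrite -leNgt in far.
apply: (@le_trans _ _ (2 * A)).
  by rewrite (le_trans (ler_normB _ _))// mulr_natl mulr2n lerD.
rewrite -[leLHS]add0r lerD ?(ltW e0)// -mulrA ler_peMr ?mulr_ge0// ler_pdivlMl// mulr1.
apply: (@le_trans _ _ (1 - cos (2 * pi * (x ord0 i - y ord0 i)))).
  have -> : 2 * pi * (x ord0 i - y ord0 i) = 2 * pi * (x ord0 i - y' ord0 i) +
      2 * pi * (Num.floor (x ord0 i - y ord0 i + 2^-1))%:~R by rewrite y'E; ring.
  rewrite cos_periodZ /eta lerD2l lerN2 -cos_norm.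
  rewrite normrM (@ger0_norm _ (2 * pi)) ?mulr_ge0 ?(ltW pi0)//.
  rewrite leNgt ltr_cos ?in_itv/= -?leNgt.
  - by rewrite ler_pM2l ?mulr_gt0.
  - rewrite !mulr_ge0 ?(ltW pi0)//= mulrAC -ler_pdivlMr// divff ?gt_eqF//.
    by rewrite -ler_pdivlMl// mulr1.
  - by rewrite tdel andbT !mulr_ge0 ?(ltW del0) ?(ltW pi0).
by rewrite /S (bigD1 i)//= lerDl sumr_ge0.
Qed.

End TorusFunctions.

Section GridMean.
Context {R : realType}.
Variables d N : nat.
Implicit Types f g : 'rV[R]_d -> R.

Lemma grid_meanD f g :
  grid_mean N (fun x => f x + g x) = grid_mean N f + grid_mean N g.
Proof. by rewrite /grid_mean big_split mulrDr. Qed.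

Lemma grid_meanB f g :
  grid_mean N (fun x => f x - g x) = grid_mean N f - grid_mean N g.
Proof. by rewrite /grid_mean sumrB mulrBr. Qed.

Lemma grid_meanZr f c : grid_mean N (fun x => f x * c) = grid_mean N f * c.
Proof. by rewrite /grid_mean -mulr_suml mulrA. Qed.

Lemma grid_mean_sum (I : finType) (f : I -> 'rV[R]_d -> R) :
  grid_mean N (fun x => \sum_i f i x) = \sum_i grid_mean N (f i).
Proof. by rewrite /grid_mean exchange_big mulr_sumr. Qed.

Lemma le_grid_mean f g : (forall x, f x <= g x) -> grid_mean N f <= grid_mean N g.
Proof.
by move=> fg; rewrite ler_wpM2l ?invr_ge0 ?exprn_ge0// ler_sum.
Qed.

Lemma normr_grid_mean f : `|grid_mean N f| <= grid_mean N (fun x => `|f x|).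
Proof.
rewrite normrM ger0_norm ?invr_ge0 ?exprn_ge0//.
by rewrite ler_wpM2l ?invr_ge0 ?exprn_ge0// ler_norm_sum.
Qed.

End GridMean.

(** * The Fejer kernel and its grid means *)

Section FejerKernel.
Context {R : realType}.
Variable d : nat.
Local Notation normc := (@Normc.normc R).
Local Notation Re := (@complex.Re R).
Implicit Types (x y z : 'rV[R]_d) (k : 'rV[int]_d).

Definition nfreq n (j : 'rV['I_n]_d) : 'rV[int]_d := \row_i (j ord0 i)%:Z.

Lemma dfreqE n (j j' : 'rV['I_n]_d) : dfreq j j' = nfreq j - nfreq j'.
Proof. by apply/rowP => i; rewrite !mxE. Qed.

(** The Fejer kernel of the torus, written as a normalised square so that positivity is immediate;
    expanding it gives the frequency differences of [fkerE]. *)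
Definition fker n z : R := (n%:R ^+ d)^-1 * normc (\sum_j wave (@nfreq n j) z) ^+ 2.

Lemma fker_ge0 n z : 0 <= fker n z.
Proof. by rewrite mulr_ge0 ?sqr_ge0// invr_ge0 exprn_ge0. Qed.

Lemma fkerE n z :
  fker n z = (n%:R ^+ d)^-1 * \sum_j \sum_j' Re (wave (@dfreq n d j j') z).
Proof.
rewrite /fker; congr (_ * _); rewrite normc_sqrE rmorph_sum mulr_suml Re_sum.
apply: eq_bigr => j _; rewrite mulr_sumr Re_sum; apply: eq_bigr => j' _.
by rewrite dfreqE waveD waveN.
Qed.

Lemma mean_fker_shift n M k x : (0 < M)%N ->
  (forall (j j' : 'rV['I_n]_d) i, (absz ((dfreq j j' + k) ord0 i)%R < M)%N) ->
  grid_mean M (fun y => (n%:R ^+ d)^-1 *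
     \sum_j \sum_j' Re (wave (@dfreq n d j j' + k) (x - y))) =
  (n%:R ^+ d)^-1 * \sum_(j : 'rV['I_n]_d) \sum_(j' : 'rV['I_n]_d) (dfreq j j' + k == 0)%:R.
Proof.
move=> M0 kM; rewrite /grid_mean -mulr_sumr mulrCA; congr (_ * _).
rewrite exchange_big/= mulr_sumr; apply: eq_bigr => j _.
rewrite exchange_big/= mulr_sumr; apply: eq_bigr => j' _.
exact: mean_wave.
Qed.

Lemma absz_dfreq_lt n (j j' : 'rV['I_n]_d) i : (absz (dfreq j j' ord0 i) < n)%N.
Proof.
rewrite mxE; have := ltn_ord (j ord0 i); have := ltn_ord (j' ord0 i).
move: (nat_of_ord _) (nat_of_ord _) => a b; clear; lia.
Qed.

Lemma mean_fker n M x : (0 < n)%N -> (n <= M)%N ->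
  grid_mean M (fun y => fker n (x - y)) = 1.
Proof.
move=> n0 nM.
have -> : (fun y => fker n (x - y)) = (fun y => (n%:R ^+ d)^-1 *
     \sum_j \sum_j' Re (wave (@dfreq n d j j' + 0) (x - y))).
  apply/funext => y; rewrite fkerE; congr (_ * _).
  by apply: eq_bigr => j _; apply: eq_bigr => j' _; rewrite addr0.
rewrite mean_fker_shift ?(leq_trans n0)//; last first.
  by move=> j j' i; rewrite addr0 (leq_trans (absz_dfreq_lt _ _ _)).
rewrite (eq_bigr (fun=> 1)); last first.
  move=> j _; rewrite (bigD1 j)//= addr0 dfreqE subrr eqxx big1 ?addr0// => j' jj'.
  rewrite addr0 dfreqE subr_eq0; case: eqP => // /rowP h; case/negP: jj'.
  apply/eqP/rowP => i; apply: ord_inj; have := h i; rewrite !mxE => -[->].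
  by [].
rewrite sumr_const card_grid -[X in X *+ _]/(1 : R) natrX mulVf// expf_neq0//.
by rewrite pnatr_eq0 -lt0n.
Qed.

(** For each j the partner j' = j + e_i exists unless j_i = n - 1, which excludes n^(d-1) choices.
    The cyclic shift provides j', since it does not wrap in the remaining cases. *)
Lemma count_shift n (i : 'I_d) : (0 < n)%N ->
  n%:R ^+ d - n%:R ^+ d.-1 <=
  \sum_(j : 'rV['I_n]_d) \sum_(j' : 'rV['I_n]_d)
    (dfreq j j' + delta_mx ord0 i == 0)%:R :> R.
Proof.
move=> n0.
have E : \sum_(j : 'rV['I_n]_d) ((j ord0 i).+1 == n)%:R = n%:R ^+ d.-1 :> R.
  pose h (i' : 'I_d) (a : 'I_n) : R := if i' == i then (a.+1 == n)%:R else 1.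
  transitivity (\sum_(j : 'rV['I_n]_d) \prod_i' h i' (j ord0 i')).
    apply: eq_bigr => j _; rewrite (bigD1 i)//= /h eqxx big1 ?mulr1// => i' i'i.
    by rewrite (negbTE i'i).
  rewrite sum_prod_rV (bigD1 i)//= /h eqxx.
  have n1 : (n.-1 < n)%N by rewrite prednK.
  rewrite (bigD1 (Ordinal n1))//= prednK// eqxx big1 ?addr0 ?mul1r; last first.
    move=> a; rewrite -val_eqE/= => an; case: eqP => // aE; case/negP: an.
    by apply/eqP; exact: (congr1 predn aE).
  rewrite (eq_bigr (fun=> n%:R)); last first.
    by move=> i' i'i; rewrite (negbTE i'i) sumr_const card_ord.
  by rewrite prodr_const; congr (_ ^+ _); rewrite cardC1 card_ord.
rewrite -E -natrX -(card_grid n d) -sumr_const -sumrB ler_sum// => j _.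
case: eqP => [_|/eqP jn]; first by rewrite subrr sumr_ge0.
rewrite subr0 (bigD1 (gshift i j))//= -[leLHS]addr0 lerD ?sumr_ge0//.
suff -> : dfreq j (gshift i j) + delta_mx ord0 i = 0 by rewrite eqxx.
apply/rowP => i'; rewrite !mxE eqxx /= [i' == i]eq_sym; case: eqP => [<-|ii'] /=.
  rewrite modn_small; last by rewrite ltn_neqAle jn ltn_ord.
  by move: (nat_of_ord _) => a; clear; lia.
by rewrite subrr addr0.
Qed.

Lemma Re_wave_cos k i z : Re (wave k z) * cos (2 * pi * z ord0 i) =
  (Re (wave (k + delta_mx ord0 i) z) + Re (wave (k - delta_mx ord0 i) z)) / 2.
Proof.
rewrite !waveD waveN.
have -> : wave (delta_mx ord0 i) z = cis (2 * pi * z ord0 i).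
  rewrite /wave; congr (cis (_ * _)).
  rewrite /inner (bigD1 i)//= mxE !eqxx mul1r big1 ?addr0// => j ji.
  by rewrite mxE (negbTE ji) mul0r.
by rewrite conjc_cis /cis cosN sinN; case: (wave k z) => a b /=; field.
Qed.

(** Multiplying by the cosine shifts the frequencies by plus or minus e_i. The mean of a shifted
    kernel counts the pairs with j - j' opposite to the shift, a proportion of at least 1 - 1/n;
    hence the concentration at rate 1/n. *)
Lemma mean_fker_cos n M x i : (0 < n)%N -> (n < M)%N ->
  grid_mean M (fun y => fker n (x - y) * (1 - cos (2 * pi * (x ord0 i - y ord0 i)))) <=
  n%:R^-1.
Proof.
move=> n0 nM; have nR : 0 < n%:R :> R by rewrite ltr0n.
pose g k y := (n%:R ^+ d)^-1 * \sum_j \sum_j' Re (wave (@dfreq n d j j' + k) (x - y)).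
have -> : (fun y => fker n (x - y) * (1 - cos (2 * pi * (x ord0 i - y ord0 i)))) =
   (fun y => fker n (x - y) - (g (delta_mx ord0 i) y + g (- delta_mx ord0 i) y) / 2).
  apply/funext => y; rewrite mulrBr mulr1; congr (_ - _).
  have -> : x ord0 i - y ord0 i = (x - y) ord0 i by rewrite !mxE.
  rewrite fkerE /g -mulrDr -[LHS]mulrA -[RHS]mulrA; congr (_ * _).
  rewrite -big_split !mulr_suml; apply: eq_bigr => j _; cbv beta.
  rewrite -big_split !mulr_suml; apply: eq_bigr => j' _; cbv beta.
  exact: Re_wave_cos.
have -> : grid_mean M (fun y => fker n (x - y) -
    (g (delta_mx ord0 i) y + g (- delta_mx ord0 i) y) / 2) =
    grid_mean M (fun y => fker n (x - y)) -
    (grid_mean M (g (delta_mx ord0 i)) + grid_mean M (g (- delta_mx ord0 i))) / 2.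
  rewrite grid_meanB (grid_meanZr _ (fun y => g _ y + g _ y)); congr (_ - _ * _).
  exact: grid_meanD.
have bnd (k : 'rV[int]_d) : (forall i', (absz (k ord0 i') <= 1)%N) ->
    forall (j j' : 'rV['I_n]_d) i', (absz ((dfreq j j' + k) ord0 i')%R < M)%N.
  move=> k1 j j' i'; have h1 := absz_dfreq_lt j j' i'; have h2 := k1 i'.
  have -> : (dfreq j j' + k) ord0 i' = dfreq j j' ord0 i' + k ord0 i' by rewrite mxE.
  by move: (dfreq j j' ord0 i') (k ord0 i') h1 h2 nM => a b; clear; lia.
have M0 : (0 < M)%N by exact: leq_ltn_trans nM.
have d1 i' : (absz (delta_mx ord0 i ord0 i' : int) <= 1)%N by rewrite mxE; case: (_ && _).
rewrite mean_fker ?(ltnW nM)// !mean_fker_shift//; last 2 first.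
- by apply: bnd => i'; rewrite mxE abszN.
- exact: bnd.
have c1 := count_shift i n0.
have c2 : n%:R ^+ d - n%:R ^+ d.-1 <=
  \sum_(j : 'rV['I_n]_d) \sum_(j' : 'rV['I_n]_d)
    (dfreq j j' + - delta_mx ord0 i == 0)%:R :> R.
  apply: le_trans c1 _; rewrite exchange_big/= le_eqVlt; apply/orP; left; apply/eqP.
  apply: eq_bigr => j _; apply: eq_bigr => j' _; congr (nat_of_bool _)%:R.
  by rewrite !dfreqE -(inj_eq oppr_inj) oppr0 opprD opprB.
set S1 := \sum_j _ in c1 *; set S2 := \sum_j _ in c2 *.
have dE : n%:R ^+ d = n%:R * n%:R ^+ d.-1 :> R.
  by rewrite -exprS prednK// (leq_ltn_trans _ (ltn_ord i)).
have n1 : 0 < n%:R ^+ d.-1 :> R by rewrite exprn_gt0.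
have nd : 0 < n%:R ^+ d :> R by rewrite exprn_gt0.
have H : (n%:R ^+ d)^-1 * (n%:R ^+ d - n%:R ^+ d.-1) = 1 - n%:R^-1 :> R.
  by rewrite dE; field; rewrite !gt_eqF.
have H1 : 1 - n%:R^-1 <= (n%:R ^+ d)^-1 * S1 by rewrite -H ler_pM2l ?invr_gt0.
have H2 : 1 - n%:R^-1 <= (n%:R ^+ d)^-1 * S2 by rewrite -H ler_pM2l ?invr_gt0.
lra.
Qed.

End FejerKernel.

Section FejerConvergence.
Context {R : realType}.
Variable d : nat.
Variable F : 'rV[R]_d -> R.
Hypothesis cF : continuous F.
Hypothesis tF : torus_fun F.
Local Notation Re := (@complex.Re R).
Local Notation Im := (@complex.Im R).
Implicit Types (x y z : 'rV[R]_d) (k : 'rV[int]_d).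

Definition fejer_sum (c : 'rV[int]_d -> R[i]) n x : R := (n%:R ^+ d)^-1 *
  \sum_(j' : 'rV['I_n]_d) Re (\sum_(j : 'rV['I_n]_d) c (dfreq j j') * wave (dfreq j j') x).

(** With DFT coefficients the Fejer sum is a finite convolution with the kernel, without integrals.
    The kernel estimates hold for every M > n, so M can tend to infinity first and n afterwards. *)
Lemma fejer_sdft n M x : fejer_sum (sdft (@pts R d M F)) n x =
  grid_mean M (fun y => F y * fker n (x - y)).
Proof.
rewrite /fejer_sum.
have -> : (fun y => F y * fker n (x - y)) = (fun y => (\sum_(j' : 'rV['I_n]_d)
    \sum_(j : 'rV['I_n]_d) F y * Re (wave (dfreq j j') (x - y))) * (n%:R ^+ d)^-1).
  apply/funext => y; rewrite fkerE mulrCA mulrC; congr (_ * _).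
  rewrite exchange_big mulr_sumr; apply: eq_bigr => j _; cbv beta.
  by rewrite mulr_sumr.
rewrite grid_meanZr mulrC; congr (_ * _).
rewrite grid_mean_sum; apply: eq_bigr => j' _.
rewrite grid_mean_sum Re_sum; apply: eq_bigr => j _.
rewrite /sdft -mulrA Re_realM; congr (_ * _).
rewrite mulr_suml Re_sum; apply: eq_bigr => n' _.
rewrite -mulrA Re_realM; congr (_ * Re _).
by rewrite wave_addr mulrC /wave inner_oppr mulrN.
Qed.

Lemma fejer_sum_dist n M x (e C : R) : (0 < n)%N -> (n < M)%N -> 0 <= C ->
  (forall y, `|F y - F x| <=
     e + C * \sum_i (1 - cos (2 * pi * (x ord0 i - y ord0 i)))) ->
  `|fejer_sum (sdft (@pts R d M F)) n x - F x| <= e + C * d%:R / n%:R.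
Proof.
move=> n0 nM C0 HC.
have -> : fejer_sum (sdft (@pts R d M F)) n x - F x =
    grid_mean M (fun y => (F y - F x) * fker n (x - y)).
  rewrite fejer_sdft -[X in _ - X]mulr1 -(mean_fker x n0 (ltnW nM)) [F x * _]mulrC.
  rewrite -grid_meanZr -grid_meanB; congr grid_mean; apply/funext => y; ring.
apply: le_trans (normr_grid_mean _ _) _.
apply: (@le_trans _ _ (grid_mean M (fun y => fker n (x - y) * e + (\sum_i
    fker n (x - y) * (1 - cos (2 * pi * (x ord0 i - y ord0 i)))) * C))).
  apply: le_grid_mean => y; rewrite normrM (ger0_norm (fker_ge0 _ _)) mulrC.
  rewrite -mulr_sumr -mulrA -mulrDr ler_wpM2l ?fker_ge0// (mulrC _ C).
  exact: HC.
rewrite grid_meanD !grid_meanZr mean_fker ?(ltnW nM)// mul1r lerD2l.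
rewrite grid_mean_sum mulrC -mulrA ler_wpM2l//.
have -> : d%:R / n%:R = \sum_(i < d) n%:R^-1 :> R.
  by rewrite sumr_const card_ord mulr_natl.
rewrite ler_sum// => i _.
exact: mean_fker_cos.
Qed.

Lemma cvg_Re_mul (u : nat -> R[i]) (l w : R[i]) :
  (fun M => Re (u M)) @ \oo --> Re l -> (fun M => Im (u M)) @ \oo --> Im l ->
  (fun M => Re (u M * w)) @ \oo --> Re (l * w).
Proof.
have E (z : R[i]) : Re (z * w) = Re z * Re w - Im z * Im w.
  by case: z w => a b [a' b'].
move=> ul vl; under eq_cvg do rewrite E; rewrite E.
by apply: cvgB; apply: cvgMl.
Qed.

Lemma fejer_sum_cvg_sdft n x : (fun M => fejer_sum (sdft (@pts R d M F)) n x) @ \oo -->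
  fejer_sum (sfhat F) n x.
Proof.
apply: cvgMr; apply: cvg_big => [|j' _]; first exact: add_continuous.
under eq_cvg do rewrite Re_sum; rewrite Re_sum.
apply: cvg_big => [|j _]; first exact: add_continuous.
by apply: cvg_Re_mul; [exact: sdft_cvg_Re|exact: sdft_cvg_Im].
Qed.

Lemma fejer_cvg x : (fun n => fejer_sum (sfhat F) n x) @ \oo --> F x.
Proof.
apply/cvgrPdist_le => e e0.
have e20 : 0 < e / 2 by rewrite divr_gt0.
have [C C0 HC] := torus_modulus cF tF x e20.
near=> n.
have n0 : (0 < n)%N by near: n; exact: nbhs_infty_gt.
have nC : C * d%:R / (e / 2) < n%:R by near: n; exact: nbhs_infty_gtr.
have H : `|fejer_sum (sfhat F) n x - F x| <= e / 2 + C * d%:R / n%:R.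
  have cv : (fun M => `|fejer_sum (sdft (@pts R d M F)) n x - F x|) @ \oo -->
      `|fejer_sum (sfhat F) n x - F x|.
    apply: cvg_norm; apply: cvgB; last exact: cvg_cst.
    exact: fejer_sum_cvg_sdft.
  apply: (cvgr_to_le cv); near=> M.
  by apply: fejer_sum_dist => //; near: M; exact: nbhs_infty_gt.
rewrite distrC (le_trans H)// [leRHS](splitr e) lerD2l ler_pdivrMr ?ltr0n//.
by rewrite [leRHS]mulrC -ler_pdivrMr//; exact: ltW.
Unshelve. all: by end_near. Qed.

End FejerConvergence.

Lemma sum_le_card (R : realType) (I : finType) (f : I -> R) (B : R) :
  (forall i, f i <= B) -> \sum_i f i <= #|I|%:R * B.
Proof. by move=> fB; rewrite mulr_natl -sumr_const ler_sum. Qed.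

(** * Sup bound and discrete regularity from the Fourier weights *)

Section SobolevGrid.
Context {R : realType}.
Variable d s : nat.
Hypothesis d0 : (0 < d)%N.
Hypothesis ds : (d < 2 * s)%N.
Local Notation normc := (@Normc.normc R).
Local Notation Re := (@complex.Re R).
Implicit Types (F : 'rV[R]_d -> R) (k : 'rV[int]_d).

(** The form in which Fejer sums use the Sobolev norm: a bound on finite sums over every window of
    frequencies j - j'. *)
Definition hs_energy_le Q F := forall n (j' : 'rV['I_n]_d),
  \sum_(j : 'rV['I_n]_d) @hs_weight R d s (dfreq j j') *
     normc (sfhat F (dfreq j j')) ^+ 2 <= Q.

Let q : R := (2 * s)%:R / d%:R.

Let q1 : 1 < q.
Proof. by rewrite /q ltr_pdivlMr ?ltr0n// mul1r ltr_nat. Qed.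

(** In each window |c| <= 1/w + w |c|^2, where w is the weight of the coefficient c: the first terms
    have a bounded sum because s > d/2, the second add up to at most Q. *)
Lemma fejer_sum_sup : exists2 A : R, 0 <= A & forall F Q n x, (0 < n)%N ->
  hs_energy_le Q F -> `|fejer_sum (sfhat F) n x| <= A + Q.
Proof.
have [G G0 hG] := @freq_weight_sum R q d q1.
exists (4 ^+ (2 * s) * G); first by rewrite mulr_ge0 ?exprn_ge0.
move=> F Q n x n0 HQ.
have nd : 0 < n%:R ^+ d :> R by rewrite exprn_gt0 ?ltr0n.
rewrite /fejer_sum normrM ger0_norm ?invr_ge0 ?(ltW nd)// ler_pdivrMl//.
rewrite -natrX -(card_grid n d) mulr_natl -sumr_const.
rewrite (le_trans (ler_norm_sum _ _ _))// ler_sum// => j' _.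
rewrite (le_trans (Re_le_normc _))// (le_trans (normc_sum _ _ _))//.
pose T : R := \sum_(j : 'rV['I_n]_d) ((@hs_weight R d s (dfreq j j'))^-1 +
    @hs_weight R d s (dfreq j j') * normc (sfhat F (dfreq j j')) ^+ 2).
apply: (@le_trans _ _ T).
  apply: ler_sum => j _; rewrite Normc.normcM normc_wave mulr1.
  set a := normc _; set w := hs_weight _ _.
  have w0 : 0 < w by exact: hs_weight_gt0.
  have a0 : 0 <= a by exact: normc_ge0.
  have : 0 <= w * (a - w^-1) ^+ 2 by rewrite mulr_ge0 ?sqr_ge0// ltW.
  have -> : w * (a - w^-1) ^+ 2 = w * a ^+ 2 + w^-1 - 2 * a.
    by field; exact: lt0r_neq0.
  lra.
rewrite /T big_split lerD//.
apply: (@le_trans _ _ (\sum_(j : 'rV['I_n]_d)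
    4 ^+ (2 * s) * freq_weight q 1 (dfreq j j'))).
  by apply: ler_sum => j _; exact: inv_weight_le.
rewrite -mulr_sumr ler_wpM2l ?exprn_ge0//.
apply: le_trans (hG 1%N n j' j' isT); rewrite big_mkcond le_eqVlt; apply/orP; left.
apply/eqP; rewrite [RHS]big_mkcond/=; apply: eq_bigr => j _.
by rewrite (_ : same_class _ _ _)//; apply/forallP => i; rewrite dvd1n.
Qed.

Lemma difn_Re (T : Type) (tau : T -> T) r (f : T -> R[i]) g :
  difn tau r (fun x => Re (f x)) g = Re (difn tau r f g).
Proof. by elim: r g => [//|r IH] g; rewrite !difnS !IH ReB. Qed.

Lemma difn_wave N (i : 'I_d) r k (g : 'rV['I_N]_d) :
  difn (gshift i) r (fun g => wave k (gridpt R g)) g =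
  (cis (2 * pi * ((k ord0 i)%:~R / N%:R)) - 1) ^+ r * wave k (gridpt R g).
Proof.
elim: r g => [|r IH] g; first by rewrite expr0 mul1r.
by rewrite difnS !IH /wave cis_shift exprS; ring.
Qed.

(** Cauchy-Schwarz over the windows reduces the claim to a single one, where differences act on each
    wave as a scalar and only congruent frequencies interact on the grid. *)
Lemma fejer_sum_smooth : exists2 C : R, 0 <= C & forall F Q n N (i : 'I_d),
  (0 < n)%N -> (0 < N)%N -> hs_energy_le Q F ->
  (N%:R ^+ d)^-1 * \sum_g difn (gshift i) s (@pts R d N (fejer_sum (sfhat F) n)) g ^+ 2
    <= C * Q / N%:R ^+ (2 * s).
Proof.
have [G G0 hG] := @freq_weight_sum R q d q1.
exists ((8 * pi) ^+ (2 * s) * G); first by rewrite mulr_ge0 ?exprn_ge0 ?mulr_ge0 ?pi_ge0.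
move=> F Q n N i n0 N0 HQ.
have nd : 0 < n%:R ^+ d :> R by rewrite exprn_gt0 ?ltr0n.
have Nd : 0 < N%:R ^+ d :> R by rewrite exprn_gt0 ?ltr0n.
pose w k := cis (2 * pi * ((k ord0 i)%:~R / N%:R)) - 1 : R[i].
pose v (j' : 'rV['I_n]_d) (g : 'rV['I_N]_d) := \sum_(j : 'rV['I_n]_d)
  (sfhat F (dfreq j j') * w (dfreq j j') ^+ s) * wave (dfreq j j') (gridpt R g).
have E g : difn (gshift i) s (@pts R d N (fejer_sum (sfhat F) n)) g =
    (n%:R ^+ d)^-1 * \sum_j' Re (v j' g).
  rewrite /pts /fejer_sum difnZl difn_sum; congr (_ * _).
  apply: eq_bigr => j' _; rewrite difn_Re difn_sum; congr Re.
  by apply: eq_bigr => j _; rewrite difnZl difn_wave mulrA.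
apply: (@le_trans _ _ ((N%:R ^+ d)^-1 * \sum_g (n%:R ^+ d)^-1 *
    \sum_j' normc (v j' g) ^+ 2)).
  rewrite ler_wpM2l ?invr_ge0 ?(ltW Nd)// ler_sum// => g _.
  rewrite E exprMn expr2 -mulrA ler_wpM2l ?invr_ge0 ?(ltW nd)// ler_pdivrMl//.
  rewrite (le_trans (sqr_sum_fin_le _))// card_grid natrX ler_wpM2l ?(ltW nd)//.
  by rewrite ler_sum// => j' _; rewrite normc_sqr lerDl sqr_ge0.
rewrite -mulr_sumr exchange_big mulrCA mulr_sumr.
rewrite ler_pdivrMl// (_ : n%:R ^+ d = #|{: 'rV['I_n]_d}|%:R); last first.
  by rewrite card_grid natrX.
apply: sum_le_card => j'.
(* The weight is divided between the two factors: the squares of [t] sum to the energy, and those of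
   [mu] over a residue class give the factor N^(-2s). *)
pose t (j : 'rV['I_n]_d) := Num.sqrt (@hs_weight R d s (dfreq j j')) *
   normc (sfhat F (dfreq j j')).
pose mu (j : 'rV['I_n]_d) := normc (w (dfreq j j')) ^+ s /
   Num.sqrt (@hs_weight R d s (dfreq j j')).
have w0 k : 0 < @hs_weight R d s k by exact: hs_weight_gt0.
apply: le_trans (@mean_sqr_waves_le R d N _ (fun j => dfreq j j') _ t mu
   ((8 * pi) ^+ (2 * s) / N%:R ^+ (2 * s) * G) N0 _ _) _.
- move=> j; rewrite Normc.normcM normcX /t /mu.
  set a := Num.sqrt _; have a0 : a != 0 by rewrite gt_eqF// sqrtr_gt0.
  by field.
- move=> j; apply: le_trans (ler_wpM2l _ (hG N n j' j N0)); last first.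
    by rewrite divr_ge0 ?exprn_ge0 ?mulr_ge0 ?pi_ge0.
  rewrite mulr_sumr ler_sum// => j1 _; rewrite /mu expr_div_n sqr_sqrtr ?(ltW (w0 _))//.
  exact: diff_weight_le.
have -> : (8 * pi) ^+ (2 * s) * G * Q / N%:R ^+ (2 * s) =
  (8 * pi) ^+ (2 * s) / N%:R ^+ (2 * s) * G * Q by ring.
rewrite ler_wpM2l//.
  by rewrite mulr_ge0 ?divr_ge0 ?exprn_ge0 ?mulr_ge0 ?pi_ge0.
apply: le_trans (HQ n j'); rewrite ler_sum// => j _.
by rewrite /t exprMn sqr_sqrtr// ltW.
Qed.

Lemma difn_cvg (T : Type) (tau : T -> T) r (f : nat -> T -> R) (f' : T -> R) :
  (forall x, (fun n => f n x) @ \oo --> f' x) ->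
  forall x, (fun n => difn tau r (f n) x) @ \oo --> difn tau r f' x.
Proof.
move=> ff; elim: r => [//|r IH] x; under eq_cvg do rewrite difnS.
by rewrite difnS; apply: cvgB.
Qed.

(** Each bound involves finitely many values of the function and constants free of the Fejer order,
    so it survives the pointwise limit. *)
Lemma sobolev_grid : exists2 A : R, 0 <= A & exists2 C : R, 0 <= C &
  forall F Q, continuous F -> torus_fun F -> hs_energy_le Q F ->
    (forall x, `|F x| <= A + Q) /\ smooth_grid s (C * Q) F.
Proof.
have [A A0 HA] := fejer_sum_sup; have [C C0 HC] := fejer_sum_smooth.
exists A => //; exists C => // F Q cF tF HQ; split=> [x|N i N0].
  have cv : (fun n => `|fejer_sum (sfhat F) n x|) @ \oo --> `|F x|.
    by apply: cvg_norm; exact: fejer_cvg.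
  apply: (cvgr_to_le cv); near=> n.
  by apply: HA => //; near: n; exact: nbhs_infty_gt.
have cv : (fun n => (N%:R ^+ d)^-1 * \sum_g difn (gshift i) s
      (@pts R d N (fejer_sum (sfhat F) n)) g ^+ 2) @ \oo -->
    (N%:R ^+ d)^-1 * \sum_g difn (gshift i) s (@pts R d N F) g ^+ 2.
  apply: cvgMr; apply: cvg_big => [|g _]; first exact: add_continuous.
  under eq_cvg do rewrite expr2; rewrite expr2.
  by apply: cvgM; apply: difn_cvg => {}g; exact: fejer_cvg.
apply: (cvgr_to_le cv); near=> n.
by apply: HC => //; near: n; exact: nbhs_infty_gt.
Unshelve. all: by end_near. Qed.

End SobolevGrid.

(** * The Sobolev norm: frequency windows, sublevel sets, compact sets *)

Section HsEnergy.
Context {R : realType}.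
Variables d m s : nat.
Local Notation normc := (@Normc.normc R).
Implicit Types f g : 'rV[R]_d -> 'cV[R]_m.

Lemma dfreq_inj n (j' : 'rV['I_n]_d) : injective (fun j => dfreq j j').
Proof.
move=> j1 j2 /rowP h; apply/rowP => i; apply: ord_inj; have := h i.
by rewrite !mxE => /addIr [].
Qed.

Lemma fhatE f k c : fhat f k c ord0 = sfhat (fun x => f x c ord0) k.
Proof. by rewrite mxE. Qed.

Lemma sqnormCE (z : R[i]) : sqnormC z = normc z ^+ 2.
Proof. by rewrite normc_sqr. Qed.

Lemma sqfrobC_fhat f k : sqfrobC (fhat f k) =
  \sum_c normc (sfhat (fun x => f x c ord0) k) ^+ 2.
Proof.
by apply: eq_bigr => c _; rewrite big_ord1 sqnormCE fhatE.
Qed.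

Lemma Hs_sqnorm_energy f Q : (Hs_sqnorm s f <= Q%:E)%E ->
  forall c, @hs_energy_le R d s Q (fun x => f x c ord0).
Proof.
move=> fQ c n j'.
rewrite -lee_fin; apply: le_trans fQ; apply: esum_ge.
pose r := [seq dfreq j j' | j <- enum {: 'rV['I_n]_d}].
have ur : uniq r by rewrite map_inj_uniq ?enum_uniq//; exact: dfreq_inj.
exists [set` r]; first by split => //; exact: finite_seq.
rewrite -fsbig_seq// sumEFin lee_fin /r big_map big_enum/= ler_sum// => j _.
rewrite ler_wpM2l ?(ltW (hs_weight_gt0 _ _))// sqfrobC_fhat (bigD1 c)//= lerDl.
by apply: sumr_ge0 => i _; exact: sqr_ge0.
Qed.

(** Additivity is trivial for grid means and passes to their limits, which avoids integrability at
    each level of the iterated integral. *)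
Lemma cube_intD (u v : 'rV[R]_d -> R) : continuous u -> continuous v ->
  cube_int (fun x => u x + v x) = cube_int u + cube_int v.
Proof.
move=> cu cv; have cuv : continuous (fun x => u x + v x).
  by move=> x; apply: continuousD; [exact: cu|exact: cv].
rewrite -(cvg_lim (@Rhausdorff R) (grid_mean_cvg cuv)).
apply: (cvg_lim (@Rhausdorff R)).
by under eq_cvg do rewrite grid_meanD; apply: cvgD; exact: grid_mean_cvg.
Qed.

Lemma sfhatD (u v : 'rV[R]_d -> R) k : continuous u -> continuous v ->
  sfhat (fun x => u x + v x) k = sfhat u k + sfhat v k.
Proof.
move=> cu cv; apply/eqP; rewrite eq_complex ReD ImD !Re_sfhat !Im_sfhat.
apply/andP; split; apply/eqP; rewrite -cube_intD.
- by congr cube_int; apply/funext => x; rewrite mulrDl.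
- by apply: phase_continuous => //; exact: continuous_cos.
- by apply: phase_continuous => //; exact: continuous_cos.
- by congr cube_int; apply/funext => x; rewrite mulrDl.
- by apply: phase_continuous => //; exact: continuous_sin.
- by apply: phase_continuous => //; exact: continuous_sin.
Qed.

Lemma normc_sqrD_le (z w : R[i]) (e : R) : 0 < e ->
  normc (z + w) ^+ 2 <= (1 + e) * normc z ^+ 2 + (1 + e^-1) * normc w ^+ 2.
Proof.
move=> e0; have H : 2 * (normc z * normc w) <= e * normc z ^+ 2 + e^-1 * normc w ^+ 2.
  have : 0 <= e * (normc z - e^-1 * normc w) ^+ 2 by rewrite mulr_ge0 ?sqr_ge0// ltW.
  have -> : e * (normc z - e^-1 * normc w) ^+ 2 =
     e * normc z ^+ 2 + e^-1 * normc w ^+ 2 - 2 * (normc z * normc w).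
    by field; exact: lt0r_neq0.
  lra.
apply: (@le_trans _ _ ((normc z + normc w) ^+ 2)).
  by rewrite lerXn2r ?nnegrE ?addr_ge0 ?normc_ge0// le_normcD.
rewrite sqrrD; lra.
Qed.

Lemma Hs_sqnorm_ge0 f : (0 <= Hs_sqnorm s f)%E.
Proof.
apply: esum_ge0 => k _; rewrite lee_fin mulr_ge0 ?(ltW (hs_weight_gt0 _ _))//.
by rewrite sqfrobC_fhat sumr_ge0// => c _; exact: sqr_ge0.
Qed.

Lemma coord_fun_continuous f c : continuous f -> continuous (fun x => f x c ord0).
Proof.
move=> cf x; apply: (@continuous_comp _ _ _ f (fun v : 'cV[R]_m => v c ord0)).
  exact: cf.
exact: coord_continuous.
Qed.

Lemma Hs_sqnorm_le_fin f g (e Qf Qd : R) : 0 < e -> continuous f -> continuous g ->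
  (Hs_sqnorm s f <= Qf%:E)%E -> (Hs_sqnorm s (fun x => g x - f x)%R <= Qd%:E)%E ->
  (Hs_sqnorm s g <= ((1 + e) * Qf + (1 + e^-1) * Qd)%:E)%E.
Proof.
move=> e0 cf cg fQ dQ; have e1 : 0 <= e^-1 by rewrite invr_ge0 ltW.
have e2 : 0 <= 1 + e by rewrite addr_ge0// ltW.
have e3 : 0 <= 1 + e^-1 by rewrite addr_ge0.
have fin (h : 'rV[R]_d -> 'cV[R]_m) (Q : R) (X : set 'rV[int]_d) :
    (Hs_sqnorm s h <= Q%:E)%E -> finite_set X ->
    \sum_(k <- fset_set X) (1 + knorm2 R k ^+ s) * sqfrobC (fhat h k) <= Q.
  move=> hQ fX; rewrite -lee_fin; apply: le_trans hQ; apply: esum_ge.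
  by exists X; [split|rewrite fsbig_finite//= sumEFin].
apply: ge_ereal_sup => _ [X [fX _] <-].
rewrite fsbig_finite//= sumEFin lee_fin.
apply: (@le_trans _ _ ((1 + e) * \sum_(k <- fset_set X)
    (1 + knorm2 R k ^+ s) * sqfrobC (fhat f k) + (1 + e^-1) *
  \sum_(k <- fset_set X) (1 + knorm2 R k ^+ s) *
    sqfrobC (fhat (fun x => g x - f x) k))); last first.
  by rewrite lerD// ler_wpM2l//; exact: fin.
rewrite !mulr_sumr -big_split/= ler_sum// => k _.
rewrite mulrCA [X in _ <= _ + X]mulrCA -mulrDr.
rewrite ler_wpM2l ?(ltW (hs_weight_gt0 _ _))// !sqfrobC_fhat.
rewrite !mulr_sumr -big_split ler_sum// => c _.
have -> : sfhat (fun x => g x c ord0) k =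
    sfhat (fun x => f x c ord0) k + sfhat (fun x => (g x - f x) c ord0) k.
  rewrite -sfhatD; first last.
  - apply: coord_fun_continuous => x; apply: continuousB; [exact: cg|exact: cf].
  - exact: coord_fun_continuous.
  by congr sfhat; apply/funext => x; rewrite !mxE subrKC.
exact: normc_sqrD_le.
Qed.

(** Compact sets will be bounded because these sublevel sets cover the space. The inequality |z +
    w|^2 <= (1 + e)|z|^2 + (1 + 1/e)|w|^2 replaces the triangle inequality, so that everything stays
    at the level of squared norms. *)
Lemma Hs_lt_open (n : R) : open [set f : Hs R d m s | (Hs_sqnorm s f < n%:E)%E].
Proof.
move=> f /= fn; have f0 := Hs_sqnorm_ge0 f.
pose Q := fine (Hs_sqnorm s f).
have QE : Hs_sqnorm s f = Q%:E.
  by rewrite /Q fineK// ge0_fin_numE// (lt_trans fn)// ltry.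
have Q0 : 0 <= Q by rewrite -lee_fin -QE.
have Qn : Q < n by rewrite -lte_fin -QE.
pose D := n - Q; have D0 : 0 < D by rewrite subr_gt0.
have Q1 : 0 < Q + 1 by rewrite ltr_wpDl.
(* Of the gap D = n - Q, the choice of [e] spends at most D/2 on the term e Q, and that of [r]
   spends D/4 on the perturbation. *)
pose e := D / (2 * (Q + 1)).
have e0 : 0 < e by rewrite divr_gt0// mulr_gt0.
have e1 : 0 < 1 + e^-1 by rewrite addr_gt0// invr_gt0.
pose r := Num.sqrt (D / (4 * (1 + e^-1))).
have r20 : 0 < D / (4 * (1 + e^-1)) by rewrite divr_gt0// mulr_gt0.
exists r => [|g /= gr]; first by rewrite sqrtr_gt0.
apply: (le_lt_trans (Hs_sqnorm_le_fin e0 (@Hs_continuous _ _ _ _ f)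
   (@Hs_continuous _ _ _ _ g) _ (ltW gr))); first by rewrite QE.
rewrite lte_fin sqr_sqrtr ?(ltW r20)//.
have -> : (1 + e^-1) * (D / (4 * (1 + e^-1))) = D / 4.
  by move: e1; move: (1 + e^-1) => c c0; field; exact: lt0r_neq0.
have : e * Q <= D / 2.
  rewrite /e invfM mulrA -mulrA ler_piMr ?divr_ge0 ?(ltW D0)//.
  by rewrite mulrC ler_pdivrMr// mul1r lerDl.
by rewrite /D; lra.
Qed.

Lemma compact_Hs_bounded (K : set (Hs R d m s)) : compact K ->
  exists2 Q : R, 0 <= Q & forall f : Hs R d m s, K f -> (Hs_sqnorm s f <= Q%:E)%E.
Proof.
move=> /compact_near_coveringP/(_ nat \oo%classic
  (fun n (f : Hs R d m s) => (Hs_sqnorm s f < n%:R%:E)%E)).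
case=> [f Kf|n _ H].
  pose Q := fine (Hs_sqnorm s f).
  have QE : Hs_sqnorm s f = Q%:E.
    by rewrite /Q fineK// ge0_fin_numE ?Hs_sqnorm_ge0//; exact: Hs_finite.
  have [n Qn] : exists n : nat, Q < n%:R.
    by exists (Num.trunc `|Q|).+1; rewrite (le_lt_trans (ler_norm _))// truncnS_gt.
  exists ([set f : Hs R d m s | (Hs_sqnorm s f < n%:R%:E)%E], [set k | (n <= k)%N]) => /=.
    split; last by exists n.
    apply: open_nbhs_nbhs; split; first exact: Hs_lt_open.
    by rewrite /= QE lte_fin.
  move=> [g k] /= [gn nk]; apply: lt_le_trans gn _.
  by rewrite lee_fin ler_nat.
exists n%:R => // f Kf; apply/ltW; exact: (H n (leqnn n)).
Qed.

End HsEnergy.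

(** * Propagation of regularity and of the error through the layers *)

Section Regular.
Context {R : realType}.
Variables (d s : nat).
Hypothesis s0 : (0 < s)%N.
Local Notation normc := (@Normc.normc R).
Local Notation Re := (@complex.Re R).

Definition mean_sqr N (f : 'rV['I_N]_d -> R) : R := (N%:R ^+ d)^-1 * \sum_n f n ^+ 2.

Lemma eq_mean_sqr N (f g : 'rV['I_N]_d -> R) : f =1 g -> mean_sqr f = mean_sqr g.
Proof. by move=> fg; congr (_ * _); apply: eq_bigr => n _; rewrite fg. Qed.

Lemma le_mean_sqr N (f g : 'rV['I_N]_d -> R) : (forall n, `|f n| <= g n) ->
  mean_sqr f <= mean_sqr g.
Proof.
move=> fg; rewrite ler_wpM2l ?invr_ge0 ?exprn_ge0// ler_sum// => n _.
by rewrite -real_normK ?num_real// lerXn2r ?nnegrE// (le_trans _ (fg n)).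
Qed.

Lemma mean_sqrD N (f g : 'rV['I_N]_d -> R) :
  mean_sqr (fun n => f n + g n) <= 2 * (mean_sqr f + mean_sqr g).
Proof.
rewrite -mulrDr mulrCA ler_wpM2l ?invr_ge0 ?exprn_ge0// -big_split mulr_sumr.
rewrite ler_sum// => n _ /=; have : 0 <= (f n - g n) ^+ 2 by rewrite sqr_ge0.
by rewrite sqrrB sqrrD; lra.
Qed.

Lemma mean_sqrZ N c (f : 'rV['I_N]_d -> R) :
  mean_sqr (fun n => c * f n) = c ^+ 2 * mean_sqr f.
Proof.
rewrite /mean_sqr mulrCA; congr (_ * _); rewrite mulr_sumr.
by apply: eq_bigr => n _; rewrite exprMn.
Qed.

Lemma mean_sqr_le N (f : 'rV['I_N]_d -> R) c : (0 < N)%N ->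
  (forall n, f n ^+ 2 <= c) -> mean_sqr f <= c.
Proof.
move=> N0 fc; rewrite /mean_sqr ler_pdivrMl ?exprn_gt0 ?ltr0n//.
by rewrite (le_trans (sum_le_card fc))// card_grid natrX.
Qed.

Section Family.
Variables (T : Type) (P : set T).

(* The bounds are uniform over the parameters a in P. *)
Definition regular_family (F : T -> 'rV[R]_d -> R) :=
  exists A Q : R, [/\ 0 <= A, 0 <= Q & forall a, P a ->
    [/\ continuous (F a), (forall x, `|F a x| <= A) & smooth_grid s Q (F a)]].

Lemma eq_regular F G : (forall a x, P a -> F a x = G a x) ->
  regular_family F -> regular_family G.
Proof.
move=> FG [A [Q [A0 Q0 H]]]; exists A, Q; split=> // a Pa.
have <- : F a = G a by apply/funext => x; exact: FG.
exact: H.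
Qed.

Lemma regularD F G : regular_family F -> regular_family G ->
  regular_family (fun a x => F a x + G a x).
Proof.
move=> [A [Q [A0 Q0 H]]] [A' [Q' [A'0 Q'0 H']]].
exists (A + A'), (2 * (Q + Q')); split; rewrite ?addr_ge0 ?mulr_ge0 ?addr_ge0//.
move=> a Pa; have [cF bF sF] := H a Pa; have [cG bG sG] := H' a Pa; split.
- by move=> x; apply: continuousD; [exact: cF|exact: cG].
- by move=> x; rewrite (le_trans (ler_normD _ _))// lerD.
move=> N i N0; rewrite -/(mean_sqr _).
rewrite (@eq_mean_sqr _ _ (fun n => difn (gshift i) s (@pts R d N (F a)) n +
  difn (gshift i) s (@pts R d N (G a)) n)); last by move=> n; exact: difnD.
rewrite (le_trans (mean_sqrD _ _))// -mulrA ler_wpM2l// mulrDl.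
by rewrite lerD//; [exact: sF|exact: sG].
Qed.

Lemma regularZ c F : regular_family F -> regular_family (fun a x => c * F a x).
Proof.
move=> [A [Q [A0 Q0 H]]].
exists (`|c| * A), (c ^+ 2 * Q); split; [exact: mulr_ge0|by rewrite mulr_ge0 ?sqr_ge0|].
move=> a Pa; have [cF bF sF] := H a Pa; split.
- move=> x; apply: (@continuous_comp _ _ _ (F a) ( *%R c)); first exact: cF.
  exact: mulrl_continuous.
- by move=> x; rewrite normrM ler_wpM2l.
move=> N i N0; rewrite -/(mean_sqr _).
rewrite (@eq_mean_sqr _ _ (fun n => c * difn (gshift i) s (@pts R d N (F a)) n)).
  by rewrite mean_sqrZ -mulrA ler_wpM2l ?sqr_ge0//; exact: sF.
by move=> n; exact: difnZl.
Qed.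

Lemma regular_cst c : regular_family (fun _ _ => c).
Proof.
exists `|c|, 0; split=> // a _; split=> //; first by move=> x; exact: cst_continuous.
move=> N i N0; rewrite mul0r -/(mean_sqr _).
rewrite (@eq_mean_sqr _ _ (fun=> 0)) /mean_sqr.
  by rewrite expr0n big1 ?mulr0.
by case: s s0 => // r _ n; exact: difn_cst.
Qed.

Lemma regular_sum (I : finType) (F : I -> T -> 'rV[R]_d -> R) :
  (forall i, regular_family (F i)) -> regular_family (fun a x => \sum_i F i a x).
Proof.
move=> HF; elim: (index_enum I) => [|i r IH].
  by apply: eq_regular (regular_cst 0) => a x _; rewrite big_nil.
by apply: eq_regular (regularD (HF i) IH) => a x _; rewrite big_cons.
Qed.

Lemma regular_wave k (z : T -> R[i]) (Z : R) : (forall a, P a -> normc (z a) <= Z) ->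
  regular_family (fun a x => Re (wave k x * z a)).
Proof.
(* [Z] is known to be nonnegative only once some parameter lies in [P]. *)
move=> zZ; have [[a Pa]|nP] := pselect (exists a, P a); last first.
  by exists 0, 0; split=> // a Pa; case: nP; exists a.
have Z0 : 0 <= Z := le_trans (normc_ge0 _) (zZ a Pa).
(* Each difference in direction i multiplies the wave by a number of modulus at most 4 pi |k_i| / N,
   so the s-th one is at most D i / N^s. *)
pose D i : R := (4 * pi * `|(k ord0 i)%:~R|) ^+ s * Z.
have D0 i : 0 <= D i ^+ 2 by rewrite sqr_ge0.
exists Z, (\sum_i D i ^+ 2); split=> //; first exact: sumr_ge0.
move=> {Pa} {}a Pa; split.
- have -> : (fun x => Re (wave k x * z a)) = (fun x =>
      complex.Re (z a) * cos (- (2 * pi * inner (- k) x)) +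
      (- complex.Im (z a)) * sin (- (2 * pi * inner (- k) x))).
    apply/funext => x; rewrite /wave !innerNl mulrN opprK.
    by case: (z a) => u v /=; ring.
  have ccst c : continuous (fun _ : 'rV[R]_d => c : R).
    by move=> x; exact: cst_continuous.
  have c1 := phase_continuous (k := - k) (@continuous_cos R) (ccst (complex.Re (z a))).
  have c2 := phase_continuous (k := - k) (@continuous_sin R) (ccst (- complex.Im (z a))).
  by move=> x; exact: (continuousD (c1 x) (c2 x)).
- move=> x; rewrite (le_trans (Re_le_normc _))// Normc.normcM normc_wave mul1r.
  exact: zZ.
move=> N i N0; rewrite -/(mean_sqr _); apply: mean_sqr_le => // n.
have NR : 0 < N%:R :> R by rewrite ltr0n.
have -> : difn (gshift i) s (@pts R d N (fun x => Re (wave k x * z a))) n =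
    Re (((cis (2 * pi * ((k ord0 i)%:~R / N%:R)) - 1) ^+ s * wave k (gridpt R n)) * z a).
  rewrite -difn_wave [in RHS]mulrC -difnZl -difn_Re.
  by apply: eq_difn => g; rewrite /pts mulrC.
rewrite -real_normK ?num_real//.
apply: (@le_trans _ _ ((D i / N%:R ^+ s) ^+ 2)).
  rewrite lerXn2r ?nnegrE ?divr_ge0 ?mulr_ge0 ?exprn_ge0 ?mulr_ge0 ?pi_ge0//.
  rewrite (le_trans (Re_le_normc _))// !Normc.normcM normc_wave mulr1 normcX.
  rewrite /D [leRHS]mulrAC -expr_div_n ler_pM ?exprn_ge0 ?normc_ge0 ?zZ//.
  rewrite lerXn2r ?nnegrE ?normc_ge0 ?divr_ge0 ?mulr_ge0 ?pi_ge0//.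
  rewrite (le_trans (dist_cis_le _))// !normrM normfV (gtr0_norm NR).
  by rewrite (ger0_norm (pi_ge0 R)) (ger0_norm (ler0n R 2)) !mulrA -[4]/((2 * 2)%:R) natrM.
rewrite expr_div_n -exprM mulnC ler_wpM2r ?invr_ge0 ?exprn_ge0//.
by rewrite (bigD1 i)//= lerDl sumr_ge0.
Qed.

Definition regular_vec m (v : T -> 'rV[R]_d -> 'cV[R]_m) :=
  forall c, regular_family (fun a x => v a x c ord0).

Lemma regular_vec_uniform m (v : T -> 'rV[R]_d -> 'cV[R]_m) : regular_vec v ->
  exists A Q : R, [/\ 0 <= A, 0 <= Q & forall a, P a -> forall c,
    [/\ continuous (fun x => v a x c ord0), (forall x, `|v a x c ord0| <= A) &
        smooth_grid s Q (fun x => v a x c ord0)]].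
Proof.
move=> /fin_all_exists[A /fin_all_exists[Q H]].
have A0 c : 0 <= A c by case: (H c).
have Q0 c : 0 <= Q c by case: (H c).
exists (\sum_c A c), (\sum_c Q c); split; try exact: sumr_ge0.
move=> a Pa c; have [_ _ /(_ a Pa)[cv bv sv]] := H c; split=> //.
  by move=> x; rewrite (le_trans (bv x))// (bigD1 c)//= lerDl sumr_ge0.
move=> N i N0; rewrite (le_trans (sv N i N0))// ler_wpM2r ?invr_ge0 ?exprn_ge0//.
by rewrite (bigD1 c)//= lerDl sumr_ge0.
Qed.

Lemma continuous_vec m (v : 'rV[R]_d -> 'cV[R]_m) :
  (forall c, continuous (fun x => v x c ord0)) -> continuous v.
Proof.
move=> cv x; have FF : Filter (nbhs x) by exact: nbhs_filter.
apply/cvgrPdist_lt => e e0.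
have H : \forall y \near x, forall c, `|v x c ord0 - v y c ord0| < e.
  apply: (@filter_forall _ _ (fun (c : 'I_m) (y : 'rV[R]_d) =>
    `|v x c ord0 - v y c ord0| < e) (nbhs x) FF) => c.
  by have /cvgrPdist_lt := cv c x; apply.
apply: filterS H => y H.
rewrite /Num.norm/= mx_normrE; apply/bigmax_ltP; split=> // -[c j] _.
by rewrite !mxE (ord1 j).
Qed.

Lemma regular_act m n (sigma : 'cV[R]_m -> 'cV[R]_n) (B : R)
    (v : T -> 'rV[R]_d -> 'cV[R]_m) : 0 <= B -> smooth sigma ->
  glob_lipschitz sigma -> deriv_bounded s B sigma -> regular_vec v ->
  regular_vec (fun a x => sigma (v a x)).
Proof.
move=> B0 sm lip db rv c; have [A [Q [A0 Q0 H]]] := regular_vec_uniform rv.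
have [A' A'0 hA'] := lip_bounded A lip.
have [C C0 hC] := composition_bound A s0 B0 sm lip db.
exists A', (C * (m%:R * Q)); split; rewrite ?mulr_ge0//.
move=> a Pa; split.
- have cv : continuous (v a) by apply: continuous_vec => c'; case: (H a Pa c').
  move=> x; apply: (@continuous_comp _ _ _ (fun x => sigma (v a x))
     (fun w : 'cV[R]_n => w c ord0)); last exact: coord_continuous.
  apply: (@continuous_comp _ _ _ (v a) sigma); first exact: cv.
  exact: (differentiable_continuous (sm [::] (v a x))).
- by move=> x; apply: hA' => i; have [_ bv _] := H a Pa i.
move=> N i N0.
apply: (@le_trans _ _ ((N%:R ^+ d)^-1 * (C * \sum_c
    \sum_g difn (gshift i) s (@pts R d N (fun x => v a x c ord0)) g ^+ 2))).
  rewrite ler_wpM2l ?invr_ge0 ?exprn_ge0//.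
  apply: (hC _ _ (fun n => v a (gridpt R n)) (@gshift_inj N d i)) => g c'.
  by have [_ bv _] := H a Pa c'.
rewrite mulrCA -!mulrA ler_wpM2l// mulr_sumr -[X in X%:R * _](card_ord m).
by apply: sum_le_card => c'; have [_ _ sv] := H a Pa c'; exact: sv.
Qed.

Lemma regular_affine m n (W : 'M[R]_(n, m)) (b : 'cV[R]_n)
    (v : T -> 'rV[R]_d -> 'cV[R]_m) : regular_vec v ->
  regular_vec (fun a x => W *m v a x + b).
Proof.
move=> rv c; apply: (@eq_regular (fun a x =>
  (\sum_e W c e * v a x e ord0) + b c ord0)); first by move=> a x _; rewrite !mxE.
by apply: regularD; [apply: regular_sum => e; exact: regularZ|exact: regular_cst].
Qed.

Lemma cube_int_le (f : 'rV[R]_d -> R) A : continuous f -> (forall x, `|f x| <= A) ->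
  `|cube_int f| <= A.
Proof.
move=> cf fA; have c0 : continuous (fun _ : 'rV[R]_d => 0 : R).
  by move=> x; exact: cst_continuous.
have i0 : cube_int (fun _ : 'rV[R]_d => 0 : R) = 0.
  have := cube_intD c0 c0; under eq_fun do rewrite addr0.
  lra.
rewrite -[cube_int f]subr0 -i0; apply: cube_int_dist => // x _.
by rewrite subr0.
Qed.

Lemma normc_sfhat_le (F : 'rV[R]_d -> R) k A : continuous F -> (forall x, `|F x| <= A) ->
  normc (sfhat F k) <= 2 * A.
Proof.
move=> cF FA; have A0 : 0 <= A := le_trans (normr_ge0 _) (FA 0).
rewrite (le_trans (normc_le_ReIm _))// Re_sfhat Im_sfhat [2 * A]mulr_natl mulr2n lerD//.
  apply: cube_int_le => [|x]; first exact: (phase_continuous (@continuous_cos R)).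
  by rewrite normrM -[A]mulr1 ler_pM// ler_norml cos_geN1 cos_le1.
apply: cube_int_le => [|x]; first exact: (phase_continuous (@continuous_sin R)).
by rewrite normrM -[A]mulr1 ler_pM// ler_norml sin_geN1 sin_le1.
Qed.

Lemma kernel_opE K m n (Pk : 'rV[int]_d -> 'M[R[i]]_(n, m)) v x c :
  kernel_op K Pk v x c ord0 = \sum_(j : 'rV['I_K]_d) wave (freq j) x *
    \sum_e Pk (freq j) c e * sfhat (fun x => v x e ord0) (freq j).
Proof.
rewrite summxE; apply: eq_bigr => j _; rewrite !mxE; congr (_ * _).
by apply: eq_bigr => e _; rewrite fhatE.
Qed.

(** The output frequencies are fixed and finite in number, and the sup bound on [v] bounds their
    coefficients uniformly in the parameter. *)
Lemma regular_kernel K m n (Pk : 'rV[int]_d -> 'M[R[i]]_(n, m))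
    (v : T -> 'rV[R]_d -> 'cV[R]_m) : regular_vec v ->
  regular_vec (fun a x => map_mx Re (kernel_op K Pk (v a) x)).
Proof.
move=> rv c; have [A [Q [A0 Q0 H]]] := regular_vec_uniform rv.
pose F (j : 'rV['I_K]_d) a x := Re (wave (freq j) x *
    \sum_e Pk (freq j) c e * sfhat (fun x => v a x e ord0) (freq j)).
apply: (@eq_regular (fun a x => \sum_j F j a x)).
  by move=> a x _; rewrite mxE kernel_opE Re_sum.
apply: regular_sum => j.
apply: (@regular_wave _ _ (\sum_e normc (Pk (freq j) c e) * (2 * A))) => a Pa.
rewrite (le_trans (normc_sum _ _ _))// ler_sum// => e _.
rewrite Normc.normcM ler_wpM2l ?normc_ge0//.
by have [cv bv _] := H a Pa e; exact: normc_sfhat_le.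
Qed.

End Family.
End Regular.

(** * Families of grid functions with mean square O(N^(-2s)) *)

Section Small.
Context {R : realType}.
Variables (d s K : nat) (T : Type) (P : set T).
Hypothesis s0 : (0 < s)%N.
Local Notation normc := (@Normc.normc R).
Local Notation Re := (@complex.Re R).

Definition small_family (f : T -> forall N, 'rV['I_N]_d -> R) :=
  exists2 C : R, 0 <= C & forall a N, P a -> (0 < N)%N -> (2 * K < N)%N ->
    mean_sqr (@f a N) <= C / N%:R ^+ (2 * s).

Lemma le_small (f g : T -> forall N, 'rV['I_N]_d -> R) :
  (forall a N n, P a -> `|f a N n| <= g a N n) -> small_family g -> small_family f.
Proof.
move=> fg [C C0 H]; exists C => // a N Pa N0 KN.
by apply: le_trans (H a N Pa N0 KN); apply: le_mean_sqr => n; exact: fg.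
Qed.

Lemma small_norm (f : T -> forall N, 'rV['I_N]_d -> R) :
  small_family f -> small_family (fun a N n => `|f a N n|).
Proof.
move=> [C C0 H]; exists C => // a N Pa N0 KN.
apply: le_trans (H a N Pa N0 KN); rewrite le_eqVlt; apply/orP; left; apply/eqP.
by congr (_ * _); apply: eq_bigr => n _; rewrite real_normK ?num_real.
Qed.

Lemma small0 : small_family (fun _ _ _ => 0).
Proof.
exists 0 => // a N _ _ _.
by rewrite mul0r /mean_sqr expr0n big1 ?mulr0.
Qed.

Lemma smallD (f g : T -> forall N, 'rV['I_N]_d -> R) :
  small_family f -> small_family g -> small_family (fun a N n => f a N n + g a N n).
Proof.
move=> [C C0 H] [C' C'0 H']; exists (2 * (C + C')); first by rewrite mulr_ge0 ?addr_ge0.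
move=> a N Pa N0 KN; rewrite (le_trans (mean_sqrD _ _))// -mulrA ler_wpM2l// mulrDl.
by rewrite lerD//; [exact: H|exact: H'].
Qed.

Lemma smallZ c (f : T -> forall N, 'rV['I_N]_d -> R) :
  small_family f -> small_family (fun a N n => c * f a N n).
Proof.
move=> [C C0 H]; exists (c ^+ 2 * C); first by rewrite mulr_ge0 ?sqr_ge0.
move=> a N Pa N0 KN; rewrite mean_sqrZ -mulrA ler_wpM2l ?sqr_ge0//; exact: H.
Qed.

Lemma small_sum (I : finType) (f : I -> T -> forall N, 'rV['I_N]_d -> R) :
  (forall i, small_family (f i)) -> small_family (fun a N n => \sum_i f i a N n).
Proof.
move=> Hf; elim: (index_enum I) => [|i r IH].
  by apply: le_small small0 => a N n _; rewrite big_nil normr0.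
apply: le_small (small_norm (smallD (Hf i) IH)) => a N n _.
by rewrite big_cons.
Qed.

Lemma small_cst (z : T -> nat -> R) :
  (exists2 C : R, 0 <= C & forall a N, P a -> (0 < N)%N -> (2 * K < N)%N ->
    z a N ^+ 2 <= C / N%:R ^+ (2 * s)) ->
  small_family (fun a N _ => z a N).
Proof.
move=> [C C0 H]; exists C => // a N Pa N0 KN.
by apply: mean_sqr_le => // _; exact: H.
Qed.

(** The retained frequencies satisfy |k_i| <= K/2, so 4 |k_i| <= 2K < N: the condition K < N/2 is
    exactly what the aliasing estimate asks for. *)
Lemma freq_le (j : 'rV['I_K]_d) N i : (2 * K < N)%N -> (4 * `|freq j ord0 i| <= N)%N.
Proof. by move=> KN; rewrite mxE; have := ltn_ord (j ord0 i); lia. Qed.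

Definition small_vec m (v : T -> forall N, 'rV['I_N]_d -> 'cV[R]_m) :=
  forall c, small_family (fun a N n => v a N n c ord0).

Lemma dkernel_opE N m n (Pk : 'rV[int]_d -> 'M[R[i]]_(n, m))
    (v : 'rV['I_N]_d -> 'cV[R]_m) l c :
  dkernel_op K Pk v l c ord0 = \sum_(j : 'rV['I_K]_d) wave (freq j) (gridpt R l) *
    \sum_e Pk (freq j) c e * sdft (fun n => v n e ord0) (freq j).
Proof.
rewrite summxE; apply: eq_bigr => j _; rewrite !mxE; congr (_ * _).
by apply: eq_bigr => e _; rewrite DFTE.
Qed.

Lemma sdftB N (f g : 'rV['I_N]_d -> R) k :
  sdft (fun n => f n - g n) k = sdft f k - sdft g k.
Proof.
rewrite /sdft -mulrBr -sumrB; congr (_ * _).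
by apply: eq_bigr => n _; rewrite rmorphB/= mulrBl.
Qed.

(** Through the DFT of the exact state: one part is its aliasing error, the other the DFT of the
    error made so far, which Cauchy-Schwarz bounds by its mean square without loss in N. *)
Lemma small_dft m (v : T -> 'rV[R]_d -> 'cV[R]_m)
    (w : T -> forall N, 'rV['I_N]_d -> 'cV[R]_m) (j : 'rV['I_K]_d) e :
  regular_vec s P v ->
  small_vec (fun a N n => v a (gridpt R n) - w a N n) ->
  small_family (fun a N _ => normc (sfhat (fun x => v a x e ord0) (freq j) -
    sdft (fun n => w a N n e ord0) (freq j))).
Proof.
move=> rv sw; have [A [Q [A0 Q0 H]]] := regular_vec_uniform rv.
have [C C0 HC] := sw e.
pose D : R := 2 * (2 ^+ d * Num.sqrt Q).
apply: small_cst; exists (2 * (D ^+ 2 + C)); first by rewrite mulr_ge0 ?addr_ge0 ?sqr_ge0.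
move=> a N Pa N0 KN; have [cv bv sv] := H a Pa e.
set F := fun x => v a x e ord0; set g := fun n => _.
have NR : 0 < N%:R :> R by rewrite ltr0n.
rewrite -(subrKA (sdft (@pts R d N F) (freq j))).
apply: le_trans (normc_sqrD_le _ _ (ltr01 : 0 < 1 :> R)) _.
rewrite invr1 -[1 + 1]/(2%:R : R) -mulrDr -mulrA ler_wpM2l// mulrDl lerD//.
  rewrite -opprB normcN.
  rewrite mulnC exprM -expr_div_n lerXn2r ?nnegrE ?normc_ge0//.
    by rewrite divr_ge0 ?exprn_ge0 ?mulr_ge0 ?exprn_ge0 ?sqrtr_ge0.
  by apply: sdft_sfhat sv => // i; exact: freq_le.
rewrite -sdftB (le_trans (normc_sdft_sqr_le _ _))//.
apply: le_trans (HC a N Pa N0 KN); rewrite le_eqVlt; apply/orP; left; apply/eqP.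
by congr (_ * _); apply: eq_bigr => n _; rewrite !mxE.
Qed.

Lemma small_kernel m n (Pk : 'rV[int]_d -> 'M[R[i]]_(n, m))
    (v : T -> 'rV[R]_d -> 'cV[R]_m) (w : T -> forall N, 'rV['I_N]_d -> 'cV[R]_m) :
  regular_vec s P v ->
  small_vec (fun a N n => v a (gridpt R n) - w a N n) ->
  small_vec (fun a N l => map_mx Re (kernel_op K Pk (v a) (gridpt R l)) -
    map_mx Re (dkernel_op K Pk (w a N) l)).
Proof.
move=> rv sw c.
apply: (@le_small _ (fun a N l => \sum_(j : 'rV['I_K]_d) \sum_e
   normc (Pk (freq j) c e) * normc (sfhat (fun x => v a x e ord0) (freq j) -
      sdft (fun n => w a N n e ord0) (freq j)))); last first.
  by apply: small_sum => j; apply: small_sum => e; apply: smallZ; exact: small_dft.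
move=> a N l Pa; rewrite !mxE kernel_opE dkernel_opE -ReB -sumrB.
rewrite (le_trans (Re_le_normc _))// (le_trans (normc_sum _ _ _))//.
rewrite ler_sum// => j _; rewrite -mulrBr Normc.normcM normc_wave mul1r -sumrB.
rewrite (le_trans (normc_sum _ _ _))// ler_sum// => e _.
by rewrite -mulrBr Normc.normcM.
Qed.

Lemma small_act m n (sigma : 'cV[R]_m -> 'cV[R]_n)
    (u w : T -> forall N, 'rV['I_N]_d -> 'cV[R]_m) :
  glob_lipschitz sigma -> small_vec (fun a N l => u a N l - w a N l) ->
  small_vec (fun a N l => sigma (u a N l) - sigma (w a N l)).
Proof.
move=> [L lip] sw c.
apply: (@le_small _ (fun a N l => `|L| * \sum_e `|(u a N l - w a N l) e ord0|)).
  move=> a N l _; rewrite (le_trans (coord_le_enorm _ _))// (le_trans (lip _ _))//.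
  rewrite (le_trans (ler_wpM2r (enorm_ge0 _) (ler_norm L)))// ler_wpM2l//.
  exact: enorm_le_sum.
by apply: smallZ; apply: small_sum => e; exact: small_norm.
Qed.

Lemma smallD_vec m (v w : T -> forall N, 'rV['I_N]_d -> 'cV[R]_m) :
  small_vec v -> small_vec w -> small_vec (fun a N l => v a N l + w a N l).
Proof.
move=> sv sw c; apply: le_small (small_norm (smallD (sv c) (sw c))) => a N l _.
by rewrite mxE.
Qed.

Lemma small_mulmx m n (W : 'M[R]_(n, m)) (v : T -> forall N, 'rV['I_N]_d -> 'cV[R]_m) :
  small_vec v -> small_vec (fun a N l => W *m v a N l).
Proof.
move=> sv c; apply: (@le_small _ (fun a N l => `|\sum_e W c e * v a N l e ord0|)).
  by move=> a N l _; rewrite mxE.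
by apply: small_norm; apply: small_sum => e; exact: smallZ.
Qed.

End Small.

(** * Regularity of the states and bound on their error *)

Section Conclusion.
Context {R : realType}.
Variables (d da du s : nat) (Psi : FNO R d da du) (B : R).
Hypotheses (d0 : (0 < d)%N) (ds : (d < 2 * s)%N) (B0 : 0 <= B).
Hypothesis hA1 : act_deriv_bounded Psi s B.
Variable Ac : set (Hs R d da s).
Hypothesis cAc : compact Ac.

Let s0 : (0 < s)%N. Proof. by case: (s) ds => //; rewrite muln0. Qed.

Lemma regular_input : regular_vec s Ac (fun a => Hs_fun a).
Proof.
have [Q Q0 HQ] := compact_Hs_bounded cAc.
have [A A0 [C C0 HC]] := @sobolev_grid R d s d0 ds.
move=> c; exists (A + Q), (C * Q); split; rewrite ?addr_ge0 ?mulr_ge0//.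
move=> a Aca; have ca : continuous (fun x => a x c ord0).
  by apply: coord_fun_continuous; exact: Hs_continuous.
have ta : torus_fun (fun x => a x c ord0) by move=> x k; rewrite (Hs_periodic a).
by have [] := HC _ Q ca ta (Hs_sqnorm_energy (HQ a Aca) c).
Qed.

Lemma regular_state t : (t <= fno_depth Psi)%N ->
  regular_vec s Ac (fun a => state Psi a t).
Proof.
have [actb liftb _] := hA1.
elim: t => [_|t IH tT].
  apply: (regular_act s0 B0 (sh_smooth _) (sh_lipschitz _) liftb).
  exact: (regular_affine s0 _ _ regular_input).
apply: (regular_act s0 B0 (fno_act_smooth tT) (fno_act_lipschitz tT) (actb t tT)).
move=> c; have rv := IH (ltnW tT).
apply: eq_regular (regularD (regular_affine s0 (fno_W Psi t) (fno_b Psi t) rv c)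
   (regular_kernel s0 (fno_modes Psi) (fno_P Psi t) rv c)) => a x _.
transitivity ((fno_W Psi t *m state Psi a t x + fno_b Psi t + map_mx (@complex.Re R)
  (kernel_op (fno_modes Psi) (fno_P Psi t) (state Psi a t) x)) c ord0).
  by rewrite [RHS]mxE.
by rewrite addrAC.
Qed.

Lemma small_error t : (t <= fno_depth Psi)%N ->
  small_vec s (fno_modes Psi) Ac
    (fun a N n => state Psi a t (gridpt R n) - dstate Psi a t n).
Proof.
elim: t => [_ c|t IH tT].
  apply: le_small (small0 _ _ _ _) => a N n _.
  by rewrite subrr mxE normr0.
have sv := IH (ltnW tT).
pose W := fno_W Psi t; pose b := fno_b Psi t.
pose k (a : Hs R d da s) x := map_mx (@complex.Re R)
  (kernel_op (fno_modes Psi) (fno_P Psi t) (state Psi a t) x).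
pose dk (a : Hs R d da s) N (n : 'rV['I_N]_d) := map_mx (@complex.Re R)
  (dkernel_op (fno_modes Psi) (fno_P Psi t) (dstate Psi a t) n).
suff H : small_vec s (fno_modes Psi) Ac (fun a N n =>
    (W *m state Psi a t (gridpt R n) + k a (gridpt R n) + b) -
    (W *m dstate Psi a t n + dk a N n + b)).
  exact: (small_act (fno_act_lipschitz tT) H).
move=> c.
apply: le_small (small_norm (smallD_vec (small_mulmx (fno_W Psi t) sv)
  (small_kernel s0 (fno_P Psi t) (regular_state (ltnW tT)) sv) c)) => a N n _.
have -> : W *m state Psi a t (gridpt R n) + k a (gridpt R n) + b -
    (W *m dstate Psi a t n + dk a N n + b) =
    W *m (state Psi a t (gridpt R n) - dstate Psi a t n) + (k a (gridpt R n) - dk a N n).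
  by rewrite opprD addrACA subrr addr0 opprD addrACA -mulmxBr.
exact: lexx.
Qed.

Lemma grid_error_sqrE N a t : (0 < N)%N ->
  grid_error Psi N a t ^+ 2 = \sum_c mean_sqr
    (fun n : 'rV['I_N]_d => (state Psi a t (gridpt R n) - dstate Psi a t n) c ord0).
Proof.
move=> N0; rewrite exprMn sqr_sqrtr; last by apply: sumr_ge0 => *; exact: sqr_ge0.
have -> : ((N%:R `^ (d%:R / 2))^-1 : R) ^+ 2 = (N%:R ^+ d)^-1.
  rewrite exprVn -powR_mulrn ?powR_ge0// -powRrM divfK ?pnatr_eq0//.
  by rewrite powR_mulrn.
rewrite -mulr_sumr exchange_big; congr (_ * _).
by apply: eq_bigr => n _; rewrite enorm_sqr.
Qed.

Lemma grid_error_bound t : (t <= fno_depth Psi)%N ->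
  exists C : R, forall N a, (0 < N)%N -> (2 * fno_modes Psi < N)%N -> Ac a ->
    grid_error Psi N a t <= C * N%:R ^- s.
Proof.
move=> tT; have /fin_all_exists2[C C0 HC] := small_error tT.
(* The squared grid error is the sum of the mean squares of the components, so their constants add
   up under the root. *)
exists (Num.sqrt (\sum_c C c)) => N a N0 KN Aca.
have S0 : 0 <= \sum_c C c by exact: sumr_ge0.
rewrite -(ler_pXn2r (ltn0Sn 1)) ?nnegrE ?mulr_ge0 ?invr_ge0 ?exprn_ge0 ?powR_ge0 ?sqrtr_ge0//.
rewrite grid_error_sqrE// exprMn sqr_sqrtr// exprVn -exprM [(s * 2)%N]mulnC mulr_suml.
by apply: ler_sum => c _; exact: HC.
Qed.

End Conclusion.

Theorem theorem3p2 (R : realType) (d da du s : nat) (hd : (0 < d)%N)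
    (Psi : FNO R d da du) (B M : R)
    (hB : 1 <= B) (hA1 : act_deriv_bounded Psi s B)
    (A : set (Hs R d da s))
    (hs : (d < 2 * s)%N)
    (hM : 1 <= M) (hA5 : params_bounded Psi M)
    (Ac : set (Hs R d da s)) (hAc : Ac `<=` A) (cAc : compact Ac)
    (t : nat) (ht : (1 <= t <= fno_depth Psi)%N) :
  exists C : R, forall N : nat, (1 < N)%N -> (2 * fno_modes Psi < N)%N ->
    (ereal_sup [set (grid_error Psi N a t)%:E | a in Ac]
       <= (C * N%:R ^- s)%:E)%E.
Proof.
have /andP[_ tT] := ht.
have [C HC] := grid_error_bound hd hs (le_trans ler01 hB) hA1 cAc tT.
exists C => N N1 KN; apply: ge_ereal_sup => _ [a Aca <-].
by rewrite lee_fin; apply: HC => //; exact: ltnW.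
Qed.
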